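(* Let $\Omega$ be a smooth bounded domain in $\mathbb{R}^N$, $N\geq 2$. Let $s:\mathbb{R}^N\times\mathbb{R}^N\to\mathbb{R}$ be continuous and symmetric with $0<s^-\leq s^+<1$; let $p\in C_+(\mathbb{R}^N\times\mathbb{R}^N)$ be continuous and symmetric with $s^+p^+<N$; let $\mu:\mathbb{R}^N\times\mathbb{R}^N\to\mathbb{R}$ be symmetric with $0<\mu^-\leq\mu^+<N$. Let $q\in C_+(\mathbb{R}^N\times\mathbb{R}^N)$ satisfy $\frac{2}{q(x,y)}+\frac{\mu(x,y)}{N}=2$ for all $(x,y)$. Let $f:\Omega\times\mathbb{R}\to\mathbb{R}$ be a Carathéodory function, $F(x,t):=\int_0^t f(x,\tau)\,d\tau$, and assume: (F1) there exist $M>0$ and $r\in C_+(\mathbb{R}^N)$ with $p(x,x)\leq r(x)q^-\leq r(x)q^+<p_s^*(x):=\frac{Np(x,x)}{N-s(x,x)p(x,x)}$ for all $x\in\mathbb{R}^N$ and $r^->p^+$, such that $|f(x,t)|\leq M|t|^{r(x)-1}$ for all $(x,t)\in\Omega\times\mathbb{R}$; (F2) there exists $\Theta>p^+$ such that $0<\Theta F(x,t)\leq 2tf(x,t)$ for all $t\neq0$ and a.e. $x\in\Omega$. Let $\alpha\in C_+(\overline\Omega)$ with $\alpha^+<p^-$. Then there exists $\Lambda>0$ such that for all $\lambda\in(0,\Lambda)$ the problem $$(-\Delta)^{s(\cdot)}_{p(\cdot)}u(x)=\lambda|u(x)|^{\alpha(x)-2}u(x)+\left(\int_\Omega\frac{F(y,u(y))}{|x-y|^{\mu(x,y)}}dy\right)f(x,u(x))\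 \text{in }\Omega,\qquad u=0\ \text{in }\mathbb{R}^N\setminus\Omega$$ admits at least two distinct nontrivial weak solutions, where $u\in X_0$ is a weak solution if for every $w\in X_0$, $$\int_{\mathbb{R}^N\times\mathbb{R}^N}\frac{|u(x)-u(y)|^{p(x,y)-2}(u(x)-u(y))(w(x)-w(y))}{|x-y|^{N+s(x,y)p(x,y)}}dxdy=\lambda\int_\Omega|u|^{\alpha(x)-2}uw\,dx+\int_\Omega\int_\Omega\frac{F(x,u(x))f(y,u(y))w(y)}{|x-y|^{\mu(x,y)}}dxdy.$$
   Context: $\Phi^\pm$ denote $\sup/\inf$ of $\Phi$ over its domain; $C_+(\mathcal D)=\{\Phi\in C(\mathcal D,\mathbb{R}):1<\Phi^-\leq\Phi^+<\infty\}$. The operator is $(-\Delta)^{s(\cdot)}_{p(\cdot)}u(x)=P.V.\int_{\mathbb{R}^N}\frac{|u(x)-u(y)|^{p(x,y)-2}(u(x)-u(y))}{|x-y|^{N+s(x,y)p(x,y)}}dy$. With $Q:=(\mathbb{R}^N\times\mathbb{R}^N)\setminus(\Omega^c\times\Omega^c)$, $X_0$ is the space of measurable $u:\mathbb{R}^N\to\mathbb{R}$ with $u|_\Omega\in L^{p(x,x)}(\Omega)$, $\int_Q\frac{|u(x)-u(y)|^{p(x,y)}}{\lambda^{p(x,y)}|x-y|^{N+s(x,y)p(x,y)}}dxdy<\infty$ for some $\lambda>0$, and $u=0$ a.e. in $\mathbb{R}^N\setminus\Omega$, with norm $\|u\|_{X_0}=\inf\{\lambda>0:\int_{\mathbb{R}^N\times\mathbb{R}^N}\frac{|u(x)-u(y)|^{p(x,y)}}{\lambda^{p(x,y)}|x-y|^{N+s(x,y)p(x,y)}}dxdy<1\}$.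 *)

(* Defs.v *)
From HB Require Import structures.
From mathcomp Require Import all_boot all_order all_algebra.
From mathcomp Require Import all_classical all_reals all_analysis.
Import Order.TTheory GRing.Theory Num.Theory.
Import numFieldNormedType.Exports.

Set Implicit Arguments.
Unset Strict Implicit.
Unset Printing Implicit Defensive.

Local Open Scope classical_set_scope.
Local Open Scope ring_scope.

(* Product of two sigma-finite measures, as a sigma-finite measure          *)
(* (the library's product m1 \x m2, with its sigma-finiteness registered).  *)
Section prodm.
Local Open Scope ereal_scope.
Context d1 d2 (T1 : measurableType d1) (T2 : measurableType d2) (R : realType).
Variable m1 : {sigma_finite_measure set T1 -> \bar R}.
Variable m2 : {sigma_finite_measure set T2 -> \bar R}.
Definition prodm : set (T1 * T2)%type -> \bar R := (m1 \x m2).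
HB.instance Definition _ := Measure.copy prodm (m1 \x m2).
Lemma prodm_sigma_finite : sigma_finite setT prodm.
Proof.
have /sigma_finiteP[F [TF ndF Foo]] := sigma_finiteT m1.
have /sigma_finiteP[G [TG ndG Goo]] := sigma_finiteT m2.
exists (fun n => F n `*` G n).
 rewrite -setXTT TF TG predeqE => -[x y]; split.
    move=> [/= [n _ Fnx] [k _ Gky]]; exists (maxn n k) => //; split.
    - by move: x Fnx; exact/subsetPset/ndF/leq_maxl.
    - by move: y Gky; exact/subsetPset/ndG/leq_maxr.
  by move=> [n _ []/= ? ?]; split; exists n.
move=> k; have [? ?] := Foo k; have [? ?] := Goo k.
split; first exact: measurableX.
by rewrite /prodm product_measure1E// lte_mul_pinfty// ge0_fin_numE.
Qed.
HB.instance Definition _ := Measure_isSigmaFinite.Build _ _ _ prodm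
  prodm_sigma_finite.
End prodm.

(* Completion of a sigma-finite measure (Caratheodory extension of mu). *)
Section completion.
Context d (T : measurableType d) (R : realType).
Variable mu : {sigma_finite_measure set T -> \bar R}.
Definition cmpl := @completed_measure_extension _ T R mu.
HB.instance Definition _ := Measure.on cmpl.
Lemma cmpl_sigma_finite : sigma_finite setT cmpl.
Proof. exact: (completed_measure_extension_sigma_finite (sigma_finiteT mu)). Qed.
HB.instance Definition _ := Measure_isSigmaFinite.Build _ _ _ cmpl
  cmpl_sigma_finite.
End completion.

(* Lebesgue measure on R^(n+1).                                             *)
(* Rb n = R * (R * ( ... * R)) (n+1 factors) with the product Borel         *)
(* sigma-algebra; lebB n = iterated product of 1-d Lebesgue measures;        *)
(* lebN n = its completion = Lebesgue measure on R^(n+1);                   *)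
(* lebN2 n = Lebesgue measure on R^(n+1) x R^(n+1) (completed product).     *)
(* vec n identifies Rb n with row vectors 'rV[R]_(n.+1).                     *)
Section lebesgueN.
Local Unset Implicit Arguments.
Variable R : realType.
Definition RR : measurableType _ := measurableTypeR R.
Definition lebR : {sigma_finite_measure set RR -> \bar R} := @lebesgue_measure R.
Definition dispR : measure_display :=
  ltac:(let t := type of RR in match t with Measurable.type ?d => exact d end).
Fixpoint Rdisp (n : nat) : measure_display :=
  match n with 0 => dispR | n'.+1 => (dispR, Rdisp n').-prod end.
Fixpoint Rb (n : nat) : measurableType (Rdisp n) :=
  match n return measurableType (Rdisp n) with
  | 0 => RR
  | n'.+1 => (RR * Rb n')%type end.
Fixpoint lebB (n : nat) : {sigma_finite_measure set (Rb n) -> \bar R} :=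
  match n return {sigma_finite_measure set (Rb n) -> \bar R} with
  | 0 => lebR
  | n'.+1 => (@prodm _ _ _ _ _ lebR (lebB n') : {sigma_finite_measure set _ -> \bar R})
  end.
Fixpoint vec (n : nat) : Rb n -> 'rV[R]_(n.+1) :=
  match n return Rb n -> 'rV[R]_(n.+1) with
  | 0 => fun x => const_mx x
  | n'.+1 => fun x => row_mx (const_mx x.1 : 'rV[R]_1) (vec n' x.2)
  end.
Definition LN (n : nat) : measurableType _ :=
  caratheodory_type (R := R) (T := Rb n) ((lebB n)^*)%mu.
Definition lebN (n : nat) : {sigma_finite_measure set (LN n) -> \bar R} :=
  @cmpl _ _ _ (lebB n).
Definition LN2 (n : nat) : measurableType _ :=
  caratheodory_type (R := R) (T := (LN n * LN n)%type)
    ((prodm (lebN n) (lebN n))^*)%mu.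
Definition lebN2 (n : nat) : {sigma_finite_measure set (LN2 n) -> \bar R} :=
  @cmpl _ _ _ (prodm (lebN n) (lebN n)).
End lebesgueN.

(* Analysis on R^N, N = n.+1; points of R^N are row vectors 'rV[R]_N.       *)
Section RN.
Variables (R : realType) (n : nat).
Local Notation V := 'rV[R]_(n.+1).
Local Notation N := (n.+1%:R : R).

(* Euclidean norm |x| on R^N *)
Definition enorm (x : V) : R := Num.sqrt (\sum_i x ord0 i ^+ 2).

(* points of LN n / LN2 n seen in R^N / R^N x R^N *)
Definition pt (x : LN R n) : V := vec R n x.
Definition pt2 (z : LN2 R n) : V * V := (vec R n z.1, vec R n z.2).

(* Lebesgue measurability on A (a subset of R^N) *)
Definition measN (A : set V) (g : V -> R) : Prop :=
  measurable_fun (pt @^-1` A) (fun x => g (pt x)).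

(* property holding Lebesgue-almost everywhere in R^N *)
Definition aeN (P : V -> Prop) : Prop := {ae lebN R n, forall x, P (pt x)}.

(* Lebesgue integral over A of g : R^N -> R *)
Definition intN (A : set V) (g : V -> R) : \bar R :=
  (\int[lebN R n]_(x in pt @^-1` A) (g (pt x))%:E)%E.
Definition integrableN (A : set V) (g : V -> R) : Prop :=
  (lebN R n).-integrable (pt @^-1` A) (fun x => (g (pt x))%:E).

(* Lebesgue integral over A (a subset of R^N x R^N) of g : R^N -> R^N -> R *)
Definition int2N (A : set (V * V)) (g : V -> V -> R) : \bar R :=
  (\int[lebN2 R n]_(z in pt2 @^-1` A) (g (pt2 z).1 (pt2 z).2)%:E)%E.
Definition integrable2N (A : set (V * V)) (g : V -> V -> R) : Prop :=
  (lebN2 R n).-integrable (pt2 @^-1` A) (fun z => (g (pt2 z).1 (pt2 z).2)%:E).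

(* Phi^+ and Phi^- : sup and inf of Phi over its domain D *)
Definition supf {T : Type} (D : set T) (Phi : T -> R) : R := sup (Phi @` D).
Definition inff {T : Type} (D : set T) (Phi : T -> R) : R := inf (Phi @` D).

(* C_+(D) *)
Definition Cplus {T : topologicalType} (D : set T) (Phi : T -> R) : Prop :=
  {within D, continuous Phi} /\ has_lbound (Phi @` D) /\ has_ubound (Phi @` D)
  /\ 1 < inff D Phi.

(* iterated directional derivatives; C^infinity functions R^N -> R *)
Fixpoint iterD (vs : seq V) (g : V -> R) : V -> R :=
  match vs with
  | [::] => g
  | v :: vs' => 'D_v (iterD vs' g)
  end.
Definition smooth (g : V -> R) : Prop :=
  forall vs : seq V,
    (forall x v, derivable (iterD vs g) x v) /\ continuous (iterD vs g).

(* smooth bounded domain: nonempty connected bounded open set with a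
   C^infinity defining function whose gradient does not vanish on the
   boundary {phi = 0} *)
Definition smooth_bounded_domain (Om : set V) : Prop :=
  open Om /\ Om !=set0 /\ connected Om /\ bounded_set Om /\
  exists phi : V -> R, smooth phi /\ Om = [set x | phi x < 0] /\
    (forall x, phi x = 0 -> exists v : V, 'D_v phi x != 0).

(* Caratheodory function on Om x R *)
Definition caratheodory (Om : set V) (f : V -> R -> R) : Prop :=
  (forall t, measN Om (fun x => f x t)) /\
  aeN (fun x => Om x -> continuous (f x)).

(* F(x,t) = int_0^t f(x,tau) dtau *)
Definition primF (f : V -> R -> R) (x : V) (t : R) : R :=
  if 0 <= t then Rintegral (lebR R) [set` `[0, t]] (f x)
  else - Rintegral (lebR R) [set` `[t, 0]] (f x).

(* Q = R^{2N} \ (Om^c x Om^c) *)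
Definition Qset (Om : set V) : set (V * V) := [set z | ~ (~ Om z.1 /\ ~ Om z.2)].

(* the space X_0 *)
Definition X0 (Om : set V) (s p : V * V -> R) (u : V -> R) : Prop :=
  measN setT u /\
  (exists l : R, 0 < l /\
     (intN Om (fun x => ((`|u x| / l) `^ (p (x, x)))%R) < +oo)%E) /\
  (exists l : R, 0 < l /\
     (int2N (Qset Om) (fun x y =>
        (`|u x - u y| `^ (p (x, y)) /
        (l `^ (p (x, y)) * enorm (x - y) `^ (N + s (x, y) * p (x, y))))%R)
      < +oo)%E) /\
  aeN (fun x => ~ Om x -> u x = 0).

(* weak solutions of the problem *)
Definition weak_solution (Om : set V) (s p mu : V * V -> R) (alpha : V -> R)
    (f : V -> R -> R) (lam : R) (u : V -> R) : Prop :=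
  X0 Om s p u /\
  forall w, X0 Om s p w ->
    let A := fun x y => `|u x - u y| `^ (p (x, y) - 2) * (u x - u y) * (w x - w y)
                        / enorm (x - y) `^ (N + s (x, y) * p (x, y)) in
    let B := fun x => `|u x| `^ (alpha x - 2) * u x * w x in
    let C := fun x y => primF f x (u x) * f y (u y) * w y / enorm (x - y) `^ (mu (x, y)) in
    [/\ integrable2N setT A, integrableN Om B, integrable2N (Om `*` Om) C &
      int2N setT A = (lam%:E * intN Om B + int2N (Om `*` Om) C)%E].

(* u is nontrivial / u1, u2 distinct as elements of X_0 (i.e. not a.e. equal) *)
Definition nontrivial (u : V -> R) : Prop := ~ aeN (fun x => u x = 0).
Definition distinct (u1 u2 : V -> R) : Prop := ~ aeN (fun x => u1 x = u2 x).

End RN.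

(* Main.v *)
Require Import Defs.
From HB Require Import structures.
From mathcomp Require Import all_boot all_order all_algebra.
From mathcomp Require Import all_classical all_reals all_analysis.
From mathcomp Require Import measurable_realfun ring lra.
Import Order.TTheory GRing.Theory Num.Theory.
Import numFieldNormedType.Exports.
Set Implicit Arguments.
Unset Strict Implicit.
Unset Printing Implicit Defensive.
Local Open Scope classical_set_scope.
Local Open Scope ring_scope.

(* Write K(x,y) = |x-y|^-(N+sp).  Since Omega is bounded, the integral of
   K(x,.) over the complement of Omega is at least some kappa > 0 for x in
   Omega.  So cutting a function v, zero off Omega, at a small height c lowers
   its energy by at least kappa c^(p+ - 1) times the integral of (v-c)^+.
   Where |v| <= 2c <= 1 the growth |f(x,t)| <= M|t|^(p+ - 1) bounds the change
   of the lower order terms by (lam + C c^(2p+ - 1)) times the same integral,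
   which is smaller when c and lam are.  Hence, with f replaced by 0 for t < 0,
   a minimiser of the functional over 0 <= u <= c is also a minimiser over
   |v| <= 2c, and the truncated variations u + e trunc(w) give the weak
   equation.  The minimum is negative because alpha+ < p-, so u is nontrivial.
   The same argument for -f(x,-t) gives a nonpositive solution.
   A minimising sequence has an a.e. convergent subsequence because K is
   larger than any multiple of 1/|C| off the diagonal of a small cube C: a
   bound on the energy controls the oscillation on small cubes, and the
   finitely many averages over cubes converge along an ultrafilter. *)

(** * Calculus of powers and dominated integrals *)

(** The Choquard term outgrows the energy, so the functional is in general unbounded below. Under
    the constraint 0 <= u <= c the lower order terms are bounded and continuous for a.e.
    convergence, and Fatou's lemma makes the energy lower semicontinuous. A constrained minimiser
    alone satisfies only one-sided inequalities where u = 0 or u = c; the comparison with |v| <= 2c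
    leaves room c on both sides of [0, c] and removes them. The concave term costs up to lam per
    unit of excess above c, against a gain kappa c^(p+ - 1): hence c is fixed first, from kappa and
    the Choquard constants, and Lambda afterwards. The variational part lives on an abstract
    sigma-finite space. The geometry of R^N enters through the lower bound kappa, a partition into
    cells on which K is large, bounded sections of the Choquard kernel, and one nonzero admissible
    function. It uses the uncompleted product, where Tonelli's theorem applies, and functions
    vanishing everywhere off Omega. The statement has the completed product, and elements of X_0
    vanish off Omega only almost everywhere, so a transfer closes the proof. *)

Section calculus.
Variable R : realType.
Implicit Types (f : R -> R) (x a b c t : R).

(** Dominated convergence works along sequences, so derivatives are taken along e_k -> 0. The case b
    = 0 is separate because e_k b then leaves the punctured neighbourhood of 0. *)
Lemma is_derive_cvg_quotient f x df b (e : nat -> R) : is_derive x 1 f df ->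
  (forall k, e k != 0) -> e @ \oo --> 0 ->
  (fun k => (f (x + e k * b) - f x) / e k) @ \oo --> df * b.
Proof.
move=> [dfx <-] e0 e_cvg.
have [->|b0] := eqVneq b 0.
  rewrite mulr0 [X in X @ \oo --> _](_ : _ = cst 0); first exact: cvg_cst.
  by apply/funext => k; rewrite mulr0 addr0 subrr mul0r.
have /cvgr_dnbhsP/(_ (fun k => e k * b)) H : (fun h => h^-1 *: ((f \o shift x) (h *: 1) - f x)) @ 0^' --> 'D_1 f x
  by [].
have Q : (fun k => (f (x + e k * b) - f x) / (e k * b)) @ \oo --> 'D_1 f x.
  apply: cvg_trans (H _); last first.
    split; first by move=> k; rewrite mulf_neq0.
    by rewrite -[0](mul0r b); apply: cvgM => //; exact: cvg_cst.
  apply: near_eq_cvg; apply: nearW => k /=.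
  by rewrite /GRing.scale /= mulr1 mulrC (addrC x).
have : (fun k => (f (x + e k * b) - f x) / (e k * b) * b) @ \oo --> 'D_1 f x * b.
  by apply: cvgM => //; exact: cvg_cst.
apply: cvg_trans; apply: near_eq_cvg; apply: nearW => k /=.
by rewrite invfM mulrA divfK.
Qed.

Lemma is_derive_Lipschitz f df c x y : (forall t, is_derive t 1 f (df t)) ->
  (forall t, t \in `[Num.min x y, Num.max x y] -> `|df t| <= c) ->
  `|f y - f x| <= c * `|y - x|.
Proof.
move=> fdf bd.
wlog xy : x y bd / x <= y => [H|].
  have [xy|/ltW yx] := leP x y; first exact: H.
  rewrite distrC (distrC y); apply: H => // t.
  by rewrite minC maxC; exact: bd.
have [] := @MVT_segment _ f df x y xy (fun t _ => fdf t).
  apply: continuous_subspaceT => t; apply: differentiable_continuous.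
  by apply/derivable1_diffP; exact: ex_derive.
move=> t; rewrite in_itv/= => txy ->; rewrite normrM ler_wpM2r//.
by apply: bd; rewrite (min_l xy) (max_r xy) in_itv.
Qed.

Definition pospow a t := Num.max t 0 `^ a.

Lemma pospow_ge0 a t : 0 <= pospow a t.
Proof. exact: powR_ge0. Qed.

Lemma pospow_pos a t : 0 <= t -> pospow a t = t `^ a.
Proof. by move=> t0; rewrite /pospow max_l. Qed.

Lemma pospow_neg a t : a != 0 -> t <= 0 -> pospow a t = 0.
Proof. by move=> a0 t0; rewrite /pospow max_r// powR0. Qed.

Lemma pospow_cvg0 a : 0 < a -> pospow a h @[h --> 0] --> 0.
Proof.
move=> a0; apply/cvgr0Pnorm_lt => e e0.
near=> h; rewrite ger0_norm ?pospow_ge0//.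
have [h0|h0] := leP h 0; first by rewrite pospow_neg ?gt_eqF.
rewrite pospow_pos ?(ltW h0)//.
have -> : e = (e `^ a^-1) `^ a by rewrite -powRrM mulVf ?gt_eqF// powRr1// ltW.
apply: gt0_ltr_powR => //; rewrite ?nnegrE ?powR_ge0 ?(ltW h0)//.
by near: h; apply: lt_nbhsl; rewrite powR_gt0.
Unshelve. all: by end_near. Qed.

Lemma is_derive_pospow a t : 1 < a ->
  is_derive t 1 (pospow a) (a * pospow (a - 1) t).
Proof.
move=> a1.
have a0 : a != 0 by rewrite gt_eqF// (lt_trans _ a1).
have a10 : a - 1 != 0 by rewrite subr_eq0 gt_eqF.
have [t0|t0|->] := ltgtP t 0.
- rewrite pospow_neg ?mulr0//; last exact: ltW.
  apply: (@near_eq_is_derive _ _ _ (cst 0)) => //.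
  near=> u; rewrite pospow_neg//=.
  by apply: ltW; near: u; apply: lt_nbhsl.
- rewrite pospow_pos ?(ltW t0)//.
  apply: (near_eq_is_derive _ (is_derive1_powR a t0)).
  near=> u; rewrite pospow_pos//.
  by apply: ltW; near: u; apply: lt_nbhsr.
- rewrite pospow_neg// mulr0.
  (* At 0 the quotient vanishes for h <= 0 and is h^(a - 1) for h > 0, which tends to 0 because a >
     1. *)
  have C : h^-1 *: ((pospow a \o shift 0) (h *: 1) - pospow a 0) @[h --> 0^'] --> 0.
    apply/cvgr0Pnorm_lt => e e0.
    have := pospow_cvg0 (a := a - 1); rewrite subr_gt0 => /(_ a1).
    move=> /cvgr0Pnorm_lt/(_ _ e0) H; near=> h.
    have h0 : h != 0 by near: h; exact: nbhs_dnbhs_neq.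
    have : `|pospow (a - 1) h| < e.
      by near: h; apply: nbhs_dnbhs.
    apply: le_lt_trans.
    rewrite /= addr0 (pospow_neg a0 (lexx 0)) subr0 /GRing.scale/= mulr1.
    rewrite normrM normfV.
    have [h0'|h0'] := leP h 0.
      by rewrite (pospow_neg a0 h0') normr0 mulr0.
    rewrite !pospow_pos ?(ltW h0')// !ger0_norm ?powR_ge0 ?(ltW h0')//.
    by rewrite -(@mulr_powRB1 _ h a) ?(ltW h0') ?(lt_trans _ a1)// mulKf// gt_eqF.
  by split; [apply/cvg_ex; exists 0|exact/cvg_lim].
Unshelve. all: by end_near. Qed.

Lemma is_derive_pospow_div a t : 1 < a ->
  is_derive t 1 (fun u => pospow a u / a) (pospow (a - 1) t).
Proof.
move=> a1; have -> : (fun u => pospow a u / a) = a^-1 \*: pospow a.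
  by apply/funext => w /=; rewrite mulrC.
have D := is_derive_pospow t a1.
apply: is_derive_eq.
by rewrite /GRing.scale/= mulKf// gt_eqF// (lt_trans _ a1).
Qed.

(** Splitting into one-sided powers yields the derivative of |t|^p, the point 0 included, from that
    of [pospow]. *)
Lemma abspowE a t : a != 0 -> `|t| `^ a = pospow a t + pospow a (- t).
Proof.
move=> a0; have [t0|t0] := leP 0 t.
  by rewrite (pospow_neg (t := - t)) ?oppr_le0// addr0 pospow_pos// ger0_norm.
by rewrite (pospow_neg (t := t)) ?ltW// add0r pospow_pos ?oppr_ge0 ?ltW// ltr0_norm.
Qed.

Lemma abspow_signed p t : 1 < p ->
  `|t| `^ (p - 2) * t = pospow (p - 1) t - pospow (p - 1) (- t).
Proof.
move=> p1; have p10 : p - 1 != 0 by rewrite subr_eq0 gt_eqF.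
have E : p - 2 = (p - 1) - 1 by ring.
have [t0|t0] := leP 0 t.
  rewrite (pospow_neg (t := - t)) ?oppr_le0// subr0 pospow_pos// ger0_norm//.
  by rewrite mulrC E mulr_powRB1// subr_gt0.
rewrite (pospow_neg (t := t)) ?ltW// sub0r pospow_pos ?oppr_ge0 ?ltW//.
by rewrite ltr0_norm// -[in LHS](opprK t) mulrN opprK mulrC E mulr_powRB1 ?oppr_ge0 ?ltW// subr_gt0.
Qed.

Lemma norm_abspow_signed p t : 1 < p -> `| `|t| `^ (p - 2) * t | = `|t| `^ (p - 1).
Proof.
move=> p1; rewrite normrM ger0_norm ?powR_ge0// mulrC.
by rewrite (_ : p - 2 = (p - 1) - 1) ?mulr_powRB1 ?subr_gt0//; ring.
Qed.

Lemma is_derive_abspow p t : 1 < p ->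
  is_derive t 1 (fun t => `|t| `^ p / p) (`|t| `^ (p - 2) * t).
Proof.
move=> p1; have p0 : p != 0 by rewrite gt_eqF// (lt_trans _ p1).
have -> : (fun t => `|t| `^ p / p) = p^-1 \*: (pospow p + (pospow p \o -%R)).
  by apply/funext => u /=; rewrite abspowE// mulrC.
have D1 := is_derive_pospow t p1; have D2 := is_derive_pospow (- t) p1.
apply: is_derive_eq.
rewrite abspow_signed// /GRing.scale/= mulrN1 -mulrBr mulKf//.
Qed.

(** By the mean value theorem, as the derivative is at most (|a| + |b|)^(p - 1) between a and a + e
    b. The bound does not depend on e, so it can dominate the quotients of the energy. *)
Lemma abspow_quotient_le p a b e : 1 < p -> 0 < e <= 1 ->
  `|(`|a + e * b| `^ p / p - `|a| `^ p / p) / e| <= 2 `^ p * (`|a| `^ p + `|b| `^ p).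
Proof.
move=> p1 /andP[e0 e1].
have p10 : 0 <= p - 1 by rewrite subr_ge0 ltW.
have p0 : 0 <= p by rewrite (le_trans _ (ltW p1)).
have H : `| `|a + e * b| `^ p / p - `|a| `^ p / p| <= (`|a| + `|b|) `^ (p - 1) * `|(a + e * b) - a|.
  apply: (is_derive_Lipschitz (fun t => is_derive_abspow t p1)) => t.
  rewrite norm_abspow_signed// in_itv/= => /andP[t1 t2].
  apply: ge0_ler_powR => //; rewrite ?nnegrE ?addr_ge0//.
  have eb : `|e * b| <= `|b| by rewrite normrM gtr0_norm// ler_piMl.
  rewrite ler_norml; apply/andP; split.
    apply: le_trans t1; rewrite le_min.
    have := ler_norm (- a); have := ler_norm (- (e * b)); rewrite !normrN => ? ?.
    by have ? := normr_ge0 b; apply/andP; split; lra.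
  apply: (le_trans t2); rewrite ge_max.
  have ? := ler_norm a; have ? := ler_norm (e * b).
  by have ? := normr_ge0 b; apply/andP; split; lra.
rewrite normrM normfV (gtr0_norm e0) ler_pdivrMr//; apply: (le_trans H).
rewrite (_ : a + e * b - a = e * b); last by ring.
rewrite normrM (gtr0_norm e0) mulrCA mulrC ler_pM2r//.
apply: (@le_trans _ _ ((`|a| + `|b|) `^ p)).
  rewrite -[leRHS]mulr_powRB1 ?addr_ge0// ?(lt_trans _ p1)//.
  by rewrite mulrC ler_wpM2r ?powR_ge0// lerDr.
apply: (@le_trans _ _ ((2 * Num.max `|a| `|b|) `^ p)).
  apply: ge0_ler_powR => //; rewrite ?nnegrE ?addr_ge0 ?mulr_ge0 ?le_max ?normr_ge0//.
  by rewrite mulrDl !mul1r lerD// le_max lexx ?orbT.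
have m0 : 0 <= Num.max `|a| `|b| by rewrite le_max normr_ge0.
rewrite powRM//; apply: ler_wpM2l; first exact: powR_ge0.
by case: (leP `|a| `|b|) => _; rewrite ?lerDl ?lerDr powR_ge0.
Qed.

Lemma powR_above_tangent p c u : 1 < p -> 0 <= c -> c <= u ->
  c `^ (p - 1) * (u - c) <= u `^ p / p - c `^ p / p.
Proof.
move=> p1 c0 cu.
have [] := @MVT_segment _ _ _ c u cu (fun t _ => is_derive_abspow t p1).
  apply: continuous_subspaceT => t; apply: differentiable_continuous.
  by apply/derivable1_diffP; have [] := is_derive_abspow t p1.
move=> t; rewrite in_itv/= => /andP[ct tu].
have t0 := le_trans c0 ct.
rewrite !ger0_norm ?(le_trans c0 cu)// => ->.
rewrite ler_wpM2r ?subr_ge0// mulrC (_ : p - 2 = (p - 1) - 1); last by ring.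
rewrite mulr_powRB1 ?subr_gt0//.
by apply: ge0_ler_powR; rewrite ?nnegrE// subr_ge0 ltW.
Qed.

Lemma norm_sub_itv01 a b : 0 <= a <= 1 -> 0 <= b <= 1 -> `|a - b| <= 1.
Proof. by move=> /andP[? ?] /andP[? ?]; rewrite ler_norml; apply/andP; split; lra. Qed.

End calculus.

Section real_integrals.
Context d (T : measurableType d) (R : realType).
Variable mu : {measure set T -> \bar R}.

Lemma dominated_convergence_Rintegral (D : set T) (h : (T -> R)^nat) (f g : T -> R) :
  measurable D -> (forall n, measurable_fun D (h n)) -> measurable_fun D f ->
  {ae mu, forall x, D x -> h ^~ x @ \oo --> f x} ->
  mu.-integrable D (EFin \o g) ->
  (forall n x, D x -> `|h n x| <= g x) ->
  mu.-integrable D (EFin \o f) /\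
  (fun n => Rintegral mu D (h n)) @ \oo --> Rintegral mu D f.
Proof.
move=> mD mh mf hf ig hg.
have [] := @dominated_convergence _ _ _ mu D mD (fun n => EFin \o h n) (EFin \o f) (EFin \o g).
- by move=> n; exact/measurable_EFinP.
- exact/measurable_EFinP.
- by apply: filterS hf => x H Dx; apply: cvg_comp (H Dx) _.
- by [].
- by apply: aeW => x n Dx /=; rewrite lee_fin; exact: hg.
move=> If _ C; split => //.
by apply: fine_cvg; rewrite /= fineK//; exact: integrable_fin_num.
Qed.

Lemma integrable_lt_pinfty (D : set T) (f : T -> R) :
  measurable_fun D f -> (forall x, D x -> 0 <= f x) ->
  (\int[mu]_(x in D) (f x)%:E < +oo)%E -> mu.-integrable D (EFin \o f).
Proof.
move=> mf f0 fi; apply/integrableP; split; first exact/measurable_EFinP.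
rewrite (eq_integral (fun x => (f x)%:E))// => x /set_mem xD /=.
by rewrite ger0_norm// f0.
Qed.

Lemma integrable_dominated (D : set T) (f g : T -> R) : measurable D ->
  measurable_fun D f -> (forall x, D x -> `|f x| <= g x) ->
  mu.-integrable D (EFin \o g) -> mu.-integrable D (EFin \o f).
Proof.
move=> mD mf fg; apply: le_integrable => //; first exact/measurable_EFinP.
move=> x Dx /=; rewrite lee_fin; apply: (le_trans (fg _ Dx)); exact: ler_norm.
Qed.

Lemma integrable_scale (D : set T) (f : T -> R) (c : R) : measurable D ->
  mu.-integrable D (EFin \o f) -> mu.-integrable D (EFin \o (fun x => c * f x)).
Proof. by move=> mD i; have := integrableZl mD c i; apply: eq_integrable. Qed.

Lemma integrable_add (D : set T) (f g : T -> R) : measurable D ->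
  mu.-integrable D (EFin \o f) -> mu.-integrable D (EFin \o g) ->
  mu.-integrable D (EFin \o (fun x => f x + g x)).
Proof. by move=> mD i j; have := integrableD mD i j; apply: eq_integrable. Qed.

Lemma integrable_sub (D : set T) (f g : T -> R) : measurable D ->
  mu.-integrable D (EFin \o f) -> mu.-integrable D (EFin \o g) ->
  mu.-integrable D (EFin \o (fun x => f x - g x)).
Proof. by move=> mD i j; have := integrableB mD i j; apply: eq_integrable. Qed.

End real_integrals.

(** * The variational problem on an abstract measure space *)

Lemma measurable_powR2 d (T : measurableType d) (R : realType) (f g : T -> R) :
  measurable_fun setT f -> measurable_fun setT g ->
  measurable_fun setT (fun x => f x `^ g x).
Proof.
move=> mf mg; rewrite /powR; apply: measurable_fun_ifT => //.
- exact: measurable_fun_eqr.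
- rewrite (_ : (fun x => _) = (fun x => if g x == 0 then 1 else 0)).
    by apply: measurable_fun_ifT => //; exact: measurable_fun_eqr.
  by apply/funext => x; case: eqP.
- by apply: measurableT_comp => //; apply: measurable_funM => //; exact: measurableT_comp.
Qed.

Lemma measurable_invr_gt0 d (T : measurableType d) (R : realType) (f : T -> R) :
  (forall x, 0 < f x) -> measurable_fun setT f ->
  measurable_fun setT (fun x => (f x)^-1).
Proof.
move=> f0 mf; rewrite (_ : (fun x => _) = (fun x => f x `^ (-1))).
  exact: (measurableT_comp (measurable_powR (-1)) mf).
by apply/funext => x; rewrite powR_inv1// ltW.
Qed.

Section product_ae.
Context d (T : measurableType d) (R : realType).
Variable m : {sigma_finite_measure set T -> \bar R}.
Local Notation m2 := (m \x m)%E.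

Lemma null_setX_prod (N : set T) : measurable N -> m N = 0%E ->
  m2 (N `*` setT) = 0%E /\ m2 (setT `*` N) = 0%E.
Proof.
move=> mN N0; split; rewrite product_measure1E//.
  (* The whole space may have infinite measure; the product with 0 is still 0. *)
  by transitivity (0 * m setT)%E; [congr (_ * _)%E|rewrite mul0e].
by rewrite N0 mule0.
Qed.

Lemma ae_prod (P : T -> Prop) : {ae m, forall x, P x} ->
  {ae m2, forall z, P z.1 /\ P z.2}.
Proof.
move=> [N [mN N0 PN]]; have [N1 N2] := null_setX_prod mN N0.
exists ((N `*` setT) `|` (setT `*` N)); split.
- by apply: measurableU; apply: measurableX.
- by apply: null_set_setU => //; apply: measurableX.
- move=> z /= /not_andP[] H; [left|right]; split => //=; exact: PN.
Qed.

End product_ae.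

Section fatou_bound.
Context d (T : measurableType d) (R : realType).
Variable mu : {measure set T -> \bar R}.

(** This is what gives the lower semicontinuity of the energy along pointwise convergent
    sequences. *)
Lemma fatou_bound (h : (T -> R)^nat) (g : T -> R) (C : \bar R) :
  (forall k, measurable_fun setT (h k)) -> (forall k x, 0 <= h k x) ->
  (forall x, h ^~ x @ \oo --> g x) ->
  (forall k, (\int[mu]_x (h k x)%:E <= C)%E) ->
  (\int[mu]_x (g x)%:E <= C)%E.
Proof.
move=> mh h0 hg hC.
have -> : (\int[mu]_x (g x)%:E = \int[mu]_x limn_einf (fun k => (h k x)%:E))%E.
  apply: eq_integral => x _; apply/esym.
  have /cvg_limn_einf_sup[-> _] // : (fun k => (h k x)%:E) @ \oo --> (g x)%:E.
  by apply: cvg_comp (hg x) _.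
apply: le_trans (@fatou _ _ _ mu _ _ (fun k x => (h k x)%:E) _ _) _ => //.
- by move=> k; exact/measurable_EFinP.
- by move=> k x _; rewrite lee_fin.
rewrite limn_einf_lim; apply: lime_le; first exact: is_cvg_einfs.
apply: nearW => k; apply: le_trans (hC k).
by apply: ereal_inf_lbound; exists k => /=.
Qed.

End fatou_bound.

Section variational.
Context d (T : measurableType d) (R : realType).
Variable m : {sigma_finite_measure set T -> \bar R}.
Local Notation m2 := (m \x m)%E.
Local Notation integrable1 f := (m.-integrable setT (EFin \o f)).
Local Notation integrable2 f := (m2.-integrable setT (EFin \o f)).
Local Notation Rint1 := (Rintegral m setT).
Local Notation Rint2 := (Rintegral m2 setT).
Variables (Om : set T) (p K : T * T -> R) (pm pp kappa : R).
Hypothesis mOm : measurable Om.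
Hypothesis finOm : (m Om < +oo)%E.
Hypothesis mp : measurable_fun setT p.
Hypothesis mK : measurable_fun setT K.
Hypothesis K0 : forall z, 0 <= K z.
Hypothesis pm1 : 1 < pm.
Hypothesis p_bd : forall z, pm <= p z <= pp.
Variables (H : T * T -> R) (F f : T -> R -> R) (alpha : T -> R) (alp M CH : R).
Hypothesis mH : measurable_fun setT H.
Hypothesis H0 : forall z, 0 <= H z.
Hypothesis H_sym : forall x y, H (x, y) = H (y, x).
Hypothesis H_supp : forall z, ~ Om z.1 -> H z = 0.
Hypothesis H_le : forall x, (\int[m]_y (H (x, y))%:E <= CH%:E)%E.
Hypothesis CH0 : 0 <= CH.
Hypothesis malpha : measurable_fun setT alpha.
Hypothesis alpha1 : forall x, 1 < alpha x.
Hypothesis pp1 : 1 < pp.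
Hypothesis mF : forall v : T -> R, measurable_fun setT v -> measurable_fun setT (fun x => F x (v x)).
Hypothesis mf : forall v : T -> R, measurable_fun setT v -> measurable_fun setT (fun x => f x (v x)).
Hypothesis dF : forall x (t : R), is_derive t 1 (F x) (f x t).
Hypothesis F_neg : forall x (t : R), t <= 0 -> F x t = 0.
Hypothesis f_le : forall x t, `|t| <= 1 -> `|f x t| <= M * `|t| `^ (pp - 1).
Hypothesis M0 : 0 <= M.
Hypothesis kappa_le : forall x, Om x ->
  (kappa%:E <= \int[m]_(y in ~` Om) (K (x, y))%:E)%E.
Hypothesis kappa0 : 0 < kappa.
Hypothesis alpha_le : forall x, alpha x <= alp.
Hypothesis alp_pm : alp < pm.

Definition energy_density (v : T -> R) (z : T * T) :=
  `|v z.1 - v z.2| `^ p z / p z * K z.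

Definition energy (v : T -> R) := Rint2 (energy_density v).

Definition admissible (v : T -> R) := [/\ measurable_fun setT v,
  (forall x, ~ Om x -> v x = 0) &
  integrable2 (energy_density v)].

(** A Rellich property. The index map need only satisfy k <= i k: the sequences it serves are
    minimising, and all that matters is that the error at i k is at most the error at k. *)
Definition compact_energy := forall u : nat -> T -> R, (forall k, measurable_fun setT (u k)) ->
  (forall k x, 0 <= u k x <= 1) -> (forall k x, ~ Om x -> u k x = 0) ->
  (exists B : R, forall k, (\int[m2]_z (energy_density (u k) z)%:E <= B%:E)%E) ->
  exists (i : nat -> nat) (v : T -> R),
    [/\ forall k, (k <= i k)%N, measurable_fun setT v &
        {ae m, forall x, (fun k => u (i k) x) @ \oo --> v x}].

Lemma p_gt1 z : 1 < p z.
Proof. by have /andP[+ _] := p_bd z; exact: lt_le_trans. Qed.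

Lemma p_gt0 z : 0 < p z.
Proof. exact: lt_trans (p_gt1 z). Qed.

Lemma energy_density_ge0 v z : 0 <= energy_density v z.
Proof. by rewrite mulr_ge0// divr_ge0 ?powR_ge0// ltW// p_gt0. Qed.

Lemma measurable_pairdiff (v : T -> R) : measurable_fun setT v ->
  measurable_fun setT (fun z : T * T => v z.1 - v z.2).
Proof. by move=> mv; apply: measurable_funB; apply: measurableT_comp. Qed.

Lemma measurable_energy_density v : measurable_fun setT v ->
  measurable_fun setT (energy_density v).
Proof.
move=> mv; apply: measurable_funM => //; apply: measurable_funM.
  apply: measurable_powR2 => //; apply: measurableT_comp => //.
  exact: measurable_pairdiff.
exact: (measurable_invr_gt0 p_gt0).
Qed.

(** * Cutting a function at height c *)

Definition clamp (c t : R) := Num.max 0 (Num.min t c).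

Lemma measurable_clamp c (v : T -> R) : measurable_fun setT v ->
  measurable_fun setT (clamp c \o v).
Proof.
move=> mv; apply: (@measurable_maxr _ _ _ _ (cst 0) (v \min cst c)).
  exact: measurable_cst.
by apply: measurable_minr.
Qed.

Lemma measurable_excess c (v : T -> R) : measurable_fun setT v ->
  measurable_fun setT (fun x => Num.max 0 (v x - c)).
Proof.
move=> mv; apply: (@measurable_maxr _ _ _ _ (cst 0) (fun x => v x - c)) => //.
exact: measurable_funB.
Qed.

Lemma clamp_itv c t : 0 <= c -> 0 <= clamp c t <= c.
Proof. by move=> c0; rewrite /clamp le_max lexx/= ge_max c0 ge_min lexx orbT. Qed.

Lemma clamp_id c t : 0 <= t <= c -> clamp c t = t.
Proof. by move=> /andP[t0 tc]; rewrite /clamp min_l// max_r. Qed.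

Lemma clamp_ge c t : 0 <= c -> c <= t -> clamp c t = c.
Proof. by move=> c0 ct; rewrite /clamp min_r// max_r. Qed.

Lemma clamp_le0 c t : 0 <= c -> t <= 0 -> clamp c t = 0.
Proof. by move=> c0 t0; rewrite /clamp min_l ?max_l// (le_trans t0). Qed.

Lemma clamp_contract c s t : 0 <= c -> `|clamp c s - clamp c t| <= `|s - t|.
Proof.
move=> c0; wlog st : s t / s <= t => [W|].
  by have [/W//|/ltW/W] := leP s t; rewrite distrC (distrC t).
rewrite (distrC s) (@ger0_norm _ (t - s)) ?subr_ge0//.
have cst' : clamp c s <= clamp c t.
  by rewrite /clamp ge_max !le_max lexx/= le_min !ge_min lexx st/= orbT orbT.
rewrite distrC ger0_norm ?subr_ge0// /clamp.
by case: (leP t c) => tc; case: (leP s c) => sc;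
  case: (leP 0 s) => ?; case: (leP 0 t) => ?; case: (leP 0 c) => ?; lra.
Qed.

Lemma energy_density_clamp c v z : 0 <= c ->
  energy_density (clamp c \o v) z <= energy_density v z.
Proof.
move=> c0; rewrite ler_wpM2r// ler_wpM2r ?invr_ge0 ?(ltW (p_gt0 z))//.
apply: ge0_ler_powR; rewrite ?nnegrE ?(ltW (p_gt0 z))//.
exact: clamp_contract.
Qed.

(* When z.2 lies off Om, v z.2 = 0 and the tangent of t^p/p at c bounds the gain below by a
   linear function of the excess (v z.1 - c)^+. *)
Lemma energy_density_clamp_gap c v (z : T * T) : 0 < c <= 1 -> ~ Om z.2 ->
  (forall x, ~ Om x -> v x = 0) ->
  energy_density (clamp c \o v) z + c `^ (pp - 1) * Num.max 0 (v z.1 - c) * K z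
    <= energy_density v z.
Proof.
move=> /andP[c0 c1] z2 v0.
have [vc|cv] := leP (v z.1) c.
  by rewrite max_l ?subr_le0// mulr0 mul0r addr0 energy_density_clamp// ltW.
rewrite max_r ?subr_ge0 ?(ltW cv)// /energy_density -mulrDl ler_wpM2r//.
rewrite /= (v0 _ z2) clamp_ge ?(ltW c0) ?(ltW cv)// clamp_le0 ?(ltW c0)// !subr0.
rewrite !gtr0_norm// ?(lt_trans c0)// addrC -lerBrDr.
apply: le_trans (powR_above_tangent (p_gt1 z) (ltW c0) (ltW cv)).
rewrite ler_wpM2r ?subr_ge0 ?(ltW cv)//.
apply: ger_powR; first by rewrite c0.
by rewrite lerB//; have /andP[] := p_bd z.
Qed.

(** The pointwise gap is integrated over the pairs with z.2 off [Om]. There Tonelli leaves (v x -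
    c)^+ times the integral of K(x, .) over the complement, and v x > c forces x into [Om], where
    [kappa_le] applies. On the other pairs monotonicity is enough. *)
Lemma energy_clamp c v : 0 < c <= 1 -> admissible v ->
  admissible (clamp c \o v) /\
  (integrable1 (fun x => Num.max 0 (v x - c)) ->
   energy (clamp c \o v) + kappa * c `^ (pp - 1) *
     Rint1 (fun x => Num.max 0 (v x - c)) <= energy v).
Proof.
move=> c01 [mv v0 iv]; have /andP[c0 c1] := c01.
have mcv := measurable_clamp c mv.
have icv : integrable2 (energy_density (clamp c \o v)).
  apply: integrable_dominated iv => //; first exact: measurable_energy_density.
  by move=> z _; rewrite ger0_norm ?energy_density_ge0// energy_density_clamp// ltW.
split.
  by split => // x /v0 /= ->; rewrite clamp_le0// ltW.
move=> iposv.
(* [g] is the gap, extended by 0 to the pairs with z.2 in [Om]. *)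
pose g (z : T * T) := c `^ (pp - 1) * Num.max 0 (v z.1 - c) * \1_(~` Om) z.2 * K z.
have g0 z : 0 <= g z by rewrite !mulr_ge0 ?powR_ge0// le_max lexx.
have mpos := measurable_excess c mv.
have mg : measurable_fun setT g.
  apply: measurable_funM => //; apply: measurable_funM; last first.
    by apply: measurableT_comp => //; apply: measurable_indic; exact: measurableC.
  apply: measurable_funM; first exact: measurable_cst.
  exact: (measurableT_comp mpos).
have gle z : energy_density (clamp c \o v) z + g z <= energy_density v z.
  rewrite /g indicE; have [z2|z2] := boolP (z.2 \in ~` Om).
    by rewrite mulr1 energy_density_clamp_gap//; exact: set_mem z2.
  by rewrite mulr0 mul0r addr0 energy_density_clamp// ltW.
have ig : integrable2 g.
  apply: integrable_dominated iv => // z _; rewrite ger0_norm//.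
  by apply: le_trans (gle z); rewrite lerDr energy_density_ge0.
have Hg : kappa * c `^ (pp - 1) * Rint1 (fun x => Num.max 0 (v x - c))
    <= Rint2 g.
  rewrite -lee_fin /Rintegral.
  rewrite EFinM !fineK; [|exact: integrable_fin_num|exact: integrable_fin_num].
  rewrite -ge0_integralZl//; last 3 first.
  - exact/measurable_EFinP.
  - by move=> x _; rewrite lee_fin le_max lexx.
  - by rewrite lee_fin mulr_ge0 ?powR_ge0// ltW.
  rewrite (fubini_tonelli1 (EFin \o g)); last 2 first.
  - exact/measurable_EFinP.
  - by move=> z; rewrite lee_fin.
  apply: ge0_le_integral => //.
  - by move=> x _; rewrite mule_ge0// lee_fin ?mulr_ge0 ?powR_ge0 ?(ltW kappa0)// le_max lexx.
  - by apply: measurable_funeM; exact/measurable_EFinP.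
  - apply: (measurable_fun_fubini_tonelli_F (EFin \o g)).
      exact/measurable_EFinP.
    by move=> z; rewrite lee_fin.
  - move=> x _; rewrite /fubini_F.
    have [xO|xO] := boolP (x \in Om); last first.
      rewrite (v0 x); last by move=> /mem_set; rewrite (negbTE xO).
      rewrite max_l ?sub0r ?oppr_le0 ?(ltW c0)// mule0.
      by apply: integral_ge0 => y _; rewrite lee_fin.
    have -> : (\int[m]_y (EFin \o g) (x, y) =
       (c `^ (pp - 1) * Num.max 0 (v x - c))%:E * \int[m]_(y in ~` Om) (K (x, y))%:E)%E.
      rewrite [in RHS]integral_mkcond -ge0_integralZl//; last 3 first.
      - apply/(measurable_restrictT _ _).1; first exact: measurableC.
        apply: measurable_funTS; apply/measurable_EFinP.
        exact: measurableT_comp.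
      - by move=> y _; apply: erestrict_ge0 => u _; rewrite lee_fin.
      - by rewrite lee_fin mulr_ge0 ?powR_ge0// le_max lexx.
      apply: eq_integral => y _; rewrite /g /= patchE indicE.
      by case: ifP => _; rewrite ?mulr1 ?mulr0 ?mul0r ?mule0 -?EFinM.
    rewrite [leLHS](_ : _ = (c `^ (pp - 1) * Num.max 0 (v x - c))%:E * kappa%:E)%E; last first.
      by rewrite -!EFinM; congr EFin; ring.
    apply: lee_wpmul2l; first by rewrite lee_fin mulr_ge0 ?powR_ge0// le_max lexx.
    by apply: kappa_le; exact: set_mem.
apply: (le_trans (lerD (lexx _) Hg)); rewrite /energy -RintegralD//.
apply: le_Rintegral => //.
  exact: (integrable_add measurableT icv ig).
by move=> z _; exact: gle.
Qed.

(** * The kernel H and the lower order terms *)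

Lemma integrable_bounded_support (g : T -> R) (c : R) : measurable_fun setT g ->
  (forall x, `|g x| <= c) -> (forall x, ~ Om x -> g x = 0) ->
  integrable1 g.
Proof.
move=> mg gc g0.
have /(integrable_mkcond _ mOm) : m.-integrable Om (EFin \o g).
  apply: measurable_bounded_integrable => //; first exact: measurable_funTS.
  exists c; split; first exact: num_real.
  by move=> t ct x _; exact: le_trans (gc x) (ltW ct).
apply: eq_integrable => // x _; rewrite patchE; case: ifPn => // xO.
by rewrite /= g0// => /mem_set; rewrite (negbTE xO).
Qed.

Lemma integrable_indic_Om : integrable1 (\1_Om : T -> R).
Proof.
apply: (@integrable_bounded_support _ 1) => [|x|x xO].
- exact: measurable_indic.
- by rewrite ger0_norm ?indicE// lern1 leq_b1.
- by rewrite indicE memNset.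
Qed.

(** Tonelli with the uniform bound on the sections H(x, .). For bounded u and an integrable weight g
    this takes the place of the Hardy-Littlewood-Sobolev inequality. *)
Lemma integral_weight_fst (g : T -> R) : measurable_fun setT g -> (forall x, 0 <= g x) ->
  (\int[m2]_z (g z.1 * H z)%:E <= CH%:E * \int[m]_x (g x)%:E)%E.
Proof.
move=> mg g0.
have mgH : measurable_fun setT (fun z : T * T => (g z.1 * H z)%:E).
  apply/measurable_EFinP; apply: measurable_funM => //.
  exact: measurableT_comp.
have gH0 (z : T * T) : (0 <= (g z.1 * H z)%:E)%E by rewrite lee_fin mulr_ge0.
rewrite (fubini_tonelli1 (fun z => (g z.1 * H z)%:E))// -ge0_integralZl//; last 2 first.
- exact/measurable_EFinP.
- by move=> x _; rewrite lee_fin.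
apply: ge0_le_integral => //.
- by move=> x _; apply: integral_ge0.
- exact: (measurable_fun_fubini_tonelli_F _ mgH).
- by apply: measurable_funeM; exact/measurable_EFinP.
move=> x _; rewrite /fubini_F /=; under eq_integral do rewrite EFinM.
rewrite ge0_integralZl//; last 3 first.
- apply/measurable_EFinP; exact: measurableT_comp.
- by move=> y _; rewrite lee_fin.
- by rewrite lee_fin.
by rewrite muleC; apply: lee_wpmul2r => //; rewrite lee_fin.
Qed.

Lemma integral_weight_snd (g : T -> R) : measurable_fun setT g -> (forall x, 0 <= g x) ->
  (\int[m2]_z (g z.2 * H z)%:E <= CH%:E * \int[m]_x (g x)%:E)%E.
Proof.
move=> mg g0; apply: le_trans (integral_weight_fst mg g0).
have mgH : measurable_fun setT (fun z : T * T => (g z.1 * H z)%:E).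
  apply/measurable_EFinP; apply: measurable_funM => //.
  exact: measurableT_comp.
have mgH' : measurable_fun setT (fun z : T * T => (g z.2 * H z)%:E).
  apply/measurable_EFinP; apply: measurable_funM => //.
  exact: measurableT_comp.
rewrite (fubini_tonelli1 (fun z => (g z.1 * H z)%:E))//; last first.
  by move=> z; rewrite lee_fin mulr_ge0.
rewrite (fubini_tonelli2 (fun z => (g z.2 * H z)%:E))//; last first.
  by move=> z; rewrite lee_fin mulr_ge0.
rewrite le_eqVlt; apply/predU1P; left.
by apply: eq_integral => x _; apply: eq_integral => y _; rewrite /= H_sym.
Qed.

Lemma integrable_weight (g : T -> R) : measurable_fun setT g -> (forall x, 0 <= g x) ->
  integrable1 g ->
  [/\ integrable2 (fun z => g z.1 * H z),
      integrable2 (fun z => g z.2 * H z),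
      Rint2 (fun z => g z.1 * H z) <= CH * Rint1 g &
      Rint2 (fun z => g z.2 * H z) <= CH * Rint1 g].
Proof.
move=> mg g0 ig; have gfin := integrable_fin_num measurableT ig.
have E : (CH%:E * \int[m]_x (g x)%:E = (CH * Rint1 g)%:E)%E.
  by rewrite EFinM /Rintegral fineK.
have I1 : integrable2 (fun z => g z.1 * H z).
  apply: integrable_lt_pinfty; [|by move=> z _; rewrite mulr_ge0|].
    by apply: measurable_funM => //; exact: measurableT_comp.
  by apply: le_lt_trans (integral_weight_fst mg g0) _; rewrite E ltry.
have I2 : integrable2 (fun z => g z.2 * H z).
  apply: integrable_lt_pinfty; [|by move=> z _; rewrite mulr_ge0|].
    by apply: measurable_funM => //; exact: measurableT_comp.
  by apply: le_lt_trans (integral_weight_snd mg g0) _; rewrite E ltry.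
split=> //; rewrite -lee_fin -E [X in (X%:E <= _)%E]/Rintegral fineK.
- exact: integral_weight_fst.
- exact: (integrable_fin_num measurableT I1).
- exact: integral_weight_snd.
- exact: (integrable_fin_num measurableT I2).
Qed.

Lemma integrable_kernel : integrable2 H.
Proof.
have mI : measurable_fun setT (\1_Om : T -> R) by exact: measurable_indic.
have I0 x : 0 <= \1_Om x :> R by rewrite indicE.
have [] := integrable_weight mI I0 integrable_indic_Om.
move=> + _ _ _; apply: eq_integrable => // z _ /=; rewrite indicE.
have [zO|zO] := boolP (z.1 \in Om); first by rewrite mul1r.
by rewrite mul0r H_supp// => /mem_set; rewrite (negbTE zO).
Qed.

Lemma F_Lipschitz x (k s t : R) : 0 <= k <= 1 -> `|s| <= k -> `|t| <= k ->
  `|F x t - F x s| <= M * k `^ (pp - 1) * `|t - s|.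
Proof.
move=> /andP[k0 k1] sk tk; apply: (is_derive_Lipschitz (dF x)) => u.
rewrite in_itv/= => /andP[ul ur].
have uk : `|u| <= k.
  move: sk tk ul ur; rewrite !ler_norml => /andP[s1 s2] /andP[t1 t2].
  by rewrite ge_min le_max => /orP[] ? /orP[] ?; apply/andP; split; lra.
apply: (le_trans (f_le x (le_trans uk k1))); apply: ler_wpM2l => //.
by apply: ge0_ler_powR => //; rewrite ?nnegrE// subr_ge0 ltW.
Qed.

Lemma F_bound x (k t : R) : 0 <= k <= 1 -> `|t| <= k -> `|F x t| <= M * k `^ pp.
Proof.
move=> k01 tk; have /andP[k0 k1] := k01.
have := F_Lipschitz x (s := 0) k01; rewrite normr0 => /(_ t k0 tk).
rewrite (F_neg x (lexx 0)) !subr0 => /le_trans; apply.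
rewrite -(@mulr_powRB1 _ k pp)// ?(lt_trans _ pp1)//.
by rewrite -mulrA ler_wpM2l// mulrC ler_wpM2r// powR_ge0.
Qed.

Definition concave_density (v : T -> R) x := pospow (alpha x) (v x) / alpha x.

Definition choquard_density (v : T -> R) (z : T * T) := F z.1 (v z.1) * F z.2 (v z.2) * H z.

(** The factor 1/2 compensates for the two factors F, which by the symmetry of H contribute equally
    to the derivative. *)
Definition potential (lam : R) (v : T -> R) :=
  lam * Rint1 (concave_density v) + 2^-1 * Rint2 (choquard_density v).

Lemma alpha0 x : 0 < alpha x.
Proof. exact: lt_trans (alpha1 x). Qed.

Lemma concave_density_Lipschitz x (s t : R) : s <= 1 -> t <= 1 ->
  `|pospow (alpha x) t / alpha x - pospow (alpha x) s / alpha x| <= `|t - s|.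
Proof.
move=> s1 t1; rewrite -[leRHS]mul1r.
apply: (is_derive_Lipschitz (fun u => is_derive_pospow_div u (alpha1 x))) => u; rewrite in_itv/= => /andP[_ ur].
have u1 : u <= 1 by apply: (le_trans ur); rewrite ge_max s1.
rewrite ger0_norm ?pospow_ge0// /pospow.
apply: (@le_trans _ _ (1 `^ (alpha x - 1))); last by rewrite powR1.
by apply: ge0_ler_powR; rewrite ?nnegrE ?le_max ?lexx ?orbT ?ge_max ?u1 ?ler01// subr_ge0 (ltW (alpha1 x)).
Qed.

Lemma concave_density_bound v x : v x <= 1 -> 0 <= concave_density v x <= 1.
Proof.
move=> v1; rewrite /concave_density divr_ge0 ?pospow_ge0 ?(ltW (alpha0 x))//=.
rewrite ler_pdivrMr ?alpha0// mul1r; apply: le_trans (ltW (alpha1 x)).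
apply: (@le_trans _ _ (1 `^ (alpha x))); last by rewrite powR1.
rewrite /pospow.
by apply: ge0_ler_powR; rewrite ?nnegrE ?le_max ?lexx ?orbT ?ge_max ?v1 ?ler01// (ltW (alpha0 x)).
Qed.

Lemma measurable_concave_density (v : T -> R) : measurable_fun setT v ->
  measurable_fun setT (concave_density v).
Proof.
move=> mv; apply: measurable_funM; last exact: (measurable_invr_gt0 alpha0).
apply: measurable_powR2 => //.
by apply: (@measurable_maxr _ _ _ _ v (cst 0)).
Qed.

Lemma measurable_choquard_density (v : T -> R) : measurable_fun setT v ->
  measurable_fun setT (choquard_density v).
Proof.
move=> /mF mv; apply: measurable_funM => //; apply: measurable_funM.
  exact: (measurableT_comp mv).
exact: (measurableT_comp mv).
Qed.

Lemma integrable_concave_density (v : T -> R) : measurable_fun setT v -> (forall x, v x <= 1) ->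
  (forall x, ~ Om x -> v x = 0) -> integrable1 (concave_density v).
Proof.
move=> mv v1 v0; apply: (@integrable_bounded_support _ 1).
- exact: measurable_concave_density.
- by move=> x; have /andP[c0 c1] := concave_density_bound (v1 x); rewrite ger0_norm.
- by move=> x /v0 E; rewrite /concave_density E pospow_neg ?mul0r// gt_eqF// alpha0.
Qed.

Lemma choquard_density_bound (v : T -> R) (z : T * T) : (forall x, `|v x| <= 1) ->
  `|choquard_density v z| <= M ^+ 2 * H z.
Proof.
move=> v1; rewrite /choquard_density normrM (ger0_norm (H0 z)) ler_wpM2r// normrM expr2.
by apply: ler_pM => //; apply: le_trans (F_bound _ _ (v1 _)) _; rewrite ?ler01 ?lexx// powR1 mulr1.
Qed.

Lemma integrable_choquard_density (v : T -> R) : measurable_fun setT v -> (forall x, `|v x| <= 1) ->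
  integrable2 (choquard_density v).
Proof.
move=> mv v1; apply: (@integrable_dominated _ _ _ _ _ _ (fun z => M ^+ 2 * H z)) => //.
- exact: measurable_choquard_density.
- by move=> z _; exact: choquard_density_bound.
- exact: (integrable_scale _ measurableT integrable_kernel).
Qed.

Lemma potential_clamp lam c (v : T -> R) : 0 <= lam -> 0 < c -> 2 * c <= 1 ->
  measurable_fun setT v -> (forall x, ~ Om x -> v x = 0) -> (forall x, `|v x| <= 2 * c) ->
  integrable1 (fun x => Num.max 0 (v x - c)) /\
  potential lam v - potential lam (clamp c \o v) <=
  (lam + M ^+ 2 * CH * ((2 * c) `^ (pp - 1) * (2 * c) `^ pp)) *
     Rint1 (fun x => Num.max 0 (v x - c)).
Proof.
move=> lam0 c0 c21 mv v0 v2c.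
have mcv := measurable_clamp c mv.
have v1 x : `|v x| <= 1 by exact: le_trans (v2c x) c21.
have v1' x : v x <= 1 by exact: le_trans (ler_norm _) (v1 x).
have cv0 x : ~ Om x -> (clamp c \o v) x = 0 by move=> /v0 /= ->; rewrite clamp_le0// ltW.
have cv2c x : `|(clamp c \o v) x| <= 2 * c.
  by have /andP[h1 h2] := clamp_itv (v x) (ltW c0); rewrite ger0_norm//= (le_trans h2)//; lra.
have cv1 x : `|(clamp c \o v) x| <= 1 by exact: le_trans (cv2c x) c21.
have cv1' x : (clamp c \o v) x <= 1 by exact: le_trans (ler_norm _) (cv1 x).
pose g x := Num.max 0 (v x - c).
have g0 x : 0 <= g x by rewrite /g le_max lexx.
have mg : measurable_fun setT g by exact: measurable_excess.
have ig : integrable1 g.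
  apply: (@integrable_bounded_support _ 1) => // x.
    rewrite ger0_norm// /g ge_max ler01/=.
    have := v1' x; lra.
  by move=> /v0 vx; rewrite /g vx max_l// sub0r oppr_le0 ltW.
split=> //.
have vg x : 0 <= v x -> v x - clamp c (v x) = g x.
  move=> vx0; rewrite /g; have [vc|cv] := leP (v x) c.
    by rewrite clamp_id ?vx0// subrr max_l// subr_le0.
  by rewrite clamp_ge ?(ltW c0)// ?(ltW cv)// max_r// subr_ge0 ltW.
have D1 x : concave_density v x <= concave_density (clamp c \o v) x + g x.
  have [vx0|vx0] := leP 0 (v x).
    rewrite -lerBlDl; apply: (le_trans (ler_norm _)).
    apply: (le_trans (concave_density_Lipschitz x (cv1' x) (v1' x))).
    by rewrite /= vg// ger0_norm.
  rewrite /concave_density /= clamp_le0 ?(ltW c0) ?(ltW vx0)//.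
  by rewrite !pospow_neg ?(ltW vx0) ?mul0r ?add0r// gt_eqF// alpha0.
have c01 : 0 <= 2 * c <= 1 by rewrite c21 mulr_ge0// ltW.
have DF (y : T) : `|F y (v y) - F y (clamp c (v y))| <= M * (2 * c) `^ (pp - 1) * g y.
  have [vx0|vx0] := leP 0 (v y).
    apply: (le_trans (F_Lipschitz y c01 (cv2c y) (v2c y))).
    by rewrite /= vg// ger0_norm.
  by rewrite clamp_le0 ?(ltW c0) ?(ltW vx0)// !F_neg ?(ltW vx0)// subrr normr0 !mulr_ge0// powR_ge0.
(* The product of the Lipschitz constant M (2c)^(pp - 1) of F on [-2c, 2c] and of its bound M
   (2c)^pp there. *)
pose L := M ^+ 2 * ((2 * c) `^ (pp - 1) * (2 * c) `^ pp).
have L0 : 0 <= L by rewrite !mulr_ge0 ?powR_ge0// exprn_ge0.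
have D2 z : choquard_density v z <= choquard_density (clamp c \o v) z + (L * (g z.1 * H z) + L * (g z.2 * H z)).
  rewrite /choquard_density -lerBlDl -mulrBl !mulrA -!mulrDl ler_wpM2r//.
  apply: (le_trans (ler_norm _)).
  (* One factor changes at a time: the difference is controlled by the excess, the other factor by
     its bound. The two resulting terms cancel the 1/2 in [potential]. *)
  have -> : F z.1 (v z.1) * F z.2 (v z.2) - F z.1 ((clamp c \o v) z.1) * F z.2 ((clamp c \o v) z.2)
     = (F z.1 (v z.1) - F z.1 (clamp c (v z.1))) * F z.2 (v z.2) +
       F z.1 (clamp c (v z.1)) * (F z.2 (v z.2) - F z.2 (clamp c (v z.2))) by rewrite /=; ring.
  apply: (le_trans (ler_normD _ _)); rewrite !normrM /L.
  have E x : M ^+ 2 * ((2 * c) `^ (pp - 1) * (2 * c) `^ pp) * g x =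
    (M * (2 * c) `^ (pp - 1) * g x) * (M * (2 * c) `^ pp) by ring.
  rewrite !E lerD//; first by rewrite ler_pM// F_bound.
  by rewrite mulrC ler_pM// F_bound//; exact: (cv2c z.1).
have [Ig1 Ig2 Rg1 Rg2] := integrable_weight mg g0 ig.
have Iv1 := integrable_concave_density mv v1' v0.
have Icv1 := integrable_concave_density mcv cv1' cv0.
have Iv2 := integrable_choquard_density mv v1.
have Icv2 := integrable_choquard_density mcv cv1.
have R1 : Rint1 (concave_density v) <=
    Rint1 (concave_density (clamp c \o v)) + Rint1 g.
  rewrite -RintegralD//; apply: le_Rintegral => //.
    exact: (integrable_add measurableT Icv1 ig).
  by move=> x _; exact: D1.
have IL1 : integrable2 (fun z => L * (g z.1 * H z)).
  exact: (integrable_scale _ measurableT Ig1).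
have IL2 : integrable2 (fun z => L * (g z.2 * H z)).
  exact: (integrable_scale _ measurableT Ig2).
have IL : integrable2 (fun z => L * (g z.1 * H z) + L * (g z.2 * H z)).
  exact: (integrable_add measurableT IL1 IL2).
have R2 : Rint2 (choquard_density v) <=
    Rint2 (choquard_density (clamp c \o v)) + 2 * (L * CH) * Rint1 g.
  apply: (@le_trans _ _ (Rint2 (choquard_density (clamp c \o v)) +
     Rint2 (fun z => L * (g z.1 * H z) + L * (g z.2 * H z)))).
    rewrite -RintegralD//; apply: le_Rintegral => //.
      exact: (integrable_add measurableT Icv2 IL).
    by move=> z _; exact: D2.
  rewrite lerD2l RintegralD// !RintegralZl//.
  rewrite [leRHS](_ : _ = L * (CH * Rint1 g) + L * (CH * Rint1 g)); last by ring.
  by rewrite lerD// ler_wpM2l.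
have h0 : 0 <= 2^-1 :> R by rewrite invr_ge0.
rewrite /potential lerBlDr; apply: (le_trans (lerD (ler_wpM2l lam0 R1) (ler_wpM2l h0 R2))).
by rewrite -/g le_eqVlt; apply/predU1P; left; rewrite /L; field.
Qed.

(** * Existence of a constrained minimiser *)

Local Notation en := (energy_density).
Local Notation adm := (admissible).
Local Notation J lam v := (energy v - potential lam v).

#[local] Hint Resolve energy_density_ge0 : core.

Hypothesis cpt : compact_energy.

Lemma energy_fin v : adm v -> (\int[m2]_z (en v z)%:E = (energy v)%:E)%E.
Proof. by move=> [_ _ iv]; rewrite /energy /Rintegral fineK//; exact: integrable_fin_num. Qed.

Lemma energy_ge0 v : 0 <= energy v.
Proof. by apply: Rintegral_ge0 => z _; exact: energy_density_ge0. Qed.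

Lemma energy_ae_eq (u v : T -> R) : measurable_fun setT u -> measurable_fun setT v ->
  {ae m, forall x, u x = v x} ->
  (\int[m2]_z (en u z)%:E = \int[m2]_z (en v z)%:E)%E.
Proof.
move=> mu mv /ae_prod uv; apply: ae_eq_integral => //.
- by apply/measurable_EFinP; exact: measurable_energy_density.
- by apply/measurable_EFinP; exact: measurable_energy_density.
- by apply: filterS uv => z [e1 e2] _; rewrite /energy_density e1 e2.
Qed.

Lemma potential_ae_eq lam (u v : T -> R) : measurable_fun setT u -> measurable_fun setT v ->
  {ae m, forall x, u x = v x} -> potential lam u = potential lam v.
Proof.
move=> mu mv uv.
have E1 : Rint1 (concave_density u) = Rint1 (concave_density v).
  rewrite /Rintegral; apply: (congr1 fine); apply: ae_eq_integral => //.
  - by apply/measurable_EFinP; apply: measurable_concave_density.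
  - by apply/measurable_EFinP; apply: measurable_concave_density.
  - by apply: filterS uv => x e _; rewrite /concave_density e.
have E2 : Rint2 (choquard_density u) = Rint2 (choquard_density v).
  rewrite /Rintegral; apply: (congr1 fine); apply: ae_eq_integral.
  - exact: measurableT.
  - by apply/measurable_EFinP; apply: measurable_choquard_density.
  - by apply/measurable_EFinP; apply: measurable_choquard_density.
  - by apply: filterS (ae_prod uv) => z [e1 e2] _; rewrite /choquard_density e1 e2.
by rewrite /potential E1 E2.
Qed.

Lemma is_derive_continuous_cvg (g : R -> R) (t dg : R) (s : nat -> R) :
  is_derive t 1 g dg -> s @ \oo --> t -> g \o s @ \oo --> g t.
Proof.
move=> D st; apply: continuous_cvg => //.
by apply: differentiable_continuous; apply/derivable1_diffP; case: D.
Qed.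

Lemma potential_cvg lam (u : nat -> T -> R) (v : T -> R) :
  (forall k, measurable_fun setT (u k)) -> measurable_fun setT v ->
  (forall k x, `|u k x| <= 1) -> (forall k x, ~ Om x -> u k x = 0) ->
  (forall x, `|v x| <= 1) ->
  (forall x, (fun k => u k x) @ \oo --> v x) ->
  (fun k => potential lam (u k)) @ \oo --> potential lam v.
Proof.
move=> mu mv u1 u0 v1 uv.
have u1' k x : u k x <= 1 by exact: le_trans (ler_norm _) (u1 k x).
have iI := integrable_indic_Om.
have [_ C1] : integrable1 (concave_density v) /\
    (fun k => Rint1 (concave_density (u k))) @ \oo -->
    Rint1 (concave_density v).
  apply: (dominated_convergence_Rintegral (g := \1_Om)) => //.
  - by move=> k; apply: measurable_concave_density.
  - exact: measurable_concave_density.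
  - apply: aeW => x _; apply: cvgM; last exact: cvg_cst.
    exact: is_derive_continuous_cvg (is_derive_pospow (v x) (alpha1 x)) (uv x).
  - move=> k x _; have /andP[c0 c1] := concave_density_bound (u1' k x).
    rewrite ger0_norm// indicE; have [xO|xO] := boolP (x \in Om) => //.
    rewrite /concave_density (u0 k x) ?pospow_neg ?mul0r// ?gt_eqF ?(alpha0)//.
    by move=> /mem_set; rewrite (negbTE xO).
have [_ C2] : integrable2 (choquard_density v) /\
    (fun k => Rint2 (choquard_density (u k))) @ \oo -->
    Rint2 (choquard_density v).
  apply: (dominated_convergence_Rintegral (g := fun z => M ^+ 2 * H z)) => //.
  - by move=> k; apply: measurable_choquard_density.
  - exact: measurable_choquard_density.
  - apply: aeW => z _; apply: cvgM; last exact: cvg_cst.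
    by apply: cvgM; [exact: is_derive_continuous_cvg (dF z.1 _) (uv z.1)|
                     exact: is_derive_continuous_cvg (dF z.2 _) (uv z.2)].
  - exact: (integrable_scale _ measurableT integrable_kernel).
  - by move=> k z _; exact: choquard_density_bound.
by apply: cvgD; apply: cvgM => //; exact: cvg_cst.
Qed.

Lemma potential_bound lam : 0 <= lam -> exists B : R, forall v : T -> R,
  measurable_fun setT v -> (forall x, `|v x| <= 1) -> (forall x, ~ Om x -> v x = 0) ->
  potential lam v <= B.
Proof.
move=> lam0.
have iI := integrable_indic_Om.
have iH : integrable2 (fun z => M ^+ 2 * H z).
  exact: (integrable_scale _ measurableT integrable_kernel).
exists (lam * Rint1 (\1_Om) + 2^-1 * Rint2 (fun z => M ^+ 2 * H z)).
move=> v mv v1 v0; rewrite /potential.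
have v1' x : v x <= 1 by exact: le_trans (ler_norm _) (v1 x).
apply: lerD; apply: ler_wpM2l => //; apply: le_Rintegral => //.
- by apply: (integrable_concave_density).
- move=> x _; have /andP[_ c1] := concave_density_bound (v1' x).
  have [xO|xO] := boolP (x \in Om); first exact: c1.
  rewrite v0 ?pospow_neg ?mul0r// ?gt_eqF ?(alpha0)//.
  by move=> /mem_set; rewrite (negbTE xO).
- by apply: (integrable_choquard_density).
- move=> z _; apply: le_trans (ler_norm _) _.
  exact: choquard_density_bound.
Qed.

Lemma admissible0 : adm (fun=> 0).
Proof.
have E z : en (fun=> 0) z = 0.
  by rewrite /energy_density subrr normr0 powR0 ?mul0r// gt_eqF// (p_gt0).
split => //; rewrite (_ : EFin \o _ = cst 0%E); first exact: integrable0.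
by apply/funext => z /=; rewrite E.
Qed.

Lemma energy_density_cvg (u : nat -> T -> R) (v : T -> R) z :
  (forall x, (fun k => u k x) @ \oo --> v x) ->
  (fun k => en (u k) z) @ \oo --> en v z.
Proof.
move=> uv; apply: cvgM; last exact: cvg_cst.
apply: (is_derive_continuous_cvg (is_derive_abspow (v z.1 - v z.2) (p_gt1 z))).
by apply: cvgB.
Qed.

Lemma minimizer lam c : 0 <= lam -> 0 < c <= 1 ->
  exists u : T -> R, [/\ adm u, (forall x, 0 <= u x <= c) &
    forall v, adm v -> (forall x, 0 <= v x <= c) -> J lam u <= J lam v].
Proof.
move=> lam0 /andP[c0 c1].
have [B potB] := potential_bound lam0.
pose A := [set J lam v | v in [set v | adm v /\ forall x, 0 <= v x <= c]].
have v1 (v : T -> R) : (forall x, 0 <= v x <= c) -> forall x, `|v x| <= 1.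
  by move=> vc x; have /andP[vx0 vxc] := vc x; rewrite ger0_norm// (le_trans vxc).
have hasinf : has_inf A.
  split.
    by exists (J lam (fun=> 0)); exists (fun=> 0) => //; split; [exact: admissible0|rewrite lexx ltW].
  exists (- B) => _ [v [[mv v0 iv] vc] <-].
  have := potB v mv (v1 v vc) v0; have := energy_ge0 v; lra.
have /choice[u0 u0P] : forall k : nat, exists v, (adm v /\ forall x, 0 <= v x <= c) /\ J lam v < inf A + harmonic k.
  by move=> k; have [_ [v vP <-] ?] := inf_adherent (harmonic_gt0 k) hasinf; exists v.
have mu0 k : measurable_fun setT (u0 k) by have [[[]]] := u0P k.
have u0c k x : 0 <= u0 k x <= c by have [[_]] := u0P k.
have u0O k x : ~ Om x -> u0 k x = 0 by have [[[_ h _] _] _] := u0P k; exact: h.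
have u0adm k : adm (u0 k) by have [[]] := u0P k.
have [| | |i [v0 [ige mv0 [N [mN N0 cvN]]]]] := cpt mu0.
- by move=> k x; have /andP[-> /le_trans->] := u0c k x.
- exact: u0O.
(* Along the minimising sequence J stays below inf A + 1 and the potential below B. *)
- exists (inf A + 1 + B) => k; rewrite energy_fin// lee_fin.
  have [_ Jk] := u0P k; have Bk := potB _ (mu0 k) (v1 _ (u0c k)) (u0O k).
  have h1 : harmonic k <= 1 :> R by rewrite /harmonic invf_le1// ler1n.
  lra.
(* The limit exists and obeys the constraints only almost everywhere. Multiplying by [I] makes the
   convergence hold at every point; the clamp and the indicator of [Om] in [u] restore the
   constraints at every point. Energy and potential do not see these changes. *)
pose I : T -> R := \1_(~` N).
have mI : measurable_fun setT I by apply: measurable_indic; exact: measurableC.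
pose w k x := u0 (i k) x * I x.
pose u x := clamp c (v0 x) * \1_Om x * I x.
have mw k : measurable_fun setT (w k) by exact: measurable_funM.
have mu : measurable_fun setT u.
  apply: measurable_funM => //; apply: measurable_funM; first exact: measurable_clamp.
  exact: measurable_indic.
have wu x : (fun k => w k x) @ \oo --> u x.
  have [xN|xN] := boolP (x \in ~` N); last first.
    have Ix : I x = 0 by rewrite /I indicE (negbTE xN).
    have -> : u x = 0 by rewrite /u Ix mulr0.
    have -> : (fun k => w k x) = cst 0; last exact: cvg_cst.
    by apply/funext => k; rewrite /w Ix mulr0.
  have Ix : I x = 1 by rewrite /I indicE xN.
  have C : (fun k => u0 (i k) x) @ \oo --> v0 x.
    by apply: contrapT => nc; exact: (set_mem xN (cvN x nc)).
  have -> : (fun k => w k x) = (fun k => u0 (i k) x).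
    by apply/funext => k; rewrite /w Ix mulr1.
  have -> : u x = clamp c (v0 x) * \1_Om x by rewrite /u Ix mulr1.
  have [xO|xO] := pselect (Om x); last first.
    rewrite indicE memNset// mulr0.
    have -> : (fun k => u0 (i k) x) = cst 0 by apply/funext => k; rewrite u0O.
    exact: cvg_cst.
  (* The clamp fixes u0 and contracts distances, so the convergence to v0 passes to its clamp. *)
  rewrite indicE mem_set// mulr1; apply/cvgrPdist_le => e e0.
  move/cvgrPdist_le : C => /(_ _ e0); apply: filterS => k; apply: le_trans.
  by rewrite -[X in _ - X](clamp_id (u0c (i k) x)); exact: clamp_contract (ltW c0).
have aeI : {ae m, forall x, I x = 1}.
  exists N; split => // x /= Ix; apply: contrapT => xN; apply: Ix.
  by rewrite /I indicE mem_set.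
have wae k : {ae m, forall x, w k x = u0 (i k) x}.
  by apply: filterS aeI => x; rewrite /w => ->; rewrite mulr1.
have I01 x : 0 <= I x <= 1 by rewrite /I indicE lern1 leq_b1 andbT ler0n.
have wc k x : 0 <= w k x <= c.
  have /andP[a1 a2] := u0c (i k) x; have /andP[b1 b2] := I01 x.
  by rewrite /w mulr_ge0//= (le_trans _ a2)// ler_piMr.
have wO k x : ~ Om x -> w k x = 0 by move=> xO; rewrite /w u0O// mul0r.
have uc x : 0 <= u x <= c.
  have /andP[b1 b2] := I01 x; have /andP[h1 h2] := clamp_itv (v0 x) (ltW c0).
  have /andP[d1 d2] : 0 <= (\1_Om x : R) <= 1 by rewrite indicE lern1 leq_b1 andbT ler0n.
  rewrite /u !mulr_ge0//= (le_trans _ h2)//.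
  apply: (@le_trans _ _ (clamp c (v0 x) * \1_Om x)); first by rewrite ler_piMr ?mulr_ge0.
  by rewrite ler_piMr.
have uO x : ~ Om x -> u x = 0 by move=> xO; rewrite /u indicE memNset// mulr0 mul0r.
have Ew k : (\int[m2]_z (en (w k) z)%:E < (inf A + harmonic (i k) + potential lam (w k))%:E)%E.
  rewrite (energy_ae_eq (mw k) (mu0 (i k)) (wae k)) energy_fin// lte_fin.
  rewrite (potential_ae_eq _ (mw k) (mu0 (i k)) (wae k)).
  have [_] := u0P (i k); lra.
have Cpot := potential_cvg (lam := lam) mw mu (fun k => v1 _ (wc k)) wO (v1 _ uc) wu.
have Eu : (\int[m2]_z (en u z)%:E <= (inf A + potential lam u)%:E)%E.
  (* [fatou_bound] asks for one bound valid for all indices, so it is applied with an error e to the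
     tail on which the potentials and the minimising error have settled. *)
  apply/lee_addgt0Pr => e e0; rewrite -EFinD.
  have : \forall k \near \oo, inf A + harmonic (i k) + potential lam (w k) <= inf A + potential lam u + e.
    have e2 : 0 < e / 2 by rewrite divr_gt0.
    near=> k.
    have h1 : `|potential lam u - potential lam (w k)| <= e / 2.
      by near: k; move/cvgrPdist_le : Cpot; exact.
    have h2 : `|0 - harmonic k| <= e / 2 :> R.
      by near: k; have /cvgrPdist_le := @cvg_harmonic R; exact.
    have h3 : harmonic (i k) <= harmonic k :> R.
      by rewrite /harmonic lef_pV2 ?posrE// ler_nat ltnS.
    rewrite sub0r normrN ger0_norm ?harmonic_ge0// in h2.
    move: h1; rewrite ler_norml => /andP[h1 h1']; lra.
  move=> [k0 _ k0P].
  apply: (@fatou_bound _ _ _ m2 (fun k => en (w (k + k0)%N)) (en u)) => //.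
  - by move=> k; exact: measurable_energy_density.
  - by move=> z; rewrite (cvg_shiftn k0 (fun k => en (w k) z)); exact: energy_density_cvg.
  - move=> k; apply: (le_trans (ltW (Ew _))); rewrite lee_fin; apply: k0P => /=.
    exact: leq_addl.
have admu : adm u.
  split => //; apply: integrable_lt_pinfty => //; first exact: measurable_energy_density.
  by apply: le_lt_trans Eu _; rewrite ltry.
exists u; split => // v admv vc.
apply: (@le_trans _ _ (inf A)); last first.
  by apply: inf_lbound; [have [] := hasinf|exists v].
by move: Eu; rewrite energy_fin// lee_fin; lra.
Unshelve. all: by end_near. Qed.

(* max (-l) (min t l), written through clamp. *)
Definition trunc (l t : R) := clamp (2 * l) (t + l) - l.

Lemma trunc_contract l s t : 0 <= l -> `|trunc l s - trunc l t| <= `|s - t|.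
Proof.
move=> l0; have -> : s - t = (s + l) - (t + l) by ring.
have -> : trunc l s - trunc l t = clamp (2 * l) (s + l) - clamp (2 * l) (t + l).
  by rewrite /trunc; ring.
by apply: clamp_contract; rewrite mulr_ge0.
Qed.

Lemma trunc_le l t : 0 <= l -> `|trunc l t| <= l.
Proof.
move=> l0; have /andP[h1 h2] := clamp_itv (t + l) (mulr_ge0 (ler0n R 2) l0).
by rewrite /trunc ler_norml; apply/andP; split; lra.
Qed.

Lemma trunc_id l t : `|t| <= l -> trunc l t = t.
Proof.
by rewrite ler_norml /trunc => /andP[t1 t2]; rewrite clamp_id ?addrK//; apply/andP; split; lra.
Qed.

Lemma trunc0 l : 0 <= l -> trunc l 0 = 0.
Proof. by move=> l0; rewrite trunc_id ?normr0. Qed.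

Lemma norm_trunc_le l t : 0 <= l -> `|trunc l t| <= `|t|.
Proof. by move=> l0; have := trunc_contract t 0 l0; rewrite trunc0// !subr0. Qed.

Lemma measurable_trunc l (v : T -> R) : measurable_fun setT v ->
  measurable_fun setT (fun x => trunc l (v x)).
Proof.
move=> mv; apply: measurable_funB; last exact: measurable_cst.
by apply: (measurable_clamp (2 * l) (v := fun x => v x + l)); exact: measurable_funD.
Qed.

(** * The weak equation for a minimiser *)

Definition weak_energy (u w : T -> R) (z : T * T) :=
  `|u z.1 - u z.2| `^ (p z - 2) * (u z.1 - u z.2) * (w z.1 - w z.2) * K z.

Definition weak_concave (u w : T -> R) x := pospow (alpha x - 1) (u x) * w x.

Definition weak_choquard (u w : T -> R) (z : T * T) :=
  F z.1 (u z.1) * f z.2 (u z.2) * w z.2 * H z.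

(** Integrability of w is a separate requirement: admissibility controls differences of w, while |w|
    itself dominates the quotients of the lower order terms. *)
Definition weakly_stationary lam (u : T -> R) := forall w, adm w -> integrable1 w ->
  [/\ integrable2 (weak_energy u w), integrable1 (weak_concave u w),
      integrable2 (weak_choquard u w) &
      Rint2 (weak_energy u w) =
      lam * Rint1 (weak_concave u w) + Rint2 (weak_choquard u w)].

Lemma measurable_weak_energy (u w : T -> R) : measurable_fun setT u ->
  measurable_fun setT w -> measurable_fun setT (weak_energy u w).
Proof.
move=> /measurable_pairdiff mu' /measurable_pairdiff mw.
apply: measurable_funM => //; apply: measurable_funM => //; apply: measurable_funM => //.
apply: measurable_powR2; first exact: measurableT_comp.
exact: measurable_funB.
Qed.

Lemma measurable_weak_concave (u w : T -> R) : measurable_fun setT u ->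
  measurable_fun setT w -> measurable_fun setT (weak_concave u w).
Proof.
move=> mu mw; apply: measurable_funM => //; apply: measurable_powR2; last exact: measurable_funB.
by apply: (@measurable_maxr _ _ _ _ u (cst 0)).
Qed.

Lemma measurable_weak_choquard (u w : T -> R) : measurable_fun setT u ->
  measurable_fun setT w -> measurable_fun setT (weak_choquard u w).
Proof.
move=> mu mw; apply: measurable_funM => //; apply: measurable_funM.
  by apply: measurable_funM; [exact: (measurableT_comp (mF mu))|exact: (measurableT_comp (mf mu))].
exact: (measurableT_comp mw).
Qed.

(** Fubini in the two orders. It identifies the two halves of the derivative of the Choquard
    term. *)
Lemma Rintegral_choquard_swap (u w : T -> R) :
  integrable2 (weak_choquard u w) ->
  integrable2 (fun z => weak_choquard u w (z.2, z.1)) ->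
  Rint2 (fun z => weak_choquard u w (z.2, z.1)) =
  Rint2 (weak_choquard u w).
Proof.
move=> i1 i2; rewrite /Rintegral -(integral12_prod_meas1 i2) -(integral21_prod_meas1 i1).
by apply: (congr1 fine); apply: eq_integral => x _.
Qed.

(* The test functions u + e trunc (c / e) w stay below 2c in absolute value, so they compete
   with u although w may be unbounded. *)
Lemma euler_lagrange_ge lam c (u w : T -> R) : 0 <= lam -> 0 < c -> 2 * c <= 1 ->
  adm u -> (forall x, 0 <= u x <= c) ->
  (forall v, adm v -> (forall x, `|v x| <= 2 * c) -> J lam u <= J lam v) ->
  adm w -> integrable1 w ->
  [/\ integrable2 (weak_energy u w),
      integrable1 (weak_concave u w),
      integrable2 (weak_choquard u w) &
      lam * Rint1 (weak_concave u w) + Rint2 (weak_choquard u w)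
       <= Rint2 (weak_energy u w)].
Proof.
move=> lam0 c0 c21 admu uc umin admw iw.
have [mu uO iu] := admu; have [mw wO iew] := admw.
pose e (k : nat) : R := harmonic k.
have e0 k : 0 < e k by exact: harmonic_gt0.
have e1 k : e k <= 1 by rewrite /e /harmonic invf_le1// ler1n.
have eN0 k : e k != 0 by rewrite gt_eqF.
have ecvg : e @ \oo --> 0 by exact: cvg_harmonic.
pose wk k x := trunc (c / e k) (w x).
have ce0 k : 0 <= c / e k by rewrite divr_ge0// ltW.
have mwk k : measurable_fun setT (wk k) by exact: measurable_trunc.
have wkw k x : `|wk k x| <= `|w x| by exact: norm_trunc_le.
have ewk k x : `|e k * wk k x| <= c.
  by rewrite normrM gtr0_norm// mulrC -ler_pdivlMr// trunc_le.
(* At a fixed x the truncation is inactive once c / e_k >= |w x|, so all pointwise limits are those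
   along u + e_k w. *)
have wk_id x : \forall k \near \oo, wk k x = w x.
  have /cvgrPdist_le : (fun k => `|w x| * e k) @ \oo --> `|w x| * 0.
    by apply: cvgM => //; exact: cvg_cst.
  rewrite mulr0 => /(_ _ c0); apply: filterS => k.
  rewrite sub0r normrN ger0_norm ?mulr_ge0 ?(ltW (e0 k))// => wc.
  by apply: trunc_id; rewrite ler_pdivlMr.
pose v k x := u x + e k * wk k x.
have mv k : measurable_fun setT (v k).
  by apply: measurable_funD => //; apply: measurable_funM.
have u1 x : `|u x| <= c by have /andP[h1 h2] := uc x; rewrite ger0_norm.
have v2c k x : `|v k x| <= 2 * c.
  by apply: (le_trans (ler_normD _ _)); rewrite mulrDl !mul1r lerD.
have cc1 : c <= 1 by lra.
have u1' x : `|u x| <= 1 by exact: le_trans (u1 x) cc1.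
have v1 k x : `|v k x| <= 1 by exact: le_trans (v2c k x) c21.
have vO k x : ~ Om x -> v k x = 0.
  by move=> xO; rewrite /v uO// /wk wO// trunc0// mulr0 addr0.
have pp0 : 0 <= pp by rewrite (le_trans ler01) ?ltW.
pose qe k z := (en (v k) z - en u z) / e k.
(* The bound of [abspow_quotient_le] lacks the 1 / p of the density; the factor [pp] makes up for
   it, and 2^pp bounds 2^p. *)
pose ge z := 2 `^ pp * pp * (en u z + en w z).
have ige : integrable2 ge.
  have := integrableZl measurableT (2 `^ pp * pp) (integrableD measurableT iu iew).
  by apply: eq_integrable.
have qe_le k z : `|qe k z| <= ge z.
  have p1 := p_gt1 z; have p0 := p_gt0 z.
  have /andP[_ ppp] := p_bd z.
  rewrite /qe /energy_density -mulrBl mulrAC normrM (ger0_norm (K0 z)).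
  rewrite (_ : v k z.1 - v k z.2 = (u z.1 - u z.2) + e k * (wk k z.1 - wk k z.2)); last by rewrite /v; ring.
  have eI : 0 < e k <= 1 by rewrite e0 e1.
  apply: (le_trans (ler_wpM2r (K0 z) (abspow_quotient_le (u z.1 - u z.2) (wk k z.1 - wk k z.2) p1 eI))).
  rewrite /ge /energy_density -mulrDl -mulrDl mulrA ler_wpM2r//.
  rewrite -mulrA ler_pM ?powR_ge0 ?addr_ge0 ?powR_ge0//.
    by apply: ler_powR => //; rewrite ler1n.
  rewrite mulrCA -[leLHS]mulr1 ler_pM ?addr_ge0 ?powR_ge0//.
    rewrite lerD2l; apply: ge0_ler_powR; rewrite ?nnegrE// ?(ltW p0)//.
    exact: trunc_contract.
  by rewrite ler_pdivlMr// mul1r.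
have mqe k : measurable_fun setT (qe k).
  by apply: measurable_funM => //; apply: measurable_funB; exact: measurable_energy_density.
have [Iwe Cwe] : integrable2 (weak_energy u w) /\
    (fun k => Rint2 (qe k)) @ \oo --> Rint2 (weak_energy u w).
  apply: (dominated_convergence_Rintegral (g := ge)) => //.
    exact: measurable_weak_energy.
  apply: aeW => z _.
  have p1 := p_gt1 z.
  have Q := is_derive_cvg_quotient (b := w z.1 - w z.2) (is_derive_abspow (u z.1 - u z.2) p1) eN0 ecvg.
  have Q2 : (fun k => (`|(u z.1 - u z.2) + e k * (w z.1 - w z.2)| `^ p z / p z
     - `|u z.1 - u z.2| `^ p z / p z) / e k * K z) @ \oo --> weak_energy u w z.
    by apply: cvgM Q _; exact: cvg_cst.
  apply: cvg_trans Q2.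
  apply: near_eq_cvg; near=> k.
  have -> : qe k z = (`|v k z.1 - v k z.2| `^ p z / p z - `|u z.1 - u z.2| `^ p z / p z) / e k * K z.
    by rewrite /qe /energy_density -mulrBl mulrAC.
  congr ((_ - _) / _ * _).
  congr (`|_| `^ _ / _); rewrite /v.
  have -> : wk k z.1 = w z.1 by near: k; exact: wk_id.
  have -> : wk k z.2 = w z.2 by near: k; exact: wk_id.
  by ring.
have w_int : integrable1 (fun x => `|w x|) by exact: integrable_norm iw.
have mnw : measurable_fun setT (fun x => `|w x|) by exact: measurableT_comp.
have [Iw1 Iw2 _ _] := integrable_weight mnw (fun x => normr_ge0 _) w_int.
have vu k x : v k x - u x = e k * wk k x by rewrite /v addrAC subrr add0r.
pose qc k x := (concave_density (v k) x - concave_density u x) / e k.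
have [Iwc Cwc] : integrable1 (weak_concave u w) /\
    (fun k => Rint1 (qc k)) @ \oo --> Rint1 (weak_concave u w).
  apply: (dominated_convergence_Rintegral (g := fun x => `|w x|)) => //.
  - move=> k; apply: measurable_funM => //; apply: measurable_funB.
      exact: measurable_concave_density.
    exact: measurable_concave_density.
  - exact: measurable_weak_concave.
  - apply: aeW => x _.
    have := is_derive_cvg_quotient (b := w x) (is_derive_pospow_div (u x) (alpha1 x)) eN0 ecvg.
    apply: cvg_trans; apply: near_eq_cvg; near=> k.
    rewrite /qc /concave_density /v; congr ((_ / _ - _) / _).
    by have -> : wk k x = w x by near: k; exact: wk_id.
  - move=> k x _; rewrite /qc normrM normfV (gtr0_norm (e0 k)) ler_pdivrMr//.
    have := concave_density_Lipschitz x (le_trans (ler_norm _) (u1' x)) (le_trans (ler_norm _) (v1 k x)).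
    move=> /le_trans; apply; rewrite vu normrM (gtr0_norm (e0 k)) mulrC.
    by rewrite ler_pM2r.
have F_le x t : `|t| <= 1 -> `|F x t| <= M.
  by move=> t1; have := F_bound x (k := 1) _ t1; rewrite ler01 lexx powR1 mulr1; apply.
have f_leM x t : `|t| <= 1 -> `|f x t| <= M.
  move=> t1; apply: (le_trans (f_le x t1)); rewrite ler_piMr//.
  apply: (@le_trans _ _ (1 `^ (pp - 1))); last by rewrite powR1.
  by apply: ge0_ler_powR; rewrite ?nnegrE// subr_ge0 ltW.
(* On [-1, 1] both F and f are at most M in absolute value, so each half of the Choquard quotient is
   below M^2 |w| H. *)
pose gh z := M ^+ 2 * (`|w z.1| * H z) + M ^+ 2 * (`|w z.2| * H z).
have igh1 : integrable2 (fun z => M ^+ 2 * (`|w z.1| * H z)).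
  exact: (integrable_scale _ measurableT Iw1).
have igh2 : integrable2 (fun z => M ^+ 2 * (`|w z.2| * H z)).
  exact: (integrable_scale _ measurableT Iw2).
have igh : integrable2 gh by exact: (integrable_add measurableT igh1 igh2).
(* The half of the derivative in which the variation falls on the factor at z.1. *)
pose wsw z := weak_choquard u w (z.2, z.1).
have wswE z : wsw z = f z.1 (u z.1) * F z.2 (u z.2) * w z.1 * H z.
  by case: z => x y; rewrite /wsw /weak_choquard /= H_sym; ring.
have mws : measurable_fun setT (weak_choquard u w) by exact: measurable_weak_choquard.
have mwsw : measurable_fun setT wsw.
  apply: (@measurableT_comp _ _ _ _ _ _ (weak_choquard u w) _ (fun z : T * T => (z.2, z.1))) => //.
  exact: measurable_swap.
have Iws : integrable2 (weak_choquard u w).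
  apply: integrable_dominated igh2 => // z _.
  rewrite /weak_choquard !normrM (ger0_norm (H0 z)) mulrA ler_wpM2r// ler_wpM2r// expr2.
  by rewrite ler_pM// ?F_le ?f_leM.
have Iwsw : integrable2 wsw.
  apply: integrable_dominated igh1 => // z _.
  rewrite wswE !normrM (ger0_norm (H0 z)) mulrA ler_wpM2r// ler_wpM2r// expr2.
  by rewrite ler_pM// ?F_le ?f_leM.
pose qh k z := (choquard_density (v k) z - choquard_density u z) / e k.
have qhE k z : qh k z = ((F z.1 (v k z.1) - F z.1 (u z.1)) / e k * F z.2 (v k z.2)
    + F z.1 (u z.1) * ((F z.2 (v k z.2) - F z.2 (u z.2)) / e k)) * H z.
  by rewrite /qh /choquard_density; ring.
have Fq k x : `|(F x (v k x) - F x (u x)) / e k| <= M * `|w x|.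
  rewrite normrM normfV (gtr0_norm (e0 k)) ler_pdivrMr//.
  have k01 : 0 <= (1 : R) <= 1 by rewrite ler01 lexx.
  apply: (le_trans (F_Lipschitz x k01 (u1' x) (v1 k x))).
  rewrite powR1 mulr1 vu normrM (gtr0_norm (e0 k)) -mulrA ler_wpM2l// mulrC.
  by rewrite ler_pM2r.
have Fqcvg x : (fun k => (F x (v k x) - F x (u x)) / e k) @ \oo --> f x (u x) * w x.
  have := is_derive_cvg_quotient (b := w x) (dF x (u x)) eN0 ecvg.
  apply: cvg_trans; apply: near_eq_cvg; near=> k; rewrite /v.
  by have -> : wk k x = w x by near: k; exact: wk_id.
have vcvg x : (fun k => v k x) @ \oo --> u x.
  have : (fun k => u x + e k * w x) @ \oo --> u x + 0 * w x.
    by apply: cvgD; [exact: cvg_cst|apply: cvgM => //; exact: cvg_cst].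
  rewrite mul0r addr0; apply: cvg_trans; apply: near_eq_cvg; near=> k; rewrite /v.
  by have -> : wk k x = w x by near: k; exact: wk_id.
have [_ Cwh] : integrable2 (fun z => wsw z + weak_choquard u w z) /\
    (fun k => Rint2 (qh k)) @ \oo --> Rint2 (fun z => wsw z + weak_choquard u w z).
  apply: (dominated_convergence_Rintegral (g := gh)) => //.
  - move=> k; apply: measurable_funM => //; apply: measurable_funB.
      exact: measurable_choquard_density.
    exact: measurable_choquard_density.
  - exact: measurable_funD.
  - apply: aeW => z _.
    have -> : wsw z + weak_choquard u w z =
       (f z.1 (u z.1) * w z.1 * F z.2 (u z.2) + F z.1 (u z.1) * (f z.2 (u z.2) * w z.2)) * H z.
      by rewrite wswE /weak_choquard; ring.
    rewrite (_ : (fun k => qh k z) = (fun k => ((F z.1 (v k z.1) - F z.1 (u z.1)) / e k * F z.2 (v k z.2)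
    + F z.1 (u z.1) * ((F z.2 (v k z.2) - F z.2 (u z.2)) / e k)) * H z)); last by apply/funext => k; exact: qhE.
    apply: cvgM; last exact: cvg_cst.
    apply: cvgD; apply: cvgM => //; last exact: cvg_cst.
    exact: is_derive_continuous_cvg (dF z.2 _) (vcvg z.2).
  - move=> k z _; rewrite qhE normrM (ger0_norm (H0 z)) /gh (mulrA (M ^+ 2) `|w z.1|) (mulrA (M ^+ 2) `|w z.2|) -mulrDl ler_wpM2r//.
    apply: (le_trans (ler_normD _ _)); rewrite (normrM ((F z.1 (v k z.1) - F z.1 (u z.1)) / e k)) (normrM (F z.1 (u z.1))).
    rewrite expr2 -!mulrA; apply: lerD.
      by rewrite mulrC ler_pM// F_le.
    by rewrite ler_pM// F_le.
(* Minimality of u against [v k], divided by e_k > 0; all three quotients converge, so the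
   inequality survives in the limit. *)
have quot k : lam * Rint1 (qc k) + 2^-1 * Rint2 (qh k) <= Rint2 (qe k).
  have Iqe : integrable2 (qe k) by exact: integrable_dominated ige.
  have Ieqe : integrable2 (fun z => e k * qe k z).
    exact: (integrable_scale _ measurableT Iqe).
  have Ev z : en (v k) z = en u z + e k * qe k z.
    by rewrite /qe mulrC divfK// addrC subrK.
  have Iv : integrable2 (en (v k)).
    have := integrableD measurableT iu Ieqe; apply: eq_integrable => // z _ /=.
    by rewrite Ev.
  have admv : adm (v k) by split => //; exact: vO.
  have := umin _ admv (v2c k).
  have -> : energy (v k) = energy u + e k * Rint2 (qe k).
    rewrite -RintegralZl// -RintegralD//; apply: eq_Rintegral => z _; exact: Ev.
  have Ic1 := integrable_concave_density (mv k) (fun x => le_trans (ler_norm _) (v1 k x)) (vO k).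
  have Ic2 := integrable_concave_density mu (fun x => le_trans (ler_norm _) (u1' x)) uO.
  have Ih1 := integrable_choquard_density (mv k) (v1 k).
  have Ih2 := integrable_choquard_density mu u1'.
  have -> : Rint1 (qc k) = (Rint1 (concave_density (v k)) - Rint1 (concave_density u)) / e k.
    rewrite -RintegralB// -RintegralZr//.
    exact: (integrable_sub measurableT Ic1 Ic2).
  have -> : Rint2 (qh k) = (Rint2 (choquard_density (v k)) - Rint2 (choquard_density u)) / e k.
    rewrite -RintegralB// -RintegralZr//.
    exact: (integrable_sub measurableT Ih1 Ih2).
  rewrite /potential => Jle; rewrite !mulrA -mulrDl ler_pdivrMr//.
  by move: Jle; move: (energy _) (Rintegral _ _ _) (Rintegral _ _ _) (Rintegral _ _ _) (Rintegral _ _ _) (Rintegral _ _ _) => *; lra.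
split=> //.
(* The derivative consists of two equal halves, and the 1/2 in [potential] keeps one. *)
have -> : Rint2 (weak_choquard u w) = 2^-1 * Rint2 (fun z => wsw z + weak_choquard u w z).
  rewrite RintegralD// (Rintegral_choquard_swap Iws Iwsw); lra.
have Cpot : (fun k => lam * Rint1 (qc k) + 2^-1 * Rint2 (qh k)) @ \oo -->
    lam * Rint1 (weak_concave u w) +
    2^-1 * Rint2 (fun z => wsw z + weak_choquard u w z).
  by apply: cvgD; apply: cvgM => //; exact: cvg_cst.
by apply: (ler_cvg_to Cpot Cwe); exact: nearW.
Unshelve. all: by end_near. Qed.

(** Since e_k > 0, each direction gives one inequality. The forms are linear in w, and the
    competitors |v| <= 2c allow -w as well as w, even where u = 0 or u = c. *)
Lemma euler_lagrange lam c (u : T -> R) : 0 <= lam -> 0 < c -> 2 * c <= 1 ->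
  adm u -> (forall x, 0 <= u x <= c) ->
  (forall v, adm v -> (forall x, `|v x| <= 2 * c) -> J lam u <= J lam v) ->
  weakly_stationary lam u.
Proof.
move=> lam0 c0 c21 admu uc umin w admw iw.
have [I1 I2 I3 le1] := euler_lagrange_ge lam0 c0 c21 admu uc umin admw iw.
have admNw : adm (fun x => - w x).
  have [mw wO iew] := admw; split; first exact: measurable_funN.
    by move=> x /wO ->; rewrite oppr0.
  apply: eq_integrable iew => // z _.
  rewrite /energy_density /= (_ : - w z.1 - - w z.2 = - (w z.1 - w z.2)) ?normrN//; ring.
have iNw : integrable1 (fun x => - w x).
  by have := integrableN iw; apply: eq_integrable.
have [_ _ _] := euler_lagrange_ge lam0 c0 c21 admu uc umin admNw iNw.
have -> : weak_energy u (fun x => - w x) = (fun z => -1 * weak_energy u w z).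
  by apply/funext => z; rewrite /weak_energy; ring.
have -> : weak_concave u (fun x => - w x) = (fun z => -1 * weak_concave u w z).
  by apply/funext => z; rewrite /weak_concave; ring.
have -> : weak_choquard u (fun x => - w x) = (fun z => -1 * weak_choquard u w z).
  by apply/funext => z; rewrite /weak_choquard; ring.
rewrite !RintegralZl// => le2; split=> //; apply/eqP; rewrite eq_le le1 andbT.
move: le2; move: (Rintegral _ _ _) (Rintegral _ _ _) (Rintegral _ _ _) => ? ? ? ?; lra.
Qed.

(** * Nontriviality and the choice of the constants *)

Variable bump : T -> R.
Hypothesis bump_adm : adm bump.
Hypothesis bump01 : forall x, 0 <= bump x <= 1.
Hypothesis bumpN0 : ~ {ae m, forall x, bump x = 0}.

Lemma clamp_decreases lam c v : 0 <= lam -> 0 < c -> 2 * c <= 1 ->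
  lam + M ^+ 2 * CH * ((2 * c) `^ (pp - 1) * (2 * c) `^ pp) <= kappa * c `^ (pp - 1) ->
  adm v -> (forall x, `|v x| <= 2 * c) ->
  adm (clamp c \o v) /\ J lam (clamp c \o v) <= J lam v.
Proof.
move=> lam0 c0 c21 small admv v2c; have [mv vO _] := admv.
have c01 : 0 < c <= 1 by rewrite c0; lra.
have [ig Hpot] := potential_clamp lam0 c0 c21 mv vO v2c.
have [admc /(_ ig) Hen] := energy_clamp c01 admv.
split=> //.
have g0 : 0 <= Rint1 (fun x => Num.max 0 (v x - c)).
  by apply: Rintegral_ge0 => x _; rewrite le_max lexx.
have := ler_wpM2r g0 small; move: Hpot Hen.
move: (energy _) (energy _) (potential _ _) (potential _ _) => *; lra.
Qed.

Lemma bump_potential_gt0 : 0 < Rint1 (concave_density bump).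
Proof.
have [mb bO _] := bump_adm.
have cd0 x : 0 <= concave_density bump x.
  by have /andP[_ b1] := bump01 x; have /andP[] := concave_density_bound b1.
rewrite lt_def; apply/andP; split; last by apply: Rintegral_ge0 => x _; exact: cd0.
apply/negP => /eqP E; apply: bumpN0.
have Ib := integrable_concave_density mb (fun x => proj2 (andP (bump01 x))) bO.
have Z : (\int[m]_x `|(concave_density bump x)%:E| = 0)%E.
  under eq_integral do rewrite gee0_abs ?lee_fin//.
  by rewrite -(fineK (integrable_fin_num measurableT Ib)) -[fine _]/(Rintegral _ _ _) E.
have mcb : measurable_fun setT (EFin \o concave_density bump).
  by apply/measurable_EFinP; exact: measurable_concave_density.
have /ae_eq_integral_abs : measurable_fun setT (EFin \o concave_density bump) by [].
move=> /(_ m measurableT)[+ _] => /(_ Z); apply: filterS => x /(_ I) /= [].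
rewrite /concave_density pospow_pos; last by have /andP[] := bump01 x.
move=> /eqP; rewrite mulf_eq0 invr_eq0 (gt_eqF (alpha0 x)) orbF.
by move=> /eqP /powR_eq0_eq0.
Qed.

(* J (t bump) <= X t^pm - lam D t^alp with alp < pm. *)
Lemma bump_scaled lam c : 0 < lam -> 0 < c <= 1 ->
  exists v, [/\ adm v, forall x, 0 <= v x <= c & J lam v < 0].
Proof.
move=> lam0 /andP[c0 c1]; have [mb bO ib] := bump_adm.
have b1 x : bump x <= 1 by have /andP[] := bump01 x.
have b0 x : 0 <= bump x by have /andP[] := bump01 x.
have D0 := bump_potential_gt0; set D := Rintegral _ _ _ in D0.
have iH := integrable_kernel.
pose X := energy bump + M ^+ 2 * Rint2 H.
have X0 : 0 <= X.
  by rewrite addr_ge0 ?energy_ge0// mulr_ge0 ?sqr_ge0// Rintegral_ge0.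
have dp : 0 < pm - alp by rewrite subr_gt0.
(* The second entry solves t^(pm - alp) (X + 1) = lam D; the 1 added to X makes the final inequality
   strict and the quotient meaningful for X = 0. *)
pose t := Num.min c ((lam * D / (X + 1)) `^ (pm - alp)^-1).
have rho0 : 0 < lam * D / (X + 1) by rewrite divr_gt0 ?mulr_gt0// ltr_wpDl.
have t0 : 0 < t by rewrite lt_min c0 powR_gt0.
have tc : t <= c by rewrite ge_min lexx.
have t1 : 0 < t <= 1 by rewrite t0 (le_trans tc).
have t_small : t `^ (pm - alp) * X < lam * D.
  apply: (@le_lt_trans _ _ (lam * D / (X + 1) * X)).
    apply: ler_wpM2r => //.
    apply: (@le_trans _ _ (((lam * D / (X + 1)) `^ (pm - alp)^-1) `^ (pm - alp))).
      apply: ge0_ler_powR; rewrite ?nnegrE ?powR_ge0 ?(ltW t0) ?(ltW dp)//.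
      by rewrite ge_min lexx orbT.
    by rewrite -powRrM mulVf ?gt_eqF// powRr1// ltW.
  rewrite mulrAC ltr_pdivrMr ?ltr_wpDl// ltr_pM2l ?mulr_gt0//; lra.
pose v x := t * bump x.
have mv : measurable_fun setT v by exact: measurable_funM.
have vt x : 0 <= v x <= t by rewrite /v mulr_ge0 ?(ltW t0)//= ler_piMr// ltW.
have v1 x : `|v x| <= t by have /andP[h1 h2] := vt x; rewrite ger0_norm.
have vO x : ~ Om x -> v x = 0 by move=> xO; rewrite /v bO// mulr0.
have tt1 : t <= 1 by have /andP[] := t1.
have v1' x : `|v x| <= 1 by exact: le_trans (v1 x) _.
have v1'' x : v x <= 1 by exact: le_trans (ler_norm _) (v1' x).
have en_le z : en v z <= t `^ pm * en bump z.
  rewrite /energy_density /v -mulrBr normrM (gtr0_norm t0) powRM ?(ltW t0)//.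
  rewrite -!mulrA ler_wpM2r ?mulr_ge0 ?powR_ge0 ?invr_ge0 ?(ltW (p_gt0 z))//.
  by apply: ger_powR => //; have /andP[] := p_bd z.
have ien : integrable2 (fun z => t `^ pm * en bump z) by exact: (integrable_scale _ measurableT ib).
have iv : integrable2 (en v).
  apply: integrable_dominated ien => //; first exact: measurable_energy_density.
  by move=> z _; rewrite ger0_norm.
exists v; split; first by split.
  by move=> x; have /andP[-> h] := vt x; rewrite (le_trans h).
have E1 : energy v <= t `^ pm * energy bump.
  rewrite /energy -RintegralZl//; apply: le_Rintegral => //.
  by move=> z _; exact: en_le.
have Ib := integrable_concave_density mb b1 bO.
have Iv := integrable_concave_density mv v1'' vO.
have E2 : t `^ alp * D <= Rint1 (concave_density v).
  rewrite /D -(RintegralZl _ measurableT Ib); apply: (le_Rintegral measurableT _ Iv).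
    exact: (integrable_scale _ measurableT Ib).
  move=> x _; rewrite /concave_density !pospow_pos ?mulr_ge0 ?(ltW t0)//.
  rewrite /v powRM ?(ltW t0)// mulrA ler_wpM2r ?invr_ge0 ?(ltW (alpha0 x))//.
  by rewrite ler_wpM2r ?powR_ge0//; apply: ger_powR.
(* The Choquard term has order t^(2 pp) in absolute value, which for t <= 1 is absorbed into the
   t^pm of the energy. *)
have tpp : t `^ pp * t `^ pp <= t `^ pm.
  have pmpp : pm <= pp by have /andP[h1 h2] := p_bd (point, point); exact: le_trans h2.
  apply: (@le_trans _ _ (1 * t `^ pp)).
    rewrite ler_wpM2r ?powR_ge0// -(powRr0 t); apply: ger_powR => //.
    by rewrite (le_trans ler01)// ltW.
  by rewrite mul1r; apply: ger_powR.
have E3 : - (t `^ pm * (M ^+ 2 * Rint2 H)) <= Rint2 (choquard_density v).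
  rewrite -mulNr mulrA -RintegralZl//; apply: le_Rintegral => //.
  - exact: (integrable_scale _ measurableT iH).
  - by apply: (integrable_choquard_density).
  - move=> z _; rewrite mulNr mulNr lerNl; apply: (le_trans (ler_norm _)); rewrite normrN.
    rewrite /choquard_density normrM (ger0_norm (H0 z)) ler_wpM2r//.
    have t01 : 0 <= t <= 1 by rewrite ltW.
    have B1 := F_bound z.1 t01 (v1 z.1).
    have B2 := F_bound z.2 t01 (v1 z.2).
    rewrite normrM; apply: (le_trans (ler_pM _ _ B1 B2)) => //.
    rewrite (_ : M * t `^ pp * (M * t `^ pp) = (t `^ pp * t `^ pp) * M ^+ 2); last by ring.
    by rewrite ler_wpM2r// sqr_ge0.
have key : t `^ pm * X < lam * (t `^ alp * D).
  have E : t `^ pm = t `^ alp * t `^ (pm - alp).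
    rewrite -powRD ?(gt_eqF t0) ?implybT//; congr (_ `^ _); ring.
  by rewrite E -mulrA [ltRHS]mulrCA ltr_pM2l// powR_gt0.
have E2' := ler_wpM2l (ltW lam0) E2.
have Y0 : 0 <= t `^ pm * (M ^+ 2 * Rint2 H).
  by rewrite !mulr_ge0 ?powR_ge0 ?sqr_ge0// Rintegral_ge0.
move: key E1 E2' E3 Y0; rewrite /X mulrDr /potential.
set a1 := t `^ pm * (_ * _); set a2 := t `^ pm * energy _; set a3 := lam * (_ * D).
set a4 := lam * Rintegral _ _ _; set a5 := Rintegral _ _ _; set a6 := energy _.
by move: (a1) (a2) (a3) (a4) (a5) (a6) => ? ? ? ? ? ?; lra.
Qed.

Theorem variational_solution : exists Lam : R, 0 < Lam /\
  forall lam, 0 < lam < Lam -> exists u : T -> R,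
  [/\ adm u, (forall x, 0 <= u x <= 1), ~ {ae m, forall x, u x = 0} & weakly_stationary lam u].
Proof.
pose A := M ^+ 2 * CH * (2 `^ (pp - 1) * 2 `^ pp).
have A0 : 0 <= A by rewrite !mulr_ge0 ?powR_ge0 ?sqr_ge0.
(* The entry 1/2 gives 2c <= 1. The other gives A c <= kappa / 2, where A collects the powers of 2
   of the Choquard constant; as c^pp <= c, that term uses half of the gain kappa c^(pp - 1) and the
   other half is left for lam, which dictates [Lam]. *)
pose c := Num.min (2^-1) (kappa / (2 * (A + 1))).
have c0 : 0 < c by rewrite lt_min invr_gt0 ltr0n/= divr_gt0// mulr_gt0// ltr_wpDl.
have c2 : c <= 2^-1 by rewrite ge_min lexx.
have c21 : 2 * c <= 1 by lra.
have c01 : 0 < c <= 1 by rewrite c0; lra.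
have Ac : A * c <= kappa / 2.
  have : c <= kappa / (2 * (A + 1)) by rewrite ge_min lexx orbT.
  rewrite ler_pdivlMr ?mulr_gt0 ?ltr_wpDl// => h.
  have := mulr_ge0 A0 (ltW c0); lra.
have cp0 : 0 < c `^ (pp - 1) by exact: powR_gt0.
exists (kappa / 2 * c `^ (pp - 1)); split; first by rewrite !mulr_gt0// invr_gt0.
move=> lam /andP[lam0 lamL].
have small : lam + M ^+ 2 * CH * ((2 * c) `^ (pp - 1) * (2 * c) `^ pp) <= kappa * c `^ (pp - 1).
  have -> : M ^+ 2 * CH * ((2 * c) `^ (pp - 1) * (2 * c) `^ pp) = c `^ (pp - 1) * (A * c `^ pp).
    by rewrite !powRM ?(ltW c0)// /A; ring.
  have h : c `^ (pp - 1) * (A * c `^ pp) <= c `^ (pp - 1) * (kappa / 2).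
    rewrite ler_pM2l//; apply: le_trans Ac; rewrite ler_wpM2l//.
    by apply: ge1r_powR => //; exact: ltW.
  move: lamL h; move: (c `^ (pp - 1)) (_ * (A * _)) => *; lra.
have [u [admu uc umin]] := minimizer (ltW lam0) c01.
exists u; split => //.
- by move=> x; have /andP[-> h] := uc x; rewrite (le_trans h); lra.
- move=> u0; have [v [admv vc Jv]] := bump_scaled lam0 c01.
  have := umin v admv vc; have [mu _ _] := admu.
  have m0 : measurable_fun setT ((fun=> 0) : T -> R) by exact: measurable_cst.
  rewrite (potential_ae_eq lam mu m0 u0).
  have := energy_ge0 u; suff -> : potential lam (fun=> 0) = 0.
    by move: Jv; move: (energy _) (energy _) => *; lra.
  rewrite /potential.
  rewrite (_ : concave_density (fun=> 0) = fun=> 0); last first.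
    by apply/funext => x; rewrite /concave_density pospow_neg ?mul0r// gt_eqF ?(alpha0).
  rewrite (_ : choquard_density (fun=> 0) = fun=> 0); last first.
    by apply/funext => z; rewrite /choquard_density F_neg// !mul0r.
  by rewrite /Rintegral !integral0 !mulr0 addr0.
- apply: (euler_lagrange (ltW lam0) c0 c21 admu uc) => v admv v2c.
  have [admc] := clamp_decreases (ltW lam0) c0 c21 small admv v2c.
  apply: le_trans; apply: umin => // x; exact: clamp_itv (ltW c0).
Qed.

End variational.

(** * Compactness of bounded energy sequences *)

Section summable_cvg.
Context d (T : measurableType d) (R : realType).
Variable m : {measure set T -> \bar R}.

(** The series of the increments has a finite integral, so it is finite almost everywhere, and there
    the telescoping sum converges absolutely. *)
Lemma ae_cvg_of_summable (u : nat -> T -> R) : (forall k, measurable_fun setT (u k)) ->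
  (forall k, (\int[m]_x (`|u k.+1 x - u k x|)%:E <= (1 / (2 ^ k.+1)%:R)%:E)%E) ->
  exists v : T -> R, measurable_fun setT v /\
    {ae m, forall x, (fun k => u k x) @ \oo --> v x}.
Proof.
move=> mu du.
pose g k x := (`|u k.+1 x - u k x|)%:E : \bar R.
have g0 k x : (0 <= g k x)%E by rewrite lee_fin.
have mg k : measurable_fun setT (g k).
  by apply/measurable_EFinP; apply: measurableT_comp => //; exact: measurable_funB.
have Ig : m.-integrable setT (fun x => \sum_(0 <= k <oo) g k x)%E.
  apply/integrableP; split.
    by apply: ge0_emeasurable_sum => // k x _ _; exact: g0.
  under eq_integral do rewrite gee0_abs ?nneseries_ge0//.
  rewrite integral_nneseries//; apply: le_lt_trans (ltry 1).
  apply: le_trans (epsilon_trick0 xpredT ler01).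
  by apply: lee_nneseries => [k _ _|k _]; [exact: integral_ge0|exact: du].
have cvg_u x : (\sum_(0 <= k <oo) g k x)%E \is a fin_num -> cvgn (fun k => u k x).
  move=> fin; have : cvgn (series (telescope (fun k => u k x))).
    apply: normed_cvg; apply: nondecreasing_is_cvgn.
      apply: nondecreasing_series => k _ _ /=; exact: normr_ge0.
    exists (fine (\sum_(0 <= k <oo) g k x)%E) => _ [n _ <-].
    rewrite -lee_fin fineK// /series /= -sumEFin.
    by apply: (@nneseries_lim_ge _ (fun k => g k x) xpredT 0%N n) => k _ _; exact: g0.
  move=> c; have : cvgn (fun k => series (telescope (fun k => u k x)) k + u 0%N x).
    by apply: is_cvgD => //; exact: is_cvg_cst.
  by under eq_fun do rewrite telescopeK /= subrK.
have [N [mN N0 aeN]] := integrable_ae measurableT Ig.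
(* With the exceptional null set erased the sequence converges at every point, and its limit is
   measurable. *)
pose I : T -> R := \1_(~` N).
have mI : measurable_fun setT I by apply: measurable_indic; exact: measurableC.
pose v x := lim ((fun k => u k x * I x) @ \oo).
have cI x : cvgn (fun k => u k x * I x).
  rewrite /I indicE; have [xN|xN] := boolP (x \in ~` N); last first.
    have -> : (fun k => u k x * false%:R) = cst 0 by apply/funext => k; rewrite mulr0.
    exact: is_cvg_cst.
  have -> : (fun k => u k x * true%:R) = (fun k => u k x) by apply/funext => k; rewrite mulr1.
  apply: cvg_u; apply: contrapT => nf; apply: (set_mem xN); apply: aeN => /=.
  by move/(_ Logic.I).
exists v; split.
  apply: (@measurable_fun_cvg _ _ _ _ (fun k x => u k x * I x)).
    by move=> k; exact: measurable_funM.
  by move=> x _; exact: cI.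
exists N; split => // x /= nc; apply: contrapT => xN; apply: nc.
have Ix : I x = 1 by rewrite /I indicE mem_set.
have := cI x; rewrite /v; under eq_fun do rewrite Ix mulr1.
by [].
Qed.

End summable_cvg.

(** Along an ultrafilter every sequence in [0, 1] has a limit, and finitely many limits are
    approached on a common member. One ultrafilter serves all partitions at once, which spares the
    successive extraction of subsequences. *)
Lemma ultra_finite_cauchy (R : realType) (U : set_system nat) (I : finType)
    (a : nat -> I -> R) (eta : R) : UltraFilter U ->
  (forall k i, 0 <= a k i <= 1) -> 0 < eta ->
  exists A, U A /\ forall j k, A j -> A k -> forall i, `|a j i - a k i| <= eta.
Proof.
move=> UU a01 eta0.
have eta2 : 0 < eta / 2 by rewrite divr_gt0.
have /choice[l lP] : forall i, exists l : R, U [set k | `|l - a k i| <= eta / 2].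
  move=> i.
  have [|l [_ cl]] := @segment_compact R 0 1 ((fun k => a k i) @ U) _.
    suff : U ((fun k => a k i) @^-1` `[0, 1]) by [].
    by apply: filterS filterT => k _; rewrite /= in_itv/= a01.
  exists l; have [//|UC] := in_ultra_setVsetC [set k | `|l - a k i| <= eta / 2] UU.
  have nb : nbhs l [set x : R | `|l - x| <= eta / 2].
    by apply/nbhs_ballP; exists (eta / 2) => //= x; rewrite /ball/= => /ltW.
  have UC' : ((fun k => a k i) @ U) ((fun k => a k i) @` (~` [set k | `|l - a k i| <= eta / 2])).
    suff : U ((fun k => a k i) @^-1` ((fun k => a k i) @` (~` [set k | `|l - a k i| <= eta / 2]))) by [].
    by apply: filterS UC => k kC; exists k.
  by have [_ [[k /= kC <-]]] := cl _ _ UC' nb.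
exists [set k | forall i, `|l i - a k i| <= eta / 2]; split.
  exact: (@filter_forall _ _ (fun i => [set k | `|l i - a k i| <= eta / 2]) U _ lP).
move=> j k /= Aj Ak i.
rewrite (_ : a j i - a k i = (l i - a k i) - (l i - a j i)); last by ring.
apply: (le_trans (ler_normB _ _)); have := Aj i; have := Ak i; lra.
Qed.

Section tonelli_setX.
Context d (T : measurableType d) (R : realType).
Variable m : {sigma_finite_measure set T -> \bar R}.

Lemma tonelli_setX (A B : set T) (g : T * T -> \bar R) : measurable A -> measurable B ->
  measurable_fun setT g -> (forall z, (0 <= g z)%E) ->
  (\int[m \x m]_(z in A `*` B) g z = \int[m]_(x in A) \int[m]_(y in B) g (x, y))%E.
Proof.
move=> mA mB mg g0; have mAB : measurable (A `*` B) by exact: measurableX.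
rewrite integral_mkcond (fubini_tonelli1 (g \_ (A `*` B))); last 2 first.
- by apply/(measurable_restrictT _ mAB); exact: measurable_funTS.
- by move=> z; apply: erestrict_ge0 => ? _.
rewrite [RHS]integral_mkcond; apply: eq_integral => x _; rewrite /fubini_F patchE.
have [xA|xA] := boolP (x \in A).
  rewrite [RHS]integral_mkcond; apply: eq_integral => y _.
  by rewrite !patchE in_setX /= xA.
rewrite -[RHS](integral0 m setT); apply: eq_integral => y _.
by rewrite patchE in_setX /= (negbTE xA).
Qed.

End tonelli_setX.

Section compactness.
Context d (T : measurableType d) (R : realType).
Variable m : {sigma_finite_measure set T -> \bar R}.
Local Notation m2 := (m \x m)%E.
Variables (Om : set T) (p K : T * T -> R) (pm pp V : R).
Hypothesis mOm : measurable Om.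
Hypothesis mp : measurable_fun setT p.
Hypothesis mK : measurable_fun setT K.
Hypothesis K0 : forall z, 0 <= K z.
Hypothesis pm1 : 1 < pm.
Hypothesis p_bd : forall z, pm <= p z <= pp.
Hypothesis V0 : 0 <= V.
(** The cells have equal measure c and total measure at most V, with V independent of [del]: errors
    proportional to c on each cell add up to the same multiple of V, however fine the partition. *)
Hypothesis cells : forall del : R, 0 < del ->
  exists (I : finType) (C : I -> set T) (c : R),
  [/\ forall i, measurable (C i), trivIset setT C, Om `<=` \bigcup_i C i,
      [/\ 0 < c, (forall i, m (C i) = c%:E) & \sum_(i : I) c <= V] &
      forall i x y, C i x -> C i y -> x <> y -> c^-1 <= del * K (x, y)].

Local Notation en := (energy_density p K).
Let en0 v z : 0 <= en v z. Proof. exact: (energy_density_ge0 K0 pm1 p_bd). Qed.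
Let men (v : T -> R) : measurable_fun setT v -> measurable_fun setT (en v).
Proof. exact: (measurable_energy_density mp mK pm1 p_bd). Qed.

Let pp1 : 1 < pp.
Proof. by have /andP[h1 h2] := p_bd (point, point); exact: lt_le_trans pm1 (le_trans h1 h2). Qed.
Let pp0 : 0 <= pp. Proof. by rewrite ltW// (lt_trans _ pp1). Qed.

(* An oscillation above eta is at most eta^(1-pp) times its p-th power. *)
Lemma oscillation_le (eta del c : R) (x y : T) (u : T -> R) : 0 < eta <= 1 ->
  0 < c -> 0 <= del -> (forall x, 0 <= u x <= 1) ->
  (x <> y -> c^-1 <= del * K (x, y)) ->
  c^-1 * `|u x - u y| <= c^-1 * eta + eta `^ (1 - pp) * del * pp * en u (x, y).
Proof.
move=> /andP[eta0 eta1] c0 del0 u01 cK.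
have R0 : 0 <= eta `^ (1 - pp) * del * pp * en u (x, y).
  by apply: mulr_ge0; [apply: mulr_ge0 => //; apply: mulr_ge0 => //; exact: powR_ge0|exact: en0].
have [le_eta|eta_lt] := leP `|u x - u y| eta.
  by rewrite ler_wpDr// ler_wpM2l// invr_ge0 ltW.
rewrite ler_wpDl// ?mulr_ge0 ?invr_ge0 ?(ltW c0) ?(ltW eta0)//.
have xy : x <> y by move=> E; move: eta_lt; rewrite E subrr normr0 ltNge (ltW eta0).
set a := `|u x - u y|.
have a0 : 0 < a by exact: lt_trans eta0 _.
have a1 : a <= 1 by exact: norm_sub_itv01.
have /andP[_ ppp] := p_bd (x, y).
have h1 : a <= eta `^ (1 - pp) * a `^ p (x, y).
  apply: (@le_trans _ _ (a `^ (1 - pp) * a `^ pp)).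
    by rewrite -powRD ?(gt_eqF a0) ?implybT// subrK powRr1// ltW.
  apply: ler_pM; rewrite ?powR_ge0//; last by apply: ger_powR; rewrite ?a0.
  rewrite -[X in a `^ X]opprB -[X in eta `^ X]opprB !powRN.
  rewrite lef_pV2 ?posrE ?powR_gt0//; apply: ge0_ler_powR; rewrite ?nnegrE ?subr_ge0 ?(ltW pp1) ?(ltW eta0) ?(ltW a0)//.
  exact: ltW.
rewrite /energy_density /= -/a.
apply: (@le_trans _ _ ((del * K (x, y)) * (eta `^ (1 - pp) * a `^ p (x, y)))).
  by apply: ler_pM; rewrite ?invr_ge0 ?(ltW c0) ?(ltW a0)//; exact: cK.
rewrite (_ : eta `^ (1 - pp) * del * pp * _ =
  (del * K (x, y)) * (eta `^ (1 - pp) * a `^ p (x, y)) * (pp / p (x, y))); last by ring.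
rewrite ler_peMr ?mulr_ge0 ?powR_ge0//.
by rewrite ler_pdivlMr ?mul1r// (p_gt0 pm1 p_bd).
Qed.

Lemma integrable_on_cell (g : T -> R) C (c : R) : measurable C -> m C = c%:E ->
  measurable_fun setT g -> (forall x, `|g x| <= 1) -> m.-integrable C (EFin \o g).
Proof.
move=> mC mCc mg g1; have fC : (m C < +oo)%E by rewrite mCc ltry.
apply: measurable_bounded_integrable => //; first exact: measurable_funTS.
exists 1; split; first exact: num_real.
by move=> t t1 y _; exact: le_trans (g1 y) (ltW t1).
Qed.

Definition cell_mean (u : T -> R) (C : set T) (c : R) := Rintegral m C u / c.

Lemma cell_mean_itv (u : T -> R) C c : measurable C -> 0 < c -> m C = c%:E ->
  measurable_fun setT u -> (forall x, 0 <= u x <= 1) -> 0 <= cell_mean u C c <= 1.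
Proof.
move=> mC c0 mCc mu u01.
have iu : m.-integrable C (EFin \o u).
  by apply: (integrable_on_cell mC mCc mu) => x; have /andP[h0 h1] := u01 x; rewrite ger0_norm.
have i1 : m.-integrable C (EFin \o (cst 1 : T -> R)).
  by apply: (integrable_on_cell mC mCc) => // x; rewrite normr1.
rewrite /cell_mean divr_ge0 ?(ltW c0)//=; last first.
  by apply: Rintegral_ge0 => x _; have /andP[] := u01 x.
rewrite ler_pdivrMr// mul1r.
have mC1 : fine (m C) = c by rewrite mCc.
have -> : c = Rintegral m C (cst 1) by rewrite Rintegral_cst// mul1r -mC1.
by apply: le_Rintegral => // x _; have /andP[] := u01 x.
Qed.

Lemma cell_mean_dist (u : T -> R) C c x : measurable C -> 0 < c -> m C = c%:E ->
  measurable_fun setT u -> (forall x, 0 <= u x <= 1) ->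
  ((`|u x - cell_mean u C c|)%:E <= \int[m]_(y in C) (c^-1 * `|u x - u y|)%:E)%E.
Proof.
move=> mC c0 mCc mu u01.
have u1 y : `|u y| <= 1 by have /andP[h0 h1] := u01 y; rewrite ger0_norm.
have iu := integrable_on_cell mC mCc mu u1.
have ic : m.-integrable C (EFin \o (cst (u x) : T -> R)) by apply: (integrable_on_cell mC mCc) => // y; exact: u1.
have md : measurable_fun setT (fun y => u x - u y) by exact: measurable_funB.
have d1 y : `|u x - u y| <= 1 by exact: norm_sub_itv01.
have id := integrable_on_cell mC mCc md d1.
have -> : u x - cell_mean u C c = Rintegral m C (fun y => u x - u y) / c.
  have mC1 : fine (m C) = c by rewrite mCc.
  have E : Rintegral m C (fun=> u x) = u x * c by rewrite Rintegral_cst// -mC1.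
  by rewrite RintegralB// E mulrBl mulfK// gt_eqF.
rewrite normrM normfV (gtr0_norm c0).
have ind : m.-integrable C (EFin \o (fun y => `|u x - u y|)) by exact: integrable_norm id.
have -> : (\int[m]_(y in C) (c^-1 * `|u x - u y|)%:E = (c^-1 * Rintegral m C (fun y => `|u x - u y|))%:E)%E.
  rewrite EFinM /Rintegral fineK; last exact: integrable_fin_num.
  rewrite -ge0_integralZl//; last by rewrite lee_fin invr_ge0 ltW.
  by apply/measurable_EFinP/measurable_funTS; exact: measurableT_comp.
rewrite lee_fin mulrC ler_pM2l ?invr_gt0//.
exact: le_normr_Rintegral.
Qed.

(** The distance to the mean is at most the mean distance, to which [oscillation_le] applies. Over C
    x C the constant part integrates to c eta; the remaining part is the energy inside C x C, and
    these squares are disjoint for different cells. *)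
Lemma cell_oscillation (u : T -> R) C (c eta del : R) : measurable C -> 0 < c -> m C = c%:E ->
  0 < eta <= 1 -> 0 <= del -> measurable_fun setT u -> (forall x, 0 <= u x <= 1) ->
  (forall x y, C x -> C y -> x <> y -> c^-1 <= del * K (x, y)) ->
  (\int[m]_(x in C) (`|u x - cell_mean u C c|)%:E <=
   (c * eta)%:E + (eta `^ (1 - pp) * del * pp)%:E * \int[m2]_(z in C `*` C) (en u z)%:E)%E.
Proof.
move=> mC c0 mCc eta01 del0 mu u01 cK; have /andP[eta0 eta1] := eta01.
set L := eta `^ (1 - pp) * del * pp.
have L0 : 0 <= L by apply: mulr_ge0 pp0; rewrite mulr_ge0// powR_ge0.
have mCC : measurable (C `*` C) by exact: measurableX.
pose g z := c^-1 * eta + L * en u z.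
have g0 z : 0 <= g z.
  by apply: addr_ge0; [rewrite mulr_ge0 ?invr_ge0 ?(ltW c0) ?(ltW eta0)|exact: mulr_ge0].
have mg : measurable_fun setT g.
  apply: measurable_funD; first exact: measurable_cst.
  by apply: measurable_funM; [exact: measurable_cst|exact: men].
have mgE : measurable_fun setT (EFin \o g) by exact/measurable_EFinP.
apply: (@le_trans _ _ (\int[m]_(x in C) \int[m]_(y in C) (g (x, y))%:E)%E).
  apply: ge0_le_integral => //.
  - apply/measurable_EFinP/measurable_funTS; apply: measurableT_comp => //.
    exact: measurable_funB.
  - apply: measurable_funTS.
    (* Measurability of partial integrals is available over the whole space, so the restriction to C
       moves into the integrand. *)
    have mgC : measurable_fun setT ((EFin \o g) \_ (setT `*` C)).
      by apply/(measurable_restrictT _ (measurableX measurableT mC)); exact: measurable_funTS.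
    have gC0 z : (0 <= ((EFin \o g) \_ (setT `*` C)) z)%E by apply: erestrict_ge0 => w _; rewrite lee_fin.
    have := measurable_fun_fubini_tonelli_F (m2 := m) _ mgC gC0.
    apply: eq_measurable_fun => x _; rewrite /fubini_F [RHS]integral_mkcond.
    by apply: eq_integral => y _; rewrite !patchE in_setX /= in_setT.
  - move=> x Cx; apply: (le_trans (cell_mean_dist x mC c0 mCc mu u01)).
    apply: ge0_le_integral => //.
    + by move=> y _; rewrite lee_fin mulr_ge0// invr_ge0 ltW.
    + apply/measurable_EFinP/measurable_funTS; apply: measurable_funM => //.
      by apply: measurableT_comp => //; exact: measurable_funB.
    + apply/measurable_EFinP/measurable_funTS.
      exact: (measurableT_comp mg (pair1_measurable x)).
    + by move=> y Cy; rewrite lee_fin; apply: oscillation_le => //; exact: cK.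
rewrite -(tonelli_setX m mC mC mgE); last by move=> z; rewrite lee_fin.
have -> : (\int[m2]_(z in C `*` C) (EFin \o g) z = \int[m2]_(z in C `*` C) ((c^-1 * eta)%:E + (L * en u z)%:E))%E.
  by apply: eq_integral => z _.
rewrite ge0_integralD//; last 3 first.
- by move=> z _; rewrite lee_fin mulr_ge0 ?invr_ge0 ?(ltW c0) ?(ltW eta0).
- by move=> z _; rewrite lee_fin mulr_ge0.
- by apply/measurable_EFinP/measurable_funTS; apply: measurable_funM => //; exact: men.
apply: leeD.
  have mm : (m2 (C `*` C) = (c * c)%:E)%E.
    by rewrite product_measure1E// mCc EFinM; congr (_ * _)%E.
  have -> : (\int[m2]_(z in C `*` C) (c^-1 * eta)%:E = (c^-1 * eta)%:E * m2 (C `*` C))%E.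
    exact: integral_cst.
  rewrite mm -EFinM lee_fin.
  by rewrite [leLHS](_ : _ = c * eta)//; field; rewrite gt_eqF.
under eq_integral do rewrite EFinM.
rewrite ge0_integralZl//; last by move=> z _; rewrite lee_fin.
by apply/measurable_EFinP/measurable_funTS; exact: men.
Qed.

Lemma bigsetU_finType (I : finType) (X : Type) (C : I -> set X) :
  \big[setU/set0]_(i <- index_enum I) C i = \bigcup_i C i.
Proof.
rewrite -bigcup_seq; have -> // : [set` index_enum I] = setT.
by apply/seteqP; split => // i _; rewrite /= mem_index_enum.
Qed.

Lemma sum_integral_finType d' (X : measurableType d') (mu : {measure set X -> \bar R})
    (I : finType) (C : I -> set X) (g : X -> \bar R) :
  (forall i, measurable (C i)) -> trivIset setT C -> measurable_fun setT g ->
  (forall x, (0 <= g x)%E) ->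
  (\sum_(i : I) \int[mu]_(x in C i) g x = \int[mu]_(x in \bigcup_i C i) g x)%E.
Proof.
move=> mC tC mg g0; rewrite -bigsetU_finType ge0_integral_bigsetU//.
- exact: index_enum_uniq.
- exact: sub_trivIset tC.
- exact: measurable_funTS.
Qed.

(** On each cell u - w is split through the two means. The two oscillations and the distance of the
    means cost eta each, whence 3 eta V; the energies over the disjoint squares add up to at most B
    for u and for w, whence the factor 2. *)
Lemma cells_L1_close (u w : T -> R) (B eta del c : R) (I : finType) (C : I -> set T) :
  (forall i, measurable (C i)) -> trivIset setT C -> Om `<=` \bigcup_i C i ->
  0 < c -> (forall i, m (C i) = c%:E) -> \sum_(i : I) c <= V ->
  (forall i x y, C i x -> C i y -> x <> y -> c^-1 <= del * K (x, y)) ->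
  0 < eta <= 1 -> 0 <= del ->
  measurable_fun setT u -> (forall x, 0 <= u x <= 1) ->
  measurable_fun setT w -> (forall x, 0 <= w x <= 1) ->
  (\int[m2]_z (en u z)%:E <= B%:E)%E -> (\int[m2]_z (en w z)%:E <= B%:E)%E ->
  (forall i, `|cell_mean u (C i) c - cell_mean w (C i) c| <= eta) ->
  (\int[m]_(x in Om) (`|u x - w x|)%:E <=
    (3 * (eta * V) + 2 * (eta `^ (1 - pp) * del * pp * B))%:E)%E.
Proof.
move=> mC tC OmC c0 mCc cV cK eta01 del0 mu u01 mw w01 uB wB close.
have /andP[eta0 eta1] := eta01.
set L := eta `^ (1 - pp) * del * pp.
have L0 : 0 <= L by apply: mulr_ge0 pp0; rewrite mulr_ge0// powR_ge0.
have mD : measurable (\bigcup_i C i) by rewrite -bigsetU_finType; exact: bigsetU_measurable.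
have md (v : T -> R) : measurable_fun setT v -> forall a : R, measurable_fun setT (fun x => (`|v x - a|)%:E).
  by move=> mv a; apply/measurable_EFinP; apply: measurableT_comp => //; exact: measurable_funB.
have muw : measurable_fun setT (fun x => (`|u x - w x|)%:E).
  by apply/measurable_EFinP; apply: measurableT_comp => //; exact: measurable_funB.
have en_sum (v : T -> R) : measurable_fun setT v -> (\int[m2]_z (en v z)%:E <= B%:E)%E ->
    (\sum_(i : I) \int[m2]_(z in C i `*` C i) (en v z)%:E <= B%:E)%E.
  move=> mv vB; have menv : measurable_fun setT (fun z => (en v z)%:E) by apply/measurable_EFinP; exact: men.
  have mCC i : measurable (C i `*` C i) by exact: measurableX.
  have tCC : trivIset setT (fun i => C i `*` C i).
    move=> i j _ _ [[x y] [[/= ix _] [jx _]]]; apply: (tC i j Logic.I Logic.I).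
    by exists x.
  have en0E z : (0 <= (en v z)%:E)%E by rewrite lee_fin.
  rewrite (sum_integral_finType m2 mCC tCC menv en0E); apply: le_trans vB.
  apply: ge0_subset_integral => //.
  by rewrite -bigsetU_finType; exact: bigsetU_measurable.
apply: (@le_trans _ _ (\int[m]_(x in \bigcup_i C i) (`|u x - w x|)%:E)%E).
  by apply: ge0_subset_integral => //; exact: measurable_funTS.
rewrite -sum_integral_finType//.
apply: (@le_trans _ _ (\sum_(i : I) ((3 * (c * eta))%:E +
   (L%:E * \int[m2]_(z in C i `*` C i) (en u z)%:E + L%:E * \int[m2]_(z in C i `*` C i) (en w z)%:E)))%E).
  apply: lee_sum => i _.
  set a := cell_mean u (C i) c; set b := cell_mean w (C i) c.
  apply: (@le_trans _ _ (\int[m]_(x in C i) ((`|u x - a|)%:E + ((`|w x - b|)%:E + eta%:E)))%E).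
    apply: ge0_le_integral => //.
    - exact: measurable_funTS.
    - apply: measurable_funTS; apply: emeasurable_funD; first exact: md.
      by apply: emeasurable_funD; [exact: md|exact: measurable_cst].
    - move=> x _; rewrite -!EFinD lee_fin.
      have -> : u x - w x = (u x - a) + (- (w x - b) + (a - b)) by ring.
      apply: (le_trans (ler_normD _ _)); rewrite lerD2l.
      by apply: (le_trans (ler_normD _ _)); rewrite normrN lerD2l; exact: close.
  have mui : measurable_fun (C i) (fun x => (`|u x - a|)%:E) by apply: measurable_funTS; exact: md.
  have mwi : measurable_fun (C i) (fun x => (`|w x - b|)%:E) by apply: measurable_funTS; exact: md.
  have eta0' : (0 <= eta%:E)%E by rewrite lee_fin ltW.
  rewrite ge0_integralD//; last 2 first.
  - by move=> x _; rewrite adde_ge0.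
  - exact: emeasurable_funD.
  rewrite ge0_integralD//.
  have -> : (\int[m]_(x in C i) eta%:E = (eta * c)%:E)%E.
    have -> : (\int[m]_(x in C i) eta%:E = eta%:E * m (C i))%E by exact: integral_cst.
    by rewrite mCc.
  have U1 := cell_oscillation (mC i) c0 (mCc i) eta01 del0 mu u01 (@cK i).
  have W1 := cell_oscillation (mC i) c0 (mCc i) eta01 del0 mw w01 (@cK i).
  apply: (le_trans (leeD U1 (leeD W1 (lexx _)))); rewrite -/L.
  have AC (x y : R) (P Q : \bar R) :
      ((x%:E + P) + ((x%:E + Q) + y%:E) = (x + (x + y))%:E + (P + Q))%E.
    rewrite !EFinD -!addeA; congr (_ + _)%E; rewrite addeCA; congr (_ + _)%E.
    by rewrite addeCA addeC -addeA addeCA.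
  by rewrite AC; apply: leeD; [rewrite lee_fin; lra|exact: lexx].
have SL (a : R) (X Y : I -> \bar R) : (forall i, 0 <= X i)%E -> (forall i, 0 <= Y i)%E ->
    (\sum_(i : I) (a%:E + (L%:E * X i + L%:E * Y i)) =
     \sum_(i : I) a%:E + (L%:E * \sum_(i : I) X i + L%:E * \sum_(i : I) Y i))%E.
  by move=> X0 Y0; rewrite 2!big_split !ge0_sume_distrr.
rewrite SL; last 2 first.
- by move=> i; apply: integral_ge0 => z _; rewrite lee_fin.
- by move=> i; apply: integral_ge0 => z _; rewrite lee_fin.
have L0' : (0 <= L%:E)%E by rewrite lee_fin.
have EU := lee_wpmul2l L0' (en_sum u mu uB); have EW := lee_wpmul2l L0' (en_sum w mw wB).
apply: (le_trans (leeD (lexx _) (leeD EU EW))).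
rewrite sumEFin -!EFinM -!EFinD lee_fin -mulr_sumr -mulr_suml.
have := ler_wpM2r (ltW eta0) cV; lra.
Qed.

Lemma sequential_compactness : compact_energy m Om p K.
Proof.
move=> u mu u01 uO [B uB].
have B0 : 0 <= B by rewrite -lee_fin; apply: le_trans (uB 0%N); apply: integral_ge0 => z _; rewrite lee_fin.
have [U [UU Uoo]] := @ultraFilterLemma nat eventually _.
have close (eps : R) : 0 < eps -> exists A, U A /\ forall j k, A j -> A k ->
    (\int[m]_x (`|u j x - u k x|)%:E <= eps%:E)%E.
  move=> eps0.
  have V1 : 0 < V + 1 by rewrite ltr_wpDl.
  (* The 1 in V + 1 pays for the energy part, which the choice of [del] keeps below 2 eta. *)
  pose eta := Num.min 1 (eps / (3 * (V + 1))).
  have eta01 : 0 < eta <= 1.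
    by rewrite lt_min ltr01 ge_min lexx andbT /= divr_gt0// mulr_gt0.
  have /andP[eta0 eta1] := eta01.
  have etaV : 3 * eta * (V + 1) <= eps.
    have : eta <= eps / (3 * (V + 1)) by rewrite ge_min lexx orbT.
    by rewrite ler_pdivlMr ?mulr_gt0// mulrA (mulrC eta).
  have pp_gt0 : 0 < pp by exact: lt_trans pp1.
  pose q := eta `^ (1 - pp) * pp.
  have q0 : 0 < q by rewrite mulr_gt0// powR_gt0.
  (* [eta] is fixed before [del], so the large factor eta^(1 - pp) is compensated by taking finer
     cells. *)
  pose del := eta / (q * (B + 1)).
  have B1 : 0 < B + 1 by rewrite ltr_wpDl.
  have del0 : 0 < del by rewrite /del divr_gt0// mulr_gt0.
  have LB : eta `^ (1 - pp) * del * pp * B <= eta.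
    rewrite [leLHS](_ : _ = eta * (B / (B + 1))); last first.
      rewrite /del /q; field; rewrite !gt_eqF ?powR_gt0//.
    by rewrite ler_piMr ?(ltW eta0)// ler_pdivrMr// mul1r lerDl.
  have fin : 3 * (eta * V) + 2 * (eta `^ (1 - pp) * del * pp * B) <= eps by lra.
  have [I [C [c [mC tC OmC [c0 mCc cV] cK]]]] := cells del0.
  have [|A [UA Aclose]] := @ultra_finite_cauchy R U I (fun k i => cell_mean (u k) (C i) c) eta UU _ eta0.
    by move=> k i; apply: cell_mean_itv.
  exists A; split => // j k Aj Ak.
  have -> : (\int[m]_x (`|u j x - u k x|)%:E = \int[m]_(x in Om) (`|u j x - u k x|)%:E)%E.
    rewrite [RHS]integral_mkcond; apply: eq_integral => x _; rewrite patchE.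
    case: ifPn => // xO; have xO' : ~ Om x by move=> /mem_set; rewrite (negbTE xO).
    by rewrite !uO// subrr normr0.
  apply: (le_trans (cells_L1_close (B := B) (eta := eta) mC tC OmC c0 mCc cV cK eta01 (ltW del0) (mu j) (u01 j) (mu k) (u01 k) (uB j) (uB k) (Aclose j k Aj Ak))).
  by rewrite lee_fin.
have eps0 (n : nat) : 0 < 1 / (2 ^ n.+1)%:R :> R by rewrite divr_gt0// ltr0n expn_gt0.
have /choice[A AP] : forall n : nat, exists A, U A /\ forall j k, A j -> A k ->
    (\int[m]_x (`|u j x - u k x|)%:E <= (1 / (2 ^ n.+1)%:R)%:E)%E.
  by move=> n; exact: close.
(* The index i n lies in A 0, ..., A n, so i k and i (k + 1) both lie in A k and their distance is
   at most 2^-(k + 1). The member of tail indices gives n <= i n. *)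
have /choice[i iP] : forall n : nat, exists k, (n <= k)%N /\ forall l, (l <= n)%N -> A l k.
  move=> n.
  have U1 : U [set k | forall l : 'I_n.+1, A l k].
    by apply: (@filter_forall _ _ (fun (l : 'I_n.+1) => A l) U) => l; have [] := AP l.
  have U2 : U [set k | (n <= k)%N] by apply: Uoo; exists n.
  have [k [h1 h2]] := filter_ex (filterI U1 U2).
  by exists k; split => // l ln; apply: (h1 (Ordinal (ln : (l < n.+1)%N))).
have [|v [mv cv]] := @ae_cvg_of_summable _ _ _ m (fun k => u (i k)) (fun k => mu (i k)).
  move=> k; have [_ h] := AP k; apply: h; first by have [_ h'] := iP k.+1; apply: h'.
  by have [_ h'] := iP k; exact: h'.
exists i, v; split => // k; by have [] := iP k.
Qed.

End compactness.

(** * Completed measures *)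

Section completion_facts.
Context d (T : measurableType d) (R : realType).
Variable mu : {sigma_finite_measure set T -> \bar R}.
Let cT : measurableType _ := caratheodory_type (R := R) (T := T) (mu^*)%mu.
Local Notation cm := (@cmpl d T R mu).

Lemma cmpl_measurable (A : set T) : measurable A -> measurable (A : set cT).
Proof. by move=> mA; apply: sub_caratheodory; apply: sub_sigma_algebra. Qed.

Lemma measurable_id_cmpl : measurable_fun setT (id : cT -> T).
Proof. by move=> _ A mA; rewrite setTI; exact: cmpl_measurable. Qed.

Lemma cmplE (A : set T) : measurable A -> cm A = mu A.
Proof. by move=> mA; rewrite /cmpl /completed_measure_extension measurable_mu_extE. Qed.

Lemma cmpl_complete (A : set cT) : cm.-negligible A -> measurable A.
Proof. exact: measure_is_complete_caratheodory. Qed.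

Lemma measurable_fun_cmpl d' (S : measurableType d') (f : T -> S) :
  measurable_fun setT f -> measurable_fun setT (f : cT -> S).
Proof. by move=> mf; exact: (measurableT_comp mf measurable_id_cmpl). Qed.

Lemma ae_cmpl_measurable (D : set cT) (f g : cT -> R) : measurable D ->
  measurable_fun D f -> {ae cm, forall x, D x -> f x = g x} ->
  measurable_fun D g.
Proof.
move=> mD mf [N [mN N0 fgN]] _ A mA.
have -> : D `&` g @^-1` A = (D `&` f @^-1` A) `\` N `|` (D `&` g @^-1` A `&` N).
  apply/seteqP; split=> [x [Dx gx]|x [[[Dx fx] Nx]|[]//]].
    have [Nx|Nx] := pselect (N x); [by right|left; split=> //; split=> //].
    by rewrite /= (_ : f x = g x)//; apply: contrapT => h; apply: Nx; apply: fgN => /= /(_ Dx).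
  by split=> //; rewrite /= -(_ : f x = g x)//; apply: contrapT => h; apply: Nx; apply: fgN => /= /(_ Dx).
apply: measurableU; first by apply: measurableD => //; exact: mf.
by apply: cmpl_complete; exists N; split=> // x [].
Qed.

Lemma integral_cmpl (f : T -> \bar R) : measurable_fun setT f -> (forall x, 0 <= f x)%E ->
  (\int[cm]_x f x = \int[mu]_x f x)%E.
Proof.
move=> mf f0.
(* The identity is measurable from the completion to the original space, and it pushes the completed
   measure forward to mu. *)
rewrite -[LHS](@ge0_integral_pushforward _ _ cT T R id measurable_id_cmpl cm setT f)//.
apply: eq_measure_integral => [mT B mB|mT A mA _]; first exact: measurable_id_cmpl.
exact: cmplE.
Qed.

Lemma ae_cmpl (P : T -> Prop) : {ae mu, forall x, P x} -> {ae cm, forall x, P x}.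
Proof.
move=> [N [mN N0 NP]]; exists N; split => //; first exact: cmpl_measurable.
by have := cmplE mN; rewrite N0.
Qed.

Lemma integrable_cmpl (f : T -> \bar R) : mu.-integrable setT f ->
  cm.-integrable setT (f : cT -> \bar R) /\ (\int[cm]_x f x = \int[mu]_x f x)%E.
Proof.
move=> /integrableP[mf fi]; split.
  apply/integrableP; split; first exact: measurable_fun_cmpl.
  rewrite integral_cmpl//; exact: measurableT_comp.
rewrite integralE [RHS]integralE; congr (_ - _)%E; apply: integral_cmpl.
- exact: measurable_funepos.
- exact: funepos_ge0.
- exact: measurable_funeneg.
- exact: funeneg_ge0.
Qed.

Lemma integral_cmpl_set (A : set T) (f : T -> \bar R) : measurable A ->
  measurable_fun setT f -> (forall x, 0 <= f x)%E ->
  (\int[cm]_(x in A) f x = \int[mu]_(x in A) f x)%E.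
Proof.
move=> mA mf f0; rewrite integral_mkcond [RHS]integral_mkcond; apply: integral_cmpl.
  by apply/(measurable_restrictT _ mA); exact: measurable_funTS.
by move=> x; apply: erestrict_ge0 => y _.
Qed.

(** The passage from the uncompleted measure, where the equation is derived, to the completed one of
    the weak formulation. There g is only known to agree with f almost everywhere, and completeness
    supplies its measurability. *)
Lemma integrable_ae_cmpl (f g : T -> R) : mu.-integrable setT (EFin \o f) ->
  {ae mu, forall x, f x = g x} ->
  cm.-integrable setT (EFin \o g : cT -> \bar R) /\
  (\int[cm]_x (g x)%:E = \int[mu]_x (f x)%:E)%E.
Proof.
have FF := ae_filter_ringOfSetsType cm.
move=> /integrable_cmpl[cf <-] /ae_cmpl fg.
have mf : measurable_fun setT (f : cT -> R) by apply/measurable_EFinP; exact: measurable_int cf.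
have mg : measurable_fun setT (g : cT -> R).
  apply: (@ae_cmpl_measurable setT f g measurableT mf).
  by apply: filterS fg => x E _.
have E : ae_eq cm setT (EFin \o f : cT -> \bar R) (EFin \o g : cT -> \bar R).
  by apply: filterS fg => x /= E _; rewrite E.
have mEf : measurable_fun setT (EFin \o f : cT -> \bar R) by exact/measurable_EFinP.
have mEg : measurable_fun setT (EFin \o g : cT -> \bar R) by exact/measurable_EFinP.
split; last first.
  have := @ae_eq_integral _ _ _ cm setT (EFin \o f) (EFin \o g) measurableT mEg mEf (ae_eq_sym E).
  by [].
have /integrableP[_ fi] := cf; apply/integrableP; split => //.
suff -> : (\int[cm]_x `|(EFin \o g) x| = \int[cm]_x `|(EFin \o f) x|)%E by [].
apply: ge0_ae_eq_integral.
- exact: measurableT.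
- exact: measurableT_comp.
- exact: measurableT_comp.
- by move=> x _; exact: abse_ge0.
- by move=> x _; exact: abse_ge0.
- by apply: filterS fg => x /= Ex _; rewrite Ex.
Qed.

End completion_facts.

(** * Lebesgue measure on R^N *)

Section boxes.
Variable R : realType.

(* The box A 0 x A 1 x ... x A n; Rb is a nested product, whence the recursion. *)
Fixpoint pset (n : nat) : (nat -> set R) -> set (Rb R n) :=
  match n return (nat -> set R) -> set (Rb R n) with
  | 0 => fun A => A 0%N
  | n'.+1 => fun A => A 0%N `*` @pset n' (fun i => A i.+1)
  end.
Arguments pset : clear implicits.

Lemma measurable_pset n (A : nat -> set R) :
  (forall i, measurable (A i)) -> measurable (pset n A).
Proof.
elim: n A => [|n IH] A mA /=; first exact: mA.
by apply: measurableX; [exact: mA|apply: IH].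
Qed.

Lemma lebB_pset n (A : nat -> set R) (l : R) :
  (forall i, measurable (A i)) -> (forall i, lebesgue_measure (A i) = l%:E) ->
  lebB R n (pset n A) = (l ^+ n.+1)%:E.
Proof.
elim: n A => [|n IH] A mA lA /=; first by rewrite expr1; exact: lA.
transitivity (lebesgue_measure (A 0%N) * lebB R n (pset n (fun i => A i.+1)))%E.
  have mA' : measurable (pset n (fun i => A i.+1)) by apply: measurable_pset => i.
  exact: (product_measure1E (lebR R) (lebB R n) (mA 0%N) mA').
by rewrite lA (IH (fun i => A i.+1))// -EFinM exprS.
Qed.

Lemma pset_vec n (A : nat -> set R) (x : Rb R n) :
  pset n A x <-> forall i : 'I_n.+1, A i (vec R n x ord0 i).
Proof.
elim: n A x => [|n IH] A x /=.
  split=> [Ax i|/(_ ord0)]; last by rewrite mxE.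
  by rewrite mxE (ord1 i).
split=> [[A1 /IH A2] i|H].
  rewrite mxE; case: splitP => j ij; first by rewrite mxE ij (ord1 j).
  by rewrite ij; exact: A2.
split.
  by have := H (@lshift 1 n.+1 ord0); rewrite (@row_mxEl _ 1 1 n.+1) mxE.
apply/IH => i; have := H (@rshift 1 n.+1 i); rewrite (@row_mxEr _ 1 1 n.+1) /=.
by rewrite add1n.
Qed.

Lemma vec_inj n : injective (vec R n).
Proof.
elim: n => [|n IH] x y /=.
  by move=> /matrixP/(_ ord0 ord0); rewrite !mxE.
case: x y => x1 x2 [y1 y2] /= E.
have [E1 E2] := @eq_row_mx _ 1 1 n.+1 _ _ _ _ E.
by congr pair; [move/matrixP: E1 => /(_ ord0 ord0); rewrite !mxE|exact: IH].
Qed.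

Lemma vec_surj n (v : 'rV[R]_n.+1) : exists x, vec R n x = v.
Proof.
elim: n v => [|n IH] v /=.
  by exists (v ord0 ord0); apply/rowP => i; rewrite mxE (ord1 i).
have [y yv] := IH (@rsubmx _ 1 1 n.+1 v).
have E : const_mx ((@lsubmx _ 1 1 n.+1 v) ord0 ord0) = @lsubmx _ 1 1 n.+1 v.
  by apply/rowP => i; rewrite [LHS]mxE (ord1 i).
exists ((@lsubmx _ 1 1 n.+1 v) ord0 ord0, y) => /=.
by rewrite yv E; exact: (@hsubmxK _ 1 1 n.+1 v).
Qed.

(** The solutions are found as functions on [LN]; this inverse carries them to functions of row
    vectors. *)
Definition unvec n (v : 'rV[R]_n.+1) : Rb R n := projT1 (cid (vec_surj v)).

Lemma unvecK n : cancel (@unvec n) (vec R n).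
Proof. by move=> v; rewrite /unvec; case: cid. Qed.

Lemma vecK n : cancel (vec R n) (@unvec n).
Proof. by move=> x; apply: vec_inj; rewrite unvecK. Qed.

Lemma measurable_vec_coord n (i : 'I_n.+1) :
  measurable_fun setT (fun x : Rb R n => vec R n x ord0 i).
Proof.
move=> _ B mB; rewrite setTI.
have -> : (fun x : Rb R n => vec R n x ord0 i) @^-1` B =
   pset n (fun j => if j == i then B else setT).
  apply/seteqP; split => x /=.
    by move=> Bx; apply/pset_vec => j; case: eqP => // /val_inj ->.
  by move=> /pset_vec/(_ i); rewrite eqxx.
by apply: measurable_pset => j; case: ifP.
Qed.

End boxes.

(** * Measurability by countable approximation *)

Section countable_approximation.
Context d (T : measurableType d) (R : realType).

(** On each of the countably many level sets of the key the second argument of g is frozen, so the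
    approximants are measurable, and so is their limit. No sigma-algebra on W enters: the same lemma
    handles Caratheodory functions and continuous functions of row vectors. *)
Lemma measurable_fun_approx (C : countType) (W : Type) (D : set T) (g : T -> W -> R)
    (u : T -> W) (key : nat -> T -> C) (r : nat -> C -> W) :
  measurable D ->
  (forall k c, measurable (D `&` key k @^-1` [set c])) ->
  (forall k c, measurable_fun D (fun x => g x (r k c))) ->
  (forall x, D x -> (fun k => g x (r k (key k x))) @ \oo --> g x (u x)) ->
  measurable_fun D (fun x => g x (u x)).
Proof.
move=> mD mkey mg gcvg.
apply: (@measurable_fun_cvg _ _ _ _ (fun k x => g x (r k (key k x)))) => // k.
move=> _ B mB.
have -> : D `&` (fun x => g x (r k (key k x))) @^-1` B =
    \bigcup_(c : C) ((D `&` key k @^-1` [set c]) `&` (D `&` (fun x => g x (r k c)) @^-1` B)).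
  apply/seteqP; split => [x [Dx Bx]|x [c _ [[Dx <-] [_ Bx]]]]; last by split.
  by exists (key k x).
apply: countable_bigcupT_measurable; first exact: countableP.
by move=> c; apply: measurableI => //; exact: mg.
Qed.

End countable_approximation.

Section row_norm.
Variables (R : realType) (n : nat).
Local Notation V := 'rV[R]_n.+1.
Implicit Types x y : V.

Lemma coord_le_norm x i : `|x ord0 i| <= `|x|.
Proof.
rewrite [`|x|]mx_normrE.
by apply: (@le_bigmax_cond _ _ _ _ (ord0, i) predT (fun ij => `|x ij.1 ij.2|)).
Qed.

Lemma norm_le_coord x (r : R) : 0 <= r -> (forall i, `|x ord0 i| <= r) -> `|x| <= r.
Proof.
move=> r0 xr; rewrite [`|x|]mx_normrE; apply: bigmax_le => // -[i j] _ /=.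
by rewrite (ord1 i).
Qed.

Lemma norm_le_enorm x : `|x| <= enorm x.
Proof.
apply: norm_le_coord => [|i]; first exact: sqrtr_ge0.
rewrite -(sqrtr_sqr (x ord0 i)) ler_wsqrtr// (bigD1 i)//= lerDl.
by apply: sumr_ge0 => j _; exact: sqr_ge0.
Qed.

Lemma enorm_le_norm x : enorm x <= n.+1%:R * `|x|.
Proof.
rewrite -[leRHS]ger0_norm ?mulr_ge0// -sqrtr_sqr ler_wsqrtr//.
apply: (@le_trans _ _ (\sum_(i < n.+1) `|x| ^+ 2)).
  apply: ler_sum => i _; rewrite -real_normK ?num_real//.
  by rewrite lerXn2r ?nnegrE// coord_le_norm.
rewrite sumr_const card_ord -[leLHS]mulr_natl exprMn ler_wpM2r ?sqr_ge0//.
by rewrite expr2 ler_peMr// ler1n.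
Qed.

Lemma enorm_gt0 x : x != 0 -> 0 < enorm x.
Proof. by move=> x0; apply: lt_le_trans (norm_le_enorm x); rewrite normr_gt0. Qed.

Lemma enorm0 : enorm (0 : V) = 0.
Proof.
apply/eqP; rewrite eq_le sqrtr_ge0 andbT; apply: le_trans (enorm_le_norm 0) _.
by rewrite normr0 mulr0.
Qed.

Lemma enormN x : enorm (- x) = enorm x.
Proof. by congr Num.sqrt; apply: eq_bigr => i _; rewrite mxE sqrrN. Qed.

End row_norm.

Section grid.
Variables (R : realType) (n : nat).
Local Notation V := 'rV[R]_n.+1.

Definition gridkey (k : nat) (x : V) : {ffun 'I_n.+1 -> int} :=
  [ffun i => Num.floor (x ord0 i * k.+1%:R)].

Definition gridpt (k : nat) (c : {ffun 'I_n.+1 -> int}) : V :=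
  \row_i ((c i)%:~R / k.+1%:R).

Lemma floor_div_dist (t : R) (k : nat) :
  `|t - (Num.floor (t * k.+1%:R))%:~R / k.+1%:R| <= k.+1%:R^-1.
Proof.
have k0 : 0 < k.+1%:R :> R by rewrite ltr0n.
set m := Num.floor _.
have /andP[h1 h2] : m%:~R <= t * k.+1%:R < (m + 1)%:~R by rewrite -floor_eq.
rewrite intrD in h2.
have -> : t - m%:~R / k.+1%:R = (t * k.+1%:R - m%:~R) / k.+1%:R by field; rewrite gt_eqF.
rewrite normrM normfV (gtr0_norm k0) -[leRHS]mul1r ler_wpM2r ?invr_ge0 ?ltW//.
rewrite ger0_norm; lra.
Qed.

Lemma gridpt_dist k (x : V) : `|x - gridpt k (gridkey k x)| <= k.+1%:R^-1.
Proof.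
apply: norm_le_coord => [|i]; first by rewrite invr_ge0.
by rewrite !mxE ffunE floor_div_dist.
Qed.

Lemma gridpt_cvg (x : V) : (fun k => gridpt k (gridkey k x)) @ \oo --> x.
Proof.
apply/cvgrPdist_le => e e0.
have /cvgrPdist_le/(_ e e0) := @cvg_harmonic R; apply: filterS => k.
rewrite sub0r normrN ger0_norm ?harmonic_ge0// => h.
exact: le_trans (gridpt_dist k x) h.
Qed.

Lemma measurable_gridkey d (T : measurableType d) (u : T -> V) k c :
  (forall i, measurable_fun setT (fun x => u x ord0 i)) ->
  measurable [set x | gridkey k (u x) = c].
Proof.
move=> mu.
have -> : [set x | gridkey k (u x) = c] =
    \bigcap_(i : 'I_n.+1) ((fun x => u x ord0 i * k.+1%:R) @^-1` [set t | (c i)%:~R <= t < (c i + 1)%:~R]).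
  apply/seteqP; split => x /=.
    by move=> <- i _ /=; rewrite ffunE -floor_eq.
  move=> H; apply/ffunP => i; rewrite ffunE; apply/eqP; rewrite floor_eq.
  exact: (H i).
apply: fin_bigcap_measurable; first exact: finite_finset.
move=> i _; rewrite -[X in measurable X]setTI.
have mi : measurable_fun setT (fun x => u x ord0 i * k.+1%:R) by exact: measurable_funM.
apply: mi => //.
rewrite (_ : [set t | _] = `[(c i)%:~R, (c i + 1)%:~R[%classic); first exact: measurable_itv.
by apply/seteqP; split => t /=; rewrite in_itv.
Qed.

Lemma measurable_floor_key d (T : measurableType d) (u : T -> R) (k : nat) (c : int) :
  measurable_fun setT u -> measurable [set x | Num.floor (u x * k.+1%:R) = c].
Proof.
move=> mu.
have mi : measurable_fun setT (fun x => u x * k.+1%:R) by exact: measurable_funM.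
have -> : [set x | Num.floor (u x * k.+1%:R) = c] =
    setT `&` (fun x => u x * k.+1%:R) @^-1` `[c%:~R, (c + 1)%:~R[%classic.
  apply/seteqP; split => x /=.
    by move=> <-; split => //; rewrite in_itv/= -floor_eq.
  by move=> [_]; rewrite in_itv/= -floor_eq => /eqP.
by apply: mi => //; exact: measurable_itv.
Qed.

Lemma floor_div_cvg (t : R) : (fun k => (Num.floor (t * k.+1%:R))%:~R / k.+1%:R) @ \oo --> t.
Proof.
apply/cvgrPdist_le => e e0.
have /cvgrPdist_le/(_ e e0) := @cvg_harmonic R; apply: filterS => k.
rewrite sub0r normrN ger0_norm ?harmonic_ge0// => h.
exact: le_trans (floor_div_dist t k) h.
Qed.

Lemma caratheodory_measurable d (T : measurableType d) (D : set T) (g : T -> R -> R) (u : T -> R) :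
  measurable D -> (forall t, measurable_fun D (g ^~ t)) ->
  (forall x, D x -> continuous (g x)) -> measurable_fun setT u ->
  measurable_fun D (fun x => g x (u x)).
Proof.
move=> mD mg cg mu.
apply: (@measurable_fun_approx _ _ _ int _ D g u
  (fun k x => Num.floor (u x * k.+1%:R)) (fun k c => c%:~R / k.+1%:R)) => //.
- by move=> k c; apply: measurableI => //; exact: measurable_floor_key.
- by move=> x Dx; apply: continuous_cvg; [exact: cg|exact: floor_div_cvg].
Qed.

Lemma continuous_at_measurable d (T : measurableType d) (D : set T) (g : V -> R) (u : T -> V) :
  measurable D -> (forall i, measurable_fun setT (fun x => u x ord0 i)) ->
  (forall x, D x -> {for u x, continuous g}) ->
  measurable_fun D (fun x => g (u x)).
Proof.
move=> mD mu cg.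
apply: (@measurable_fun_approx _ _ _ {ffun 'I_n.+1 -> int} _ D (fun _ => g) u
  (fun k x => gridkey k (u x)) (fun k c => gridpt k c)) => //.
- by move=> k c; apply: measurableI => //; exact: measurable_gridkey.
- by move=> x Dx; apply: continuous_cvg; [exact: cg|exact: gridpt_cvg].
Qed.

Lemma continuous2_measurable d (T : measurableType d) (g : V * V -> R) (u v : T -> V) :
  (forall i, measurable_fun setT (fun x => u x ord0 i)) ->
  (forall i, measurable_fun setT (fun x => v x ord0 i)) ->
  continuous g -> measurable_fun setT (fun x => g (u x, v x)).
Proof.
move=> mu mv cg.
apply: (@measurable_fun_approx _ _ _ ({ffun 'I_n.+1 -> int} * {ffun 'I_n.+1 -> int})%type (V * V)%type setT (fun _ => g)
  (fun x => (u x, v x))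
  (fun k x => (gridkey k (u x), gridkey k (v x))) (fun k c => (gridpt k c.1, gridpt k c.2))) => //.
- move=> k [c1 c2]; rewrite setTI.
  have -> : (fun x => (gridkey k (u x), gridkey k (v x))) @^-1` [set (c1, c2)] =
    [set x | gridkey k (u x) = c1] `&` [set x | gridkey k (v x) = c2].
    by apply/seteqP; split => x /=; [case=> -> ->|case=> -> ->].
  by apply: measurableI; exact: measurable_gridkey.
- move=> x _; apply: continuous_cvg; first exact: cg.
  exact: (cvg_pair (@gridpt_cvg (u x)) (@gridpt_cvg (v x))).
Qed.

End grid.

Section lebesgue_space.
Variables (R : realType) (n : nat).
Local Notation V := 'rV[R]_n.+1.
Local Notation T := (LN R n).
Local Notation m := (lebN R n).
Local Notation N := (n.+1%:R : R).
Local Notation pt := (@pt R n).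

Lemma measurable_pt_coord i : measurable_fun setT (fun x : T => pt x ord0 i).
Proof. by apply: measurable_fun_cmpl; exact: measurable_vec_coord. Qed.

Lemma measurable_pt_fst i : measurable_fun setT (fun z : T * T => pt z.1 ord0 i).
Proof. exact: (measurableT_comp (measurable_pt_coord i) measurable_fst). Qed.

Lemma measurable_pt_snd i : measurable_fun setT (fun z : T * T => pt z.2 ord0 i).
Proof. exact: (measurableT_comp (measurable_pt_coord i) measurable_snd). Qed.

Lemma measurable_pt_continuous2 (g : V * V -> R) : continuous g ->
  measurable_fun setT (fun z : T * T => g (pt z.1, pt z.2)).
Proof.
by apply: continuous2_measurable; [exact: measurable_pt_fst|exact: measurable_pt_snd].
Qed.

Lemma measurable_dist : measurable_fun setT (fun z : T * T => `|pt z.1 - pt z.2|).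
Proof.
apply: (@measurable_pt_continuous2 (fun v => `|v.1 - v.2|)) => v.
by apply: cvg_norm; apply: cvgB; [exact: cvg_fst|exact: cvg_snd].
Qed.

Lemma measurable_enorm : measurable_fun setT (fun z : T * T => enorm (pt z.1 - pt z.2)).
Proof.
rewrite (_ : (fun z => _) = (fun z : T * T => (\sum_i (pt z.1 ord0 i - pt z.2 ord0 i) ^+ 2) `^ (2^-1))).
  apply: (measurableT_comp (measurable_powR _)).
  apply: measurable_sum => i; apply: measurable_funX; apply: measurable_funB.
    exact: measurable_pt_fst.
  exact: measurable_pt_snd.
apply/funext => z; rewrite powR12_sqrt; last by apply: sumr_ge0 => i _; exact: sqr_ge0.
by congr Num.sqrt; apply: eq_bigr => i _; rewrite !mxE.
Qed.

Definition cube (lo : nat -> R) (r : R) : set T :=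
  @pset R n (fun i => `[lo i, lo i + r[%classic).

Lemma measurable_cube lo r : measurable (cube lo r).
Proof. by apply: cmpl_measurable; apply: measurable_pset => i; exact: measurable_itv. Qed.

Lemma lebN_cube lo r : 0 <= r -> m (cube lo r) = (r ^+ n.+1)%:E.
Proof.
move=> r0; transitivity (lebB R n (cube lo r)).
  by apply: cmplE; apply: measurable_pset => i; exact: measurable_itv.
apply: lebB_pset => i; first exact: measurable_itv.
rewrite lebesgue_measure_itv/= lte_fin ltrDl; case: ltP => [_|].
  by rewrite -EFinB addrAC subrr add0r.
by move=> rle0; congr EFin; apply/eqP; rewrite eq_le r0 rle0.
Qed.

Lemma cubeP lo r (x : T) : cube lo r x <-> forall i : 'I_n.+1, lo i <= pt x ord0 i < lo i + r.
Proof.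
rewrite /cube pset_vec; split => H i; have := H i; rewrite /= in_itv; exact.
Qed.

Lemma lebN_ball (x : T) (r : R) : 0 < r ->
  (m [set y | `|pt x - pt y| <= r]%R <= ((3 * r) ^+ n.+1)%:E)%E /\
  measurable [set y : T | `|pt x - pt y| <= r].
Proof.
move=> r0.
have mB : measurable [set y : T | `|pt x - pt y| <= r].
  have md : measurable_fun setT (fun y : T => `|pt x - pt y|).
    exact: (measurableT_comp measurable_dist (pair1_measurable x)).
  rewrite -[X in measurable X]setTI (_ : [set y | _] = (fun y : T => `|pt x - pt y|) @^-1` `]-oo, r]%classic).
    by apply: md => //; exact: measurable_itv.
  by apply/seteqP; split => y /=; rewrite in_itv.
split => //.
pose lo (i : nat) := pt x ord0 (inord i) - r.
(* The norm of row vectors is the maximum norm, so the ball is a closed cube of side 2r. The side 3r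
   makes room for its upper faces in a half-open cube. *)
rewrite -(lebN_cube lo); last by rewrite mulr_ge0// ltW.
apply: le_measure; rewrite ?inE//; first exact: measurable_cube.
move=> y /= xy; apply/cubeP => i.
have := le_trans (coord_le_norm (pt x - pt y) i) xy.
rewrite /lo inord_val !mxE ler_norml => /andP[h1 h2]; apply/andP; split; lra.
Qed.

(** * Dyadic bounds for singular kernels *)

Lemma geometric_nneseries_le (c z : R) : 0 <= c -> 0 <= z < 1 ->
  (\sum_(0 <= j <oo) (c * z ^+ j)%:E <= (c / (1 - z))%:E)%E.
Proof.
move=> c0 /andP[z0 z1]; apply: lime_le.
  by apply: is_cvg_nneseries => k _ _; rewrite lee_fin mulr_ge0// exprn_ge0.
apply: nearW => k; rewrite sumEFin lee_fin -mulr_sumr ler_wpM2l//.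
rewrite -[leRHS]mul1r ler_pdivlMr ?subr_gt0//.
rewrite big_mkord mulrC; have := subrX1 z k.
move=> E; have zk := exprn_ge0 k z0.
have -> : (1 - z) * \sum_(i < k) z ^+ i = 1 - z ^+ k by rewrite -opprB mulNr -E opprB.
lra.
Qed.

(* The balls of radius rho j have measure at most (3 rho j)^(n+1), and k <= a j on the j-th. *)
Lemma shell_integral (x : T) (k : T -> R) (a rho : nat -> R) (c z : R) :
  measurable_fun setT k -> (forall y, 0 <= k y) -> 0 <= c -> 0 <= z < 1 ->
  (forall j, 0 <= a j) -> (forall j, 0 < rho j) ->
  (forall j, a j * (3 * rho j) ^+ n.+1 = c * z ^+ j) ->
  (forall y, k y = 0 \/ exists j, k y <= a j /\ `|pt x - pt y| <= rho j) ->
  (\int[m]_y (k y)%:E <= (c / (1 - z))%:E)%E.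
Proof.
move=> mk k0 c0 z01 a0 rho0 E ky.
apply: le_trans (geometric_nneseries_le c0 z01).
pose B j := [set y : T | `|pt x - pt y| <= rho j].
have mB j : measurable (B j) by have [] := lebN_ball x (rho0 j).
have g0 j y : (0 <= (a j * \1_(B j) y)%:E)%E by rewrite lee_fin mulr_ge0.
have mg j : measurable_fun setT (fun y => (a j * \1_(B j) y)%:E).
  apply/measurable_EFinP; apply: measurable_funM; first exact: measurable_cst.
  exact: measurable_indic.
apply: (@le_trans _ _ (\int[m]_y (\sum_(0 <= j <oo) (a j * \1_(B j) y)%:E))%E).
  apply: ge0_le_integral.
  - exact: measurableT.
  - by move=> y _; rewrite lee_fin.
  - exact/measurable_EFinP.
  - by apply: ge0_emeasurable_sum => // j y _ _; exact: g0.
  - move=> y _; have [->|[j [kj yj]]] := ky y; first by apply: nneseries_ge0 => j _ _; exact: g0.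
    apply: (@le_trans _ _ (a j * \1_(B j) y)%:E); first by rewrite lee_fin indicE mem_set// mulr1.
    apply: (@le_trans _ _ (\sum_(0 <= i < j.+1) (a i * \1_(B i) y)%:E)%E).
      by rewrite big_nat_recr//= leeDr//; apply: sume_ge0 => i _; exact: g0.
    by apply: (@nneseries_lim_ge _ (fun i => (a i * \1_(B i) y)%:E) xpredT 0%N j.+1) => i _ _; exact: g0.
rewrite integral_nneseries//; apply: lee_nneseries => [j _ _|j _].
  by apply: integral_ge0 => y _; exact: g0.
under eq_integral do rewrite EFinM.
have mI : measurable_fun setT (fun y => (\1_(B j) y)%:E : \bar R).
  by apply/measurable_EFinP; exact: measurable_indic.
rewrite ge0_integralZl; [|exact: measurableT|exact: mI|by move=> y _; rewrite lee_fin|by rewrite lee_fin].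
rewrite (integral_indic _ measurableT (mB j)) setIT -E EFinM.
by apply: lee_wpmul2l; [rewrite lee_fin|have [] := lebN_ball x (rho0 j)].
Qed.

(** The power t^-b is cut at t = 1 because the part near 0 is integrable on R^N for b < N and the
    part at infinity for b > N. Kernels of variable exponent are compared with these two. *)
Definition near_kernel (b t : R) : R := t `^ (- b) * \1_(`]0, 1[%classic : set R) t.
Definition far_kernel (b t : R) : R := t `^ (- b) * \1_(`[1, +oo[%classic : set R) t.

Lemma measurable_near_kernel b : measurable_fun setT (near_kernel b).
Proof. by apply: measurable_funM => //; apply: measurable_indic; exact: measurable_itv. Qed.

Lemma measurable_far_kernel b : measurable_fun setT (far_kernel b).
Proof. by apply: measurable_funM => //; apply: measurable_indic; exact: measurable_itv. Qed.

Lemma near_kernel_ge0 b t : 0 <= near_kernel b t.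
Proof. by rewrite mulr_ge0 ?powR_ge0. Qed.

Lemma far_kernel_ge0 b t : 0 <= far_kernel b t.
Proof. by rewrite mulr_ge0 ?powR_ge0. Qed.

Lemma lt_pow2 (t : R) : exists k, t < 2 ^+ k.
Proof.
exists (Num.Def.archi_bound `|t|); apply: (le_lt_trans (ler_norm t)).
apply: (lt_le_trans (archi_boundP (normr_ge0 t))).
by rewrite -natrX ler_nat ltnW// ltn_expl.
Qed.

Lemma powR_pow2 (b : R) (j : nat) : (2 ^+ j) `^ b = (2 `^ b) ^+ j.
Proof.
by rewrite -(powR_mulrn j (ler0n R 2)) -(powR_mulrn j (powR_ge0 2 b)) powRAC.
Qed.

Lemma ltr_powR2 (b c : R) : b < c -> 2 `^ b < 2 `^ c.
Proof. by move=> bc; rewrite /powR gt_eqF// ltr_expR ltr_pM2r// ln_gt0// ltr1n. Qed.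

Lemma near_kernel_shell (b t : R) : 0 <= b -> near_kernel b t = 0 \/
  exists j, near_kernel b t <= (2 `^ b) ^+ j.+1 /\ t <= (2^-1) ^+ j.
Proof.
move=> b0; rewrite /near_kernel indicE.
have [tI|tI] := boolP (t \in _); last by left; rewrite mulr0.
right; move: tI; rewrite inE /= in_itv/= => /andP[t0 t1].
have ex : exists k, (2^-1 ^+ k < t).
  have [k tk] := lt_pow2 t^-1; exists k.
  by rewrite exprVn -[ltRHS]invrK ltf_pV2 ?posrE ?invr_gt0// exprn_gt0.
(* As t < 1, the least k with 2^-k < t is positive; writing it j + 1 gives 2^-(j + 1) < t <=
   2^-j. *)
case: (ex_minnP ex) => [[|j]]; first by rewrite expr0 ltNge (ltW t1).
move=> jt minj; exists j; split; last first.
  by rewrite leNgt; apply/negP => /minj; rewrite ltnn.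
have hb : (2^-1 ^+ j.+1) `^ b = ((2 `^ b) ^+ j.+1)^-1.
  by rewrite exprVn -powR_inv1 ?exprn_ge0// powRAC powR_inv1 ?powR_ge0// powR_pow2.
rewrite mulr1 powRN -[leRHS]invrK -hb lef_pV2 ?posrE ?powR_gt0// ?exprn_gt0 ?invr_gt0//.
by apply: ge0_ler_powR; rewrite ?nnegrE ?exprn_ge0 ?(ltW t0) ?(ltW jt)// invr_ge0.
Qed.

Lemma far_kernel_shell (b t : R) : 0 <= b -> far_kernel b t = 0 \/
  exists j, far_kernel b t <= ((2 `^ b)^-1) ^+ j /\ t <= 2 ^+ j.+1.
Proof.
move=> b0; rewrite /far_kernel indicE.
have [tI|tI] := boolP (t \in _); last by left; rewrite mulr0.
right; move: tI; rewrite inE /= in_itv/= andbT => t1.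
have t0 : 0 < t by exact: lt_le_trans t1.
case: (ex_minnP (lt_pow2 t)) => [[|j]]; first by rewrite expr0 ltNge t1.
move=> jt minj; exists j; split; last exact: ltW.
have tj : 2 ^+ j <= t by rewrite leNgt; apply/negP => /minj; rewrite ltnn.
rewrite mulr1 powRN exprVn -powR_pow2 lef_pV2 ?posrE ?powR_gt0// ?exprn_gt0//.
by apply: ge0_ler_powR; rewrite ?nnegrE ?exprn_ge0 ?(ltW t0).
Qed.

Lemma powR2_natlt (b : R) : b < N -> 2 `^ b < 2 ^+ n.+1.
Proof. by move=> bN; rewrite -powR_mulrn//; exact: ltr_powR2. Qed.

Lemma near_kernel_integral (b : R) : 0 <= b < N -> exists C : R, 0 <= C /\
  forall x : T, (\int[m]_y (near_kernel b `|pt x - pt y|)%:E <= C%:E)%E.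
Proof.
move=> /andP[b0 bN]; set B := 2 `^ b; have B0 : 0 < B by exact: powR_gt0.
(* The j-th shell contributes 2^(b (j + 1)) (3 2^-j)^N, a geometric term of ratio 2^(b - N) < 1. *)
pose z := B * 2^-1 ^+ n.+1.
have z0 : 0 <= z by rewrite mulr_ge0 ?(ltW B0)// exprn_ge0// invr_ge0.
have z1 : z < 1 by rewrite /z exprVn ltr_pdivrMr ?exprn_gt0// mul1r; exact: powR2_natlt.
have c0 : 0 <= B * 3 ^+ n.+1 by rewrite mulr_ge0 ?(ltW B0)// exprn_ge0.
exists (B * 3 ^+ n.+1 / (1 - z)); split; first by rewrite divr_ge0// subr_ge0 ltW.
move=> x; pose k (y : T) := near_kernel b `|pt x - pt y|.
have mk : measurable_fun setT k.
  apply: (measurableT_comp (measurable_near_kernel b)).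
  exact: (measurableT_comp measurable_dist (pair1_measurable x)).
have k0 y : 0 <= k y by exact: near_kernel_ge0.
have z01 : 0 <= z < 1 by rewrite z0.
have a0 j : 0 <= B ^+ j.+1 by rewrite exprn_ge0// ltW.
have rho0 j : 0 < 2^-1 ^+ j :> R by rewrite exprn_gt0// invr_gt0.
have E j : B ^+ j.+1 * (3 * 2^-1 ^+ j) ^+ n.+1 = (B * 3 ^+ n.+1) * z ^+ j.
  by rewrite /z !exprMn exprS (exprAC 2^-1); ring.
have ky y : k y = 0 \/ exists j, k y <= B ^+ j.+1 /\ `|pt x - pt y| <= 2^-1 ^+ j.
  exact: near_kernel_shell.
exact: (shell_integral mk k0 c0 z01 a0 rho0 E ky).
Qed.

Lemma far_kernel_integral (b : R) : N < b -> exists C : R, 0 <= C /\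
  forall x : T, (\int[m]_y (far_kernel b `|pt x - pt y|)%:E <= C%:E)%E.
Proof.
move=> Nb; set B := 2 `^ b; have B0 : 0 < B by exact: powR_gt0.
have b0 : 0 <= b by apply: le_trans (ltW Nb).
(* Here the shells grow, and the ratio is 2^(N - b) < 1. *)
pose z := B^-1 * 2 ^+ n.+1.
have z0 : 0 <= z by rewrite mulr_ge0 ?invr_ge0 ?(ltW B0)// exprn_ge0.
have z1 : z < 1.
  by rewrite /z mulrC ltr_pdivrMr// mul1r /B -powR_mulrn//; exact: ltr_powR2.
have c0 : 0 <= 6 ^+ n.+1 :> R by rewrite exprn_ge0.
exists (6 ^+ n.+1 / (1 - z)); split; first by rewrite divr_ge0// subr_ge0 ltW.
move=> x; pose k (y : T) := far_kernel b `|pt x - pt y|.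
have mk : measurable_fun setT k.
  apply: (measurableT_comp (measurable_far_kernel b)).
  exact: (measurableT_comp measurable_dist (pair1_measurable x)).
have k0 y : 0 <= k y by exact: far_kernel_ge0.
have z01 : 0 <= z < 1 by rewrite z0.
have a0 j : 0 <= B^-1 ^+ j by rewrite exprn_ge0// invr_ge0 ltW.
have rho0 j : 0 < 2 ^+ j.+1 :> R by rewrite exprn_gt0.
have E j : B^-1 ^+ j * (3 * 2 ^+ j.+1) ^+ n.+1 = 6 ^+ n.+1 * z ^+ j.
  have -> : 6 ^+ n.+1 = 3 ^+ n.+1 * 2 ^+ n.+1 :> R by rewrite -exprMn; congr (_ ^+ _); ring.
  by rewrite /z (exprS 2 j) !exprMn (exprAC 2 j); ring.
have ky y : k y = 0 \/ exists j, k y <= B^-1 ^+ j /\ `|pt x - pt y| <= 2 ^+ j.+1.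
  exact: far_kernel_shell.
exact: (shell_integral mk k0 c0 z01 a0 rho0 E ky).
Qed.

End lebesgue_space.

(** * The nonlinearity and its primitive *)

Section primitive.
Context d (T : measurableType d) (R : realType).
Variable h : T -> R -> R.
Hypothesis mh : forall t, measurable_fun setT (h ^~ t).
Hypothesis ch : forall x, continuous (h x).
Hypothesis h_neg : forall x t, t <= 0 -> h x t = 0.

(** For t < 0 the interval is empty and the value 0 is the right one, as h vanishes on t <= 0. *)
Definition primitive (x : T) (t : R) : R := Rintegral (lebR R) [set` `[0, t]] (h x).

Lemma measurable_primitive_at t : measurable_fun setT (primitive ^~ t).
Proof.
pose I : set (RR R) := `[0, t]%classic.
have mI : measurable I by exact: measurable_itv.
have mhh : measurable_fun setT (fun z : T * RR R => h z.1 z.2).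
  apply: (@caratheodory_measurable R _ (T * RR R)%type setT (fun z => h z.1) snd) => //.
  by move=> s; exact: (measurableT_comp (mh s) measurable_fst).
pose g (z : T * RR R) := (h z.1 z.2 * \1_I z.2)%:E.
have mg : measurable_fun setT g.
  apply/measurable_EFinP/measurable_funM => //.
  exact: (measurableT_comp (measurable_indic mI) measurable_snd).
have E x : (\int[lebR R]_(s in I) (h x s)%:E = \int[lebR R]_s g (x, s))%E.
  rewrite integral_mkcond; apply: eq_integral => s _; rewrite /g patchE /= indicE.
  by case: ifPn; rewrite ?mulr1 ?mulr0.
(* Partial integrals are known to be measurable for nonnegative integrands, hence the splitting into
   positive and negative parts. *)
rewrite (_ : (fun x => _) = (fun x => fine (\int[lebR R]_s (g^\+ (x, s))%E - \int[lebR R]_s (g^\- (x, s))%E)%E)).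
  apply: measurableT_comp; first exact: fine_measurable.
  apply: emeasurable_funB.
    apply: (measurable_fun_fubini_tonelli_F (m2 := lebR R) (g^\+)%E) => [|z].
      exact: measurable_funepos.
    exact: funepos_ge0.
  apply: (measurable_fun_fubini_tonelli_F (m2 := lebR R) (g^\-)%E) => [|z].
    exact: measurable_funeneg.
  exact: funeneg_ge0.
apply/funext => x; rewrite /primitive /Rintegral -/I; apply: (congr1 fine).
rewrite E integralE.
by congr (_ - _)%E; apply: eq_integral => s _; rewrite ?funeposE ?funenegE.

Qed.

Lemma integrable_continuous_itv (g : R -> R) (a b : R) : continuous g ->
  (@lebesgue_measure R).-integrable `[a, b] (EFin \o g).
Proof.
move=> cg; apply: continuous_compact_integrable; first exact: segment_compact.
exact: continuous_subspaceT.
Qed.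

Lemma is_derive_primitive (x : T) (t : R) : is_derive t 1 (primitive x) (h x t).
Proof.
(* The fundamental theorem needs a base point strictly to the left of t. Starting at a < 0 changes
   nothing, because h vanishes on [a, 0]. *)
pose a := Num.min 0 t - 1.
have a0 : a < 0 by rewrite /a ltrBlDr (le_lt_trans (_ : _ <= 0))// ?ge_min ?lexx// add0r.
have at_ : a < t by rewrite /a ltrBlDr (le_lt_trans (_ : _ <= t))// ?ge_min ?lexx ?orbT// ltrDl.
have tu : t < t + 1 by rewrite ltrDl.
have int := integrable_continuous_itv a (t + 1) (@ch x).
have [der dE] := continuous_FTC1_closed tu int at_ (@ch x t).
have E : (fun y => Rintegral lebesgue_measure `[a, y] (h x)) = primitive x.
  apply/funext => y; rewrite /primitive /Rintegral; apply: (congr1 fine).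
  rewrite integral_mkcond [RHS]integral_mkcond; apply: eq_integral => s _.
  rewrite !patchE; have [s0|s0] := leP s 0.
    by rewrite h_neg//; do 2 case: ifP.
  by congr (if _ then _ else _); rewrite !mem_setE !in_itv/= (ltW s0) (ltW (lt_trans a0 s0)).
rewrite E in der dE.
by apply: DeriveDef; [exact: der|rewrite -derive1E].
Qed.

Lemma continuous_primitive (x : T) : continuous (primitive x).
Proof.
move=> t; have [d1 _] := is_derive_primitive x t.
exact/differentiable_continuous/derivable1_diffP.
Qed.

Lemma primitive_neg (x : T) (t : R) : t <= 0 -> primitive x t = 0.
Proof.
move=> t0; rewrite /primitive /Rintegral (_ : integral _ _ _ = 0%E)//.
apply: integral0_eq => s; rewrite /= in_itv/= => /andP[s0 st].
by rewrite h_neg// (le_trans st).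
Qed.

Lemma measurable_primitive (v : T -> R) : measurable_fun setT v ->
  measurable_fun setT (fun x => primitive x (v x)).
Proof.
move=> mv; apply: (@caratheodory_measurable R _ _ setT primitive v) => //.
  exact: measurable_primitive_at.
by move=> x _; exact: continuous_primitive.
Qed.

End primitive.

Section nonlinearity.
Variables (R : realType) (n : nat).
Local Notation V := 'rV[R]_n.+1.
Local Notation T := (LN R n).
Local Notation m := (lebN R n).
Local Notation pt := (@pt R n).
Variables (Om : set V) (f : V -> R -> R) (M pp : R) (r : V -> R).
Hypothesis mOm : measurable (pt @^-1` Om : set T).
Hypothesis hf : caratheodory Om f.
Hypothesis growth : forall x t, Om x -> `|f x t| <= M * `|t| `^ (r x - 1).
Hypothesis M0 : 0 <= M.
Hypothesis pp1 : 1 < pp.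
Hypothesis pp_r : forall x, pp <= r x.

(** f(x, .) is continuous for almost every x only. Setting the nonlinearity to 0 off a measurable D
    of full measure in [Om] makes it continuous for every x. *)
Lemma continuity_set : exists D : set T, [/\ measurable D, D `<=` pt @^-1` Om,
  {ae m, forall x, Om (pt x) -> D x} & forall x, D x -> continuous (f (pt x))].
Proof.
have [_ [B [mB B0 sB]]] := hf.
exists (pt @^-1` Om `\` B); split.
- exact: measurableD.
- by move=> x [].
- exists B; split => //; move=> x /= h; apply: contrapT => xB; apply: h => xO.
  by split.
- move=> x [xO xB]; apply: contrapT => h; apply: xB; apply: sB => /= H.
  by apply: h; exact: H.
Qed.

Variables (D : set T) (sg : R).
Hypothesis mD : measurable D.
Hypothesis DOm : D `<=` pt @^-1` Om.
Hypothesis f_cont : forall x, D x -> continuous (f (pt x)).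
Hypothesis sg1 : sg = 1 \/ sg = -1.

(* sg = 1 keeps f on t > 0 and sg = -1 reflects f on t < 0; since f(x,0) = 0 both are
   continuous extensions by 0. *)
Definition half_nonlinearity (x : T) (t : R) :=
  if x \in D then sg * f (pt x) (sg * Num.max 0 t) else 0.
Local Notation h := half_nonlinearity.

Lemma growth_at0 x : Om x -> f x 0 = 0.
Proof.
move=> xO; apply/eqP; rewrite -normr_le0; have := growth 0 xO.
rewrite normr0 powR0 ?mulr0//.
by rewrite subr_eq0 gt_eqF// (lt_le_trans pp1).
Qed.

Lemma norm_sg : `|sg| = 1.
Proof. by case: sg1 => ->; rewrite ?normrN normr1. Qed.

Lemma measurable_half_nonlinearity (t : R) : measurable_fun setT (h ^~ t).
Proof.
have [mf _] := hf.
rewrite (_ : h ^~ t = (fun x : T => sg * f (pt x) (sg * Num.max 0 t)) \_ D); last first.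
  by apply/funext => x; rewrite patchE.
apply/(measurable_restrictT _ mD); apply: measurable_funM; first exact: measurable_cst.
exact: (measurable_funS mOm DOm (mf (sg * Num.max 0 t))).
Qed.

Lemma continuous_half_nonlinearity x : continuous (h x).
Proof.
have [/set_mem xD|xD] := boolP (x \in D); last first.
  by rewrite (_ : h x = cst 0); [move=> t; exact: cvg_cst|apply/funext => t; rewrite /h (negbTE xD)].
rewrite (_ : h x = fun t => sg * f (pt x) (sg * Num.max 0 t)); last first.
  by apply/funext => t; rewrite /h mem_set.
move=> t; apply: cvgM; first exact: cvg_cst.
have c1 : continuous (fun t : R => sg * Num.max 0 t).
  move=> s; apply: cvgM; first exact: cvg_cst.
  by apply: (@normed_module.continuous_max R R^o (cst 0) id); [exact: cvg_cst|exact: cvg_id].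
by apply: (@continuous_comp _ _ _ (fun t : R => sg * Num.max 0 t) (f (pt x))); [exact: c1|exact: f_cont].
Qed.

Lemma half_nonlinearity_neg (x : T) (t : R) : t <= 0 -> h x t = 0.
Proof.
move=> t0; rewrite /h; case: ifPn => // /set_mem xD.
by rewrite max_l// mulr0 growth_at0 ?mulr0//; exact: DOm.
Qed.

Lemma half_nonlinearity_le (x : T) (t : R) : `|t| <= 1 -> `|h x t| <= M * `|t| `^ (pp - 1).
Proof.
move=> t1; have R0 : 0 <= M * `|t| `^ (pp - 1) by rewrite mulr_ge0 ?powR_ge0.
have [t0|t0] := leP t 0; first by rewrite half_nonlinearity_neg// normr0.
rewrite /h; case: ifPn => [/set_mem xD|_ ]; last by rewrite normr0.
rewrite normrM norm_sg mul1r max_r ?(ltW t0)//.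
apply: (le_trans (growth _ (DOm xD))); rewrite normrM norm_sg mul1r.
apply: ler_wpM2l => //; apply: ger_powR; first by rewrite normr_gt0 (gt_eqF t0).
by rewrite lerD2r.
Qed.

Lemma half_nonlinearityE (x : T) (t : R) : D x -> 0 <= t ->
  h x t = sg * f (pt x) (sg * t).
Proof. by move=> xD t0; rewrite /h mem_set// max_r. Qed.

Lemma primitive_half_nonlinearity (x : T) (t : R) : D x -> 0 <= t ->
  primitive h x t = primF f (pt x) (sg * t).
Proof.
move=> xD t0; rewrite /primitive.
have E : Rintegral (lebR R) [set` `[0, t]] (h x) =
    Rintegral (lebR R) [set` `[0, t]] (fun s => sg * f (pt x) (sg * s)).
  apply: eq_Rintegral => s; rewrite inE /= in_itv/= => /andP[s0 _].
  exact: half_nonlinearityE.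
rewrite E; have [->|] := eqVneq t 0.
  by rewrite mulr0 /primF lexx set_itv1 /Rintegral !integral_set1.
move=> tn0; have tp : 0 < t by rewrite lt_neqAle eq_sym tn0.
case: sg1 => ->.
  by rewrite mul1r /primF t0; apply: eq_Rintegral => s _; rewrite !mul1r.
(* The reflection s -> -s carries [0, t] to [-t, 0], and the sign [sg] is the minus of [primF] at
   negative arguments. *)
rewrite mulN1r /primF oppr_ge0 leNgt tp/=.
have cf : {within `[(- t), (- 0)], continuous (f (pt x))}.
  by apply: continuous_subspaceT; exact: f_cont.
rewrite /Rintegral -fineN; apply: (congr1 fine).
have := integration_by_substitution_oppr t0 cf; rewrite oppr0 => ->.
rewrite -integralN /=; last first.
  apply: integrable_add_def; first exact: measurable_itv.
  apply: (integrable_continuous_itv (g := f (pt x) \o -%R)).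
  by move=> s; apply: (@continuous_comp _ _ _ -%R (f (pt x))); [exact: opp_continuous|exact: f_cont].
by apply: eq_integral => s _; rewrite !mulN1r.
Qed.

End nonlinearity.

(** * The fractional problem *)

Section problem.
Variables (R : realType) (n : nat).
Local Notation V := 'rV[R]_n.+1.
Local Notation T := (LN R n).
Local Notation m := (lebN R n).
Local Notation m2 := (m \x m)%E.
Local Notation N := (n.+1%:R : R).
Local Notation pt := (@pt R n).
Variables (Om : set V) (s p mu : V * V -> R) (sm sp pm pp mup L : R).
Hypothesis mOm : measurable (pt @^-1` Om : set T).
Hypothesis s_cont : continuous s.
Hypothesis p_cont : continuous p.
Hypothesis mu_cont : continuous mu.
Hypothesis sm0 : 0 < sm.
Hypothesis sp1 : sp < 1.
Hypothesis s_bd : forall v, sm <= s v <= sp.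
Hypothesis pm1 : 1 < pm.
Hypothesis p_bd : forall v, pm <= p v <= pp.
Hypothesis mu_bd : forall v, 0 < mu v <= mup.
Hypothesis mupN : mup < N.
Hypothesis mu_sym : forall x y, mu (x, y) = mu (y, x).
Hypothesis L1 : 1 <= L.
Hypothesis OmL : forall x, Om x -> `|x| < L.

Let Om' : set T := pt @^-1` Om.

Definition pexp (z : T * T) := p (pt z.1, pt z.2).
Definition fkernel (z : T * T) :=
  (enorm (pt z.1 - pt z.2) `^ (N + s (pt z.1, pt z.2) * p (pt z.1, pt z.2)))^-1.
(** The two indicators turn the Choquard integral over Om x Om into one over the whole product. *)
Definition rkernel (z : T * T) :=
  \1_Om' z.1 * \1_Om' z.2 * (enorm (pt z.1 - pt z.2) `^ mu (pt z.1, pt z.2))^-1.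

Lemma measurable_pexp : measurable_fun setT pexp.
Proof. exact: measurable_pt_continuous2. Qed.

Lemma p_pos v : 0 < p v.
Proof. by have /andP[+ _] := p_bd v; apply: lt_le_trans; exact: lt_trans pm1. Qed.

#[local] Hint Resolve p_pos : core.

Lemma sp_ge0 v : 0 <= s v * p v.
Proof.
by have /andP[s1 _] := s_bd v; rewrite mulr_ge0 ?(ltW (p_pos v))// (le_trans (ltW sm0)).
Qed.

Lemma pexp_bd z : pm <= pexp z <= pp. Proof. exact: p_bd. Qed.

Lemma fkernel_ge0 z : 0 <= fkernel z. Proof. by rewrite invr_ge0 powR_ge0. Qed.

Lemma rkernel_ge0 z : 0 <= rkernel z.
Proof. by rewrite !mulr_ge0// invr_ge0 powR_ge0. Qed.

Lemma measurable_fkernel : measurable_fun setT fkernel.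
Proof.
rewrite (_ : fkernel = (fun z => enorm (pt z.1 - pt z.2) `^ (- (N + s (pt z.1, pt z.2) * p (pt z.1, pt z.2))))).
  apply: measurable_powR2; first exact: measurable_enorm.
  apply: (@measurable_funN _ _ _ _ (fun z => N + s (pt z.1, pt z.2) * p (pt z.1, pt z.2))).
  apply: measurable_funD; first exact: measurable_cst.
  by apply: measurable_funM; exact: measurable_pt_continuous2.
by apply/funext => z; rewrite powRN.
Qed.

Lemma measurable_rkernel : measurable_fun setT rkernel.
Proof.
apply: measurable_funM.
  have mI : measurable_fun setT (\1_Om' : T -> R) by exact: measurable_indic.
  apply: measurable_funM; first exact: (measurableT_comp mI measurable_fst).
  exact: (measurableT_comp mI measurable_snd).
rewrite (_ : (fun z => _) = (fun z : T * T => enorm (pt z.1 - pt z.2) `^ (- mu (pt z.1, pt z.2)))).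
  apply: measurable_powR2; first exact: measurable_enorm.
  apply: (@measurable_funN _ _ _ _ (fun z : T * T => mu (pt z.1, pt z.2))).
  exact: measurable_pt_continuous2.
by apply/funext => z; rewrite powRN.
Qed.

Lemma rkernel_sym x y : rkernel (x, y) = rkernel (y, x).
Proof.
rewrite /rkernel /= mu_sym -(enormN (pt x - pt y)) opprB.
by rewrite (mulrC (\1_Om' x)).
Qed.

Lemma rkernel_supp z : ~ Om' z.1 -> rkernel z = 0.
Proof. by move=> zO; rewrite /rkernel indicE memNset// !mul0r. Qed.

Lemma powRN_le (a e t : R) : 0 < t -> t <= e -> 0 <= a -> (e `^ a)^-1 <= t `^ (- a).
Proof.
move=> t0 te a0; have e0 := lt_le_trans t0 te.
rewrite powRN lef_pV2 ?posrE ?powR_gt0//.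
by apply: ge0_ler_powR; rewrite ?nnegrE ?(ltW t0) ?(ltW e0).
Qed.

Lemma rkernel_le x y : rkernel (x, y) <= near_kernel mup `|pt x - pt y| + \1_Om' y.
Proof.
have /andP[mu0 mule] := mu_bd (pt x, pt y).
rewrite /rkernel /=; have [xO|xO] := boolP (x \in Om'); last first.
  by rewrite indicE (negbTE xO) !mul0r addr_ge0// near_kernel_ge0.
have [yO|yO] := boolP (y \in Om'); last first.
  by rewrite [X in _ * X * _]indicE (negbTE yO) mulr0 mul0r addr_ge0// near_kernel_ge0.
rewrite !indicE xO yO !mul1r.
have [E|xy] := eqVneq (pt x - pt y) 0.
  by rewrite E enorm0 powR0 ?gt_eqF// invr0 addr_ge0// near_kernel_ge0.
have t0 : 0 < `|pt x - pt y| by rewrite normr_gt0.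
have le_e := norm_le_enorm (pt x - pt y).
apply: (le_trans (powRN_le t0 le_e (ltW mu0))).
have [t1|t1] := ltP `|pt x - pt y| 1.
  rewrite /near_kernel indicE mem_set/= ?in_itv/= ?t0// mulr1.
  apply: (@le_trans _ _ (`|pt x - pt y| `^ (- mup))); last by rewrite lerDl.
  by apply: ger_powR; rewrite ?t0 ?(ltW t1)// lerN2.
apply: (@le_trans _ _ 1); last by rewrite lerDr near_kernel_ge0.
rewrite powRN invf_le1 ?powR_gt0//.
by rewrite -[leLHS](powRr0 `|pt x - pt y|); apply: ler_powR => //; exact: ltW.
Qed.

Lemma lebN_bounded : (m Om' < +oo)%E.
Proof.
pose lo (i : nat) : R := - L.
have LL : 0 <= 2 * L by rewrite mulr_ge0// (le_trans ler01).
apply: (@le_lt_trans _ _ (m (@cube R n lo (2 * L)))); last by rewrite lebN_cube// ltry.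
apply: le_measure; rewrite ?inE//; first exact: measurable_cube.
move=> x xO; apply/cubeP => i; have := le_lt_trans (coord_le_norm (pt x) i) (OmL xO).
rewrite ltr_norml /lo => /andP[h1 h2]; apply/andP; split; lra.
Qed.

Lemma rkernel_integral : exists CH : R, 0 <= CH /\
  forall x, (\int[m]_y (rkernel (x, y))%:E <= CH%:E)%E.
Proof.
have mup0 : 0 <= mup < N.
  by have /andP[h1 h2] := mu_bd (0, 0); rewrite mupN andbT (le_trans (ltW h1)).
have [C [C0 HC]] := @near_kernel_integral R n mup mup0.
have mfin : m Om' = (fine (m Om'))%:E by rewrite fineK// ge0_fin_numE// lebN_bounded.
have f0 : 0 <= fine (m Om') by exact: fine_ge0.
exists (C + fine (m Om')); split; first exact: addr_ge0.
move=> x.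
have mn : measurable_fun setT (fun y : T => (near_kernel mup `|pt x - pt y|)%:E).
  apply/measurable_EFinP; apply: (measurableT_comp (measurable_near_kernel mup)).
  exact: (measurableT_comp (@measurable_dist R n) (pair1_measurable x)).
have mI : measurable_fun setT (fun y : T => (\1_Om' y)%:E : \bar R).
  by apply/measurable_EFinP; exact: measurable_indic.
apply: (@le_trans _ _ (\int[m]_y ((near_kernel mup `|pt x - pt y|)%:E + (\1_Om' y)%:E))%E).
  apply: ge0_le_integral.
  - exact: measurableT.
  - by move=> y _; rewrite lee_fin rkernel_ge0.
  - apply/measurable_EFinP.
    exact: (measurableT_comp measurable_rkernel (pair1_measurable x)).
  - exact: emeasurable_funD.
  - by move=> y _; rewrite -EFinD lee_fin rkernel_le.
rewrite ge0_integralD; [|exact: measurableT|by move=> y _; rewrite lee_fin near_kernel_ge0|exact: mn|by move=> y _; rewrite lee_fin|exact: mI].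
rewrite EFinD; apply: leeD; first exact: HC.
by rewrite (integral_indic _ measurableT mOm) setIT -mfin.
Qed.

(** One unit cube outside [Om] suffices. For y in [2L, 2L + 1)^N and x in [Om] the maximum norm of x
    - y is at most 3L + 1, so the Euclidean one is at most D; D >= 1 and the exponent is at most N +
    pp because s < 1. *)
Lemma fkernel_killing : exists kappa : R, 0 < kappa /\
  forall x, Om' x -> (kappa%:E <= \int[m]_(y in ~` Om') (fkernel (x, y))%:E)%E.
Proof.
have L0 : 0 < L by exact: lt_le_trans L1.
pose D := N * (3 * L + 1).
have D1 : 1 <= D.
  by rewrite /D -[leLHS]mul1r; apply: ler_pM => //; [rewrite ler1n|lra].
have D0 : 0 < D by exact: lt_le_trans D1.
have k0 : 0 < (D `^ (N + pp))^-1 by rewrite invr_gt0 powR_gt0.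
exists (D `^ (N + pp))^-1; split => // x xO.
pose B := @cube R n (fun=> 2 * L) 1.
have mB : measurable B by exact: measurable_cube.
have yB y : B y -> 2 * L <= `|pt y| <= 2 * L + 1.
  move/cubeP => yB; apply/andP; split.
    apply: le_trans (coord_le_norm (pt y) ord0); have /andP[h _] := yB ord0.
    by apply: (le_trans h); exact: ler_norm.
  apply: norm_le_coord => [|i]; first lra.
  have /andP[h1 h2] := yB i; rewrite ger0_norm; lra.
have BO : B `<=` ~` Om'.
  by move=> y /yB /andP[h _] /OmL; apply/negP; rewrite -leNgt; lra.
have mk : measurable_fun setT (fun y : T => (fkernel (x, y))%:E).
  by apply/measurable_EFinP; exact: (measurableT_comp measurable_fkernel (pair1_measurable x)).
apply: (@le_trans _ _ (\int[m]_(y in B) (fkernel (x, y))%:E)%E); last first.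
  apply: ge0_subset_integral; [exact: mB|exact: measurableC| |by move=> y _; rewrite lee_fin fkernel_ge0|exact: BO].
  exact: measurable_funTS.
apply: (@le_trans _ _ (\int[m]_(y in B) ((D `^ (N + pp))^-1)%:E)%E).
  have -> : (\int[m]_(y in B) ((D `^ (N + pp))^-1)%:E = ((D `^ (N + pp))^-1)%:E * m B)%E by exact: integral_cst.
  by rewrite lebN_cube// expr1n mule1.
apply: ge0_le_integral.
- exact: mB.
- by move=> y _; rewrite lee_fin ltW.
- exact: measurable_cst.
- exact: measurable_funTS.
- move=> y /yB /andP[h1 h2]; rewrite lee_fin /fkernel /=.
  have xL := OmL xO.
  have xy : pt x - pt y != 0.
    by apply/negP => /eqP/subr0_eq E; move: xL; rewrite E ltNge => /negP; apply; lra.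
  have e0 := enorm_gt0 xy.
  have /andP[s1 s2] := s_bd (pt x, pt y); have /andP[p1 p2] := p_bd (pt x, pt y).
  have sp0 := sp_ge0 (pt x, pt y).
  have spp : s (pt x, pt y) * p (pt x, pt y) <= pp.
    by apply: le_trans p2; rewrite ler_piMl ?(ltW (p_pos _))// ltW// (le_lt_trans s2).
  rewrite lef_pV2 ?posrE ?powR_gt0//.
  apply: (@le_trans _ _ (D `^ (N + s (pt x, pt y) * p (pt x, pt y)))).
    apply: ge0_ler_powR; rewrite ?nnegrE ?addr_ge0 ?(ltW e0) ?(ltW D0)//.
    apply: (le_trans (enorm_le_norm _)); rewrite /D ler_wpM2l//.
    apply: (le_trans (ler_normB _ _)); lra.
  by apply: ler_powR => //; rewrite lerD2l.
Qed.

(** A cube of side h has Euclidean diameter at most N h and measure h^N. The exponent N + sp exceeds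
    N by at least sm pm, so |x - y|^(N + sp) is at most a constant times h^(sm pm) h^N, and a small
    h makes the factor of h^N at most [del]. *)
Lemma fkernel_cells : exists V : R, 0 <= V /\ forall del : R, 0 < del ->
  exists (I : finType) (C : I -> set T) (c : R),
  [/\ forall i, measurable (C i), trivIset setT C, Om' `<=` \bigcup_i C i,
      [/\ 0 < c, (forall i, m (C i) = c%:E) & \sum_(i : I) c <= V] &
      forall i x y, C i x -> C i y -> x <> y -> c^-1 <= del * fkernel (x, y)].
Proof.
have L0 : 0 < L by exact: lt_le_trans L1.
have N0 : 0 < N by rewrite ltr0n.
exists ((2 * L) ^+ n.+1); split; first by rewrite exprn_ge0// mulr_ge0// ltW.
move=> del del0.
pose sg := sm * pm.
have sg0 : 0 < sg by rewrite mulr_gt0// (lt_trans _ pm1).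
pose A := N `^ (N + sg).
have A0 : 0 < A by exact: powR_gt0.
(* The first entry gives N h <= 1, so that lowering the exponent to N + sg increases the power; the
   second gives A h^sg <= del. *)
pose h0 := Num.min N^-1 ((del / A) `^ sg^-1).
have h00 : 0 < h0 by rewrite lt_min invr_gt0 N0 powR_gt0// divr_gt0.
pose M := Num.Def.archi_bound (2 * L / h0).
pose h := 2 * L / M.+1%:R.
have M0 : 0 < M.+1%:R :> R by rewrite ltr0n.
have hpos : 0 < h by rewrite divr_gt0// mulr_gt0.
have hh0 : h <= h0.
  rewrite /h ler_pdivrMr// [leRHS]mulrC -ler_pdivrMr//.
  have : 2 * L / h0 < M%:R by apply: archi_boundP; rewrite divr_ge0// ?mulr_ge0 ?(ltW L0) ?(ltW h00).
  by move=> /ltW h1; apply: (le_trans h1); rewrite ler_nat.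
have Nh1 : N * h <= 1.
  by rewrite mulrC -ler_pdivlMr// mul1r (le_trans hh0)// /h0 ge_min lexx.
have Ahs : A * h `^ sg <= del.
  rewrite mulrC -ler_pdivlMr//.
  apply: (@le_trans _ _ (((del / A) `^ sg^-1) `^ sg)).
    apply: ge0_ler_powR; rewrite ?nnegrE ?powR_ge0 ?(ltW hpos) ?(ltW sg0)//.
    by rewrite (le_trans hh0)// /h0 ge_min lexx orbT.
  by rewrite -powRrM mulVf ?gt_eqF// powRr1// divr_ge0 ?(ltW del0) ?(ltW A0).
have Mh : M.+1%:R * h = 2 * L by rewrite /h mulrC divfK// gt_eqF.
pose I : finType := {ffun 'I_n.+1 -> 'I_M.+1}.
pose lo (c : I) (i : nat) : R := - L + (c (inord i))%:R * h.
pose C (c : I) := @cube R n (lo c) h.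
exists I, C, (h ^+ n.+1).
have CP c (x : T) : C c x <-> forall i : 'I_n.+1, (c i)%:R * h <= pt x ord0 i + L < (c i).+1%:R * h.
  rewrite /C cubeP /lo; split => H i; have := H i; rewrite inord_val -natr1 mulrDl mul1r;
    by move=> /andP[h1 h2]; apply/andP; split; lra.
split.
- by move=> c; exact: measurable_cube.
- move=> c c' _ _ [x [/CP Cx /CP Cx']]; apply/ffunP => i; apply/val_inj => /=.
  have /andP[h1 h2] := Cx i; have /andP[h3 h4] := Cx' i.
  have := le_lt_trans h1 h4; have := le_lt_trans h3 h2.
  rewrite !ltr_pM2r// !ltr_nat !ltnS => l1 l2.
  by apply/eqP; rewrite eqn_leq l1 l2.
- move=> x /OmL xL.
  have tr (i : 'I_n.+1) : 0 <= (pt x ord0 i + L) / h < M.+1%:R.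
    have := le_lt_trans (coord_le_norm (pt x) i) xL; rewrite ltr_norml => /andP[h1 h2].
    rewrite divr_ge0 ?(ltW hpos)//=; last lra.
    rewrite ltr_pdivrMr// Mh; lra.
  exists [ffun i => inord (Num.Def.truncn ((pt x ord0 i + L) / h))] => //.
  apply/CP => i; rewrite ffunE.
  have /andP[t0 tM] := tr i.
  have /andP[h1 h2] := truncn_itv t0.
  have tn : (Num.Def.truncn ((pt x ord0 i + L) / h) < M.+1)%N.
    by rewrite -(ltr_nat R); exact: le_lt_trans tM.
  by rewrite inordK// -ler_pdivlMr// -ltr_pdivrMr// h1 h2.
- split; first exact: exprn_gt0.
    by move=> c; rewrite /C lebN_cube// ltW.
  rewrite sumr_const card_ffun !card_ord -[leLHS]mulr_natl natrX -exprMn Mh//.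
- move=> c x y /CP Cx /CP Cy xy.
  have xyV : pt x - pt y != 0.
    by apply/negP => /eqP/subr0_eq E; apply: xy; exact: (vec_inj E).
  have e0 := enorm_gt0 xyV.
  have tle : `|pt x - pt y| <= h.
    apply: norm_le_coord => [|i]; first exact: ltW.
    have /andP[h1 h2] := Cx i; have /andP[h3 h4] := Cy i.
    rewrite !mxE ler_norml; move: h2 h4; rewrite -natr1 mulrDl mul1r => h2 h4.
    by apply/andP; split; lra.
  have eNh : enorm (pt x - pt y) <= N * h.
    by apply: (le_trans (enorm_le_norm _)); rewrite ler_pM2l.
  have e1 := le_trans eNh Nh1.
  have /andP[s1 s2] := s_bd (pt x, pt y); have /andP[p1 p2] := p_bd (pt x, pt y).
  have sgle : sg <= s (pt x, pt y) * p (pt x, pt y).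
    by apply: ler_pM => //; rewrite ltW// (lt_trans _ pm1).
  have E1 : enorm (pt x - pt y) `^ (N + s (pt x, pt y) * p (pt x, pt y)) <= h ^+ n.+1 * del.
    apply: (@le_trans _ _ (enorm (pt x - pt y) `^ (N + sg))).
      by apply: ger_powR; rewrite ?e0// lerD2l.
    apply: (@le_trans _ _ ((N * h) `^ (N + sg))).
      apply: ge0_ler_powR => //; rewrite ?nnegrE ?(ltW e0)//.
        by rewrite addr_ge0// ltW.
      by rewrite mulr_ge0 ?(ltW hpos)// (ltW N0).
    rewrite powRM ?(ltW hpos)// -/A powRD ?(gt_eqF hpos) ?implybT// powR_mulrn ?(ltW hpos)//.
    by rewrite mulrCA ler_pM2l ?exprn_gt0.
  rewrite /fkernel /= ler_pdivlMr ?powR_gt0// [leLHS]mulrC ler_pdivrMr ?exprn_gt0//.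
  by rewrite [leRHS]mulrC.
Qed.

(** Near the diagonal a <= |x - y| lowers the singularity from N + sp to N + sp - p; away from it a
    <= 1 and the kernel decays by itself. At x = y the bound forces a = 0. *)
Lemma fkernel_lipschitz_le (x y : V) (a b b' : R) : 0 <= a -> a <= `|x - y| -> a <= 1 ->
  N + s (x, y) * p (x, y) - p (x, y) <= b -> b' <= N + s (x, y) * p (x, y) ->
  a `^ p (x, y) * (enorm (x - y) `^ (N + s (x, y) * p (x, y)))^-1 <=
  near_kernel b `|x - y| + far_kernel b' `|x - y|.
Proof.
move=> a0 at_ a1 bb bb'.
have /andP[s1 s2] := s_bd (x, y); have /andP[p1 p2] := p_bd (x, y).
have p0 := p_pos (x, y); have sp0 := sp_ge0 (x, y).
have R0 : 0 <= near_kernel b `|x - y| + far_kernel b' `|x - y|.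
  by rewrite addr_ge0 ?near_kernel_ge0 ?far_kernel_ge0.
have [E|xy] := eqVneq (x - y) 0.
  rewrite E in at_ *; rewrite normr0 in at_.
  have -> : a = 0 by apply/eqP; rewrite eq_le a0 at_.
  by rewrite powR0 ?mul0r ?gt_eqF// -E.
have t0 : 0 < `|x - y| by rewrite normr_gt0.
have le_e := norm_le_enorm (x - y).
have a_nn : 0 <= N + s (x, y) * p (x, y) by rewrite addr_ge0.
have K1 := powRN_le t0 le_e a_nn.
have [t1|t1] := ltP `|x - y| 1.
  apply: (@le_trans _ _ (near_kernel b `|x - y|)); last by rewrite lerDl far_kernel_ge0.
  rewrite /near_kernel indicE mem_set/= ?in_itv/= ?t0// mulr1.
  apply: (@le_trans _ _ (`|x - y| `^ p (x, y) * `|x - y| `^ (- (N + s (x, y) * p (x, y))))).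
    apply: ler_pM; rewrite ?powR_ge0 ?invr_ge0 ?powR_ge0//.
    by apply: ge0_ler_powR; rewrite ?nnegrE ?(ltW p0) ?(ltW t0).
  rewrite -powRD ?(gt_eqF t0) ?implybT//; apply: ger_powR; first by rewrite t0 ltW.
  lra.
apply: (@le_trans _ _ (far_kernel b' `|x - y|)); last by rewrite lerDr near_kernel_ge0.
rewrite /far_kernel indicE mem_set/= ?in_itv/= ?t1// mulr1.
apply: (@le_trans _ _ (1 * `|x - y| `^ (- (N + s (x, y) * p (x, y))))).
  apply: ler_pM; rewrite ?powR_ge0 ?invr_ge0 ?powR_ge0//.
  apply: (@le_trans _ _ (1 `^ p (x, y))); last by rewrite powR1.
  by apply: ge0_ler_powR; rewrite ?nnegrE ?(ltW p0).
by rewrite mul1r; apply: ler_powR => //; rewrite lerN2.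
Qed.

Section bump.
Variables (x0 : T) (rho : R).
Hypothesis rho01 : 0 < rho <= 1.

(** A tent: it is 1-Lipschitz with values in [0, 1], and these are the two bounds on differences
    that [fkernel_lipschitz_le] asks for. *)
Definition bump (x : T) := Num.max 0 (rho - `|pt x0 - pt x|).

Lemma measurable_bump : measurable_fun setT bump.
Proof.
apply: (@measurable_maxr _ _ _ _ (cst 0) (fun x : T => rho - `|pt x0 - pt x|)).
  exact: measurable_cst.
apply: measurable_funB; first exact: measurable_cst.
exact: (measurableT_comp (@measurable_dist R n) (pair1_measurable x0)).
Qed.

Lemma bump_itv x : 0 <= bump x <= 1.
Proof.
have /andP[r0 r1] := rho01; rewrite /bump le_max lexx ge_max ler01/=.
by rewrite lerBlDr (le_trans r1)// lerDl.
Qed.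

Lemma bump_contract x y : `|bump x - bump y| <= `|pt x - pt y|.
Proof.
have H : `|(`|pt x0 - pt x| - `|pt x0 - pt y|)| <= `|pt x - pt y|.
  have -> : `|pt x - pt y| = `|(pt x0 - pt x) - (pt x0 - pt y)|.
    by rewrite opprB [in RHS]addrC [in RHS]addrA subrK distrC.
  exact: ler_dist_dist.
apply: le_trans H; rewrite /bump.
move: (`|pt x0 - pt x|) (`|pt x0 - pt y|) => a b.
have le_max2 (u v : R) : Num.max 0 u - Num.max 0 v <= `|u - v|.
  have := ler_norm (u - v); have := normr_ge0 (u - v); set k := `|_| => h1 h2.
  by case: (leP 0 u) => ?; case: (leP 0 v) => ?; lra.
have E : `|a - b| = `|rho - a - (rho - b)|.
  by rewrite -normrN; congr (`|_|); ring.
by rewrite E ler_norml lerNl opprB le_max2 distrC le_max2.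
Qed.

Lemma bump_neq0 : ~ {ae m, forall x, bump x = 0}.
Proof.
have /andP[r0 r1] := rho01.
move=> [B [mB B0 /= sB]].
pose e := rho / 2.
have e0 : 0 < e by rewrite divr_gt0.
pose C := @cube R n (fun i => pt x0 ord0 (inord i)) e.
have CB : C `<=` B.
  move=> x /cubeP Cx; apply: sB => /= /eqP; rewrite /bump eq_maxl subr_le0 leNgt => /negP; apply.
  apply: (@le_lt_trans _ _ e); last by rewrite /e; lra.
  apply: norm_le_coord => [|i]; first exact: ltW.
  have := Cx i; rewrite inord_val => /andP[h1 h2].
  by rewrite !mxE ler_norml; apply/andP; split; lra.
have : (m C <= m B)%E.
  by apply: le_measure; rewrite ?inE//; exact: measurable_cube.
rewrite B0 lebN_cube ?(ltW e0)// lee_fin leNgt => /negP; apply.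
exact: exprn_gt0.
Qed.

Hypothesis rho_Om : forall x, `|pt x0 - pt x| < rho -> Om (pt x).

Lemma bump_supp x : ~ Om' x -> bump x = 0.
Proof.
move=> xO; rewrite /bump max_l// subr_le0 leNgt; apply/negP => h; exact/xO/rho_Om.
Qed.

Lemma bump_admissible : admissible m Om' pexp fkernel bump.
Proof.
split; [exact: measurable_bump|exact: bump_supp|].
have sp0 : sm <= sp by have /andP[] := s_bd (0, 0) => h1 h2; exact: le_trans h2.
have N1 : 1 <= N by rewrite ler1n.
have pm0 : 0 < pm by exact: lt_trans pm1.
(* N + sp - p = N - p (1 - s) is at most N - pm (1 - sp) < N; the entry 1/2 keeps b nonnegative. *)
pose b := N - Num.min (pm * (1 - sp)) 2^-1.
have d0 : 0 < pm * (1 - sp) by rewrite mulr_gt0// subr_gt0.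
have bN : 0 <= b < N.
  rewrite /b; case: (leP (pm * (1 - sp)) 2^-1) => h; apply/andP; split; lra.
have b'N : N < N + sm * pm by rewrite ltrDl mulr_gt0.
have [C1 [C10 HC1]] := @near_kernel_integral R n b bN.
have [C2 [C20 HC2]] := @far_kernel_integral R n _ b'N.
pose k (z : T * T) := near_kernel b `|pt z.1 - pt z.2| + far_kernel (N + sm * pm) `|pt z.1 - pt z.2|.
have mk1 : measurable_fun setT (fun z : T * T => near_kernel b `|pt z.1 - pt z.2|).
  by apply: (measurableT_comp (measurable_near_kernel b)); exact: measurable_dist.
have mk2 : measurable_fun setT (fun z : T * T => far_kernel (N + sm * pm) `|pt z.1 - pt z.2|).
  by apply: (measurableT_comp (measurable_far_kernel _)); exact: measurable_dist.
have mk : measurable_fun setT k by exact: measurable_funD.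
have k0 z : 0 <= k z by rewrite addr_ge0 ?near_kernel_ge0 ?far_kernel_ge0.
have k_sym x y : k (x, y) = k (y, x) by rewrite /k /= distrC.
have kC (x : T) : (\int[m]_y (k (x, y))%:E <= (C1 + C2)%:E)%E.
  under eq_integral do rewrite EFinD.
  rewrite ge0_integralD.
  - by rewrite EFinD; apply: leeD; [exact: HC1|exact: HC2].
  - exact: measurableT.
  - by move=> y _; rewrite lee_fin near_kernel_ge0.
  - by apply/measurable_EFinP; exact: (measurableT_comp mk1 (pair1_measurable x)).
  - by move=> y _; rewrite lee_fin far_kernel_ge0.
  - by apply/measurable_EFinP; exact: (measurableT_comp mk2 (pair1_measurable x)).
have mI : measurable_fun setT (\1_Om' : T -> R) by exact: measurable_indic.
have I0 x : 0 <= \1_Om' x :> R by rewrite indicE.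
have [i1 i2 _ _] := integrable_weight mk k0 k_sym kC (addr_ge0 C10 C20) mI I0
  (integrable_indic_Om mOm lebN_bounded).
apply: integrable_dominated (integrable_add measurableT i1 i2) => //.
- apply: (measurable_energy_density _ _ pm1 pexp_bd).
  + exact: measurable_pexp.
  + exact: measurable_fkernel.
  + exact: measurable_bump.
- move=> z _; rewrite ger0_norm ?(energy_density_ge0 fkernel_ge0 pm1 pexp_bd)// -mulrDl.
  have /andP[s1 s2] := s_bd (pt z.1, pt z.2); have /andP[p1 p2] := p_bd (pt z.1, pt z.2).
  have P1 : 1 < p (pt z.1, pt z.2) by exact: lt_le_trans p1.
  have P0 : 0 < p (pt z.1, pt z.2) by exact: lt_trans P1.
  have S0 : 0 < s (pt z.1, pt z.2) by exact: lt_le_trans s1.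
  have D1 : `|bump z.1 - bump z.2| <= 1 by apply: norm_sub_itv01; exact: bump_itv.
  have bound : energy_density pexp fkernel bump z <= k z.
    apply: (@le_trans _ _ (`|bump z.1 - bump z.2| `^ p (pt z.1, pt z.2) * fkernel z)).
      rewrite /energy_density; apply: ler_wpM2r; first exact: fkernel_ge0.
      by rewrite /pexp ler_pdivrMr// ler_peMr ?powR_ge0// ltW.
    apply: fkernel_lipschitz_le => //.
    + exact: bump_contract.
    + rewrite /b; have : pm * (1 - sp) <= p (pt z.1, pt z.2) * (1 - s (pt z.1, pt z.2)).
        by apply: ler_pM; [exact: ltW|rewrite subr_ge0 ltW|exact: p1|rewrite lerD2l lerN2].
      have : Num.min (pm * (1 - sp)) 2^-1 <= pm * (1 - sp) by rewrite ge_min lexx.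
      by rewrite mulrBr mulr1; lra.
    + by rewrite lerD2l; apply: ler_pM => //; exact: ltW.
  (* The density vanishes unless one of the two points lies in [Om], so k may be weighted by the sum
     of the indicators, which makes it integrable over the product. *)
  have [z1|z1] := boolP (z.1 \in Om').
    apply: (le_trans bound); rewrite ler_peMl// indicE z1 lerDl//.
  have [z2|z2] := boolP (z.2 \in Om').
    apply: (le_trans bound); rewrite ler_peMl// [X in _ <= _ + X]indicE z2 lerDr//.
  rewrite /energy_density !bump_supp; try by move/mem_set; apply/negP.
  have Pn : pexp z != 0 by rewrite gt_eqF.
  by rewrite subrr normr0 (powR0 Pn) !mul0r mulr_ge0// addr_ge0.
Qed.

End bump.

(** * Transfer to the space X_0 and the weak formulation *)

Local Notation K := fkernel.
Local Notation P := pexp.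
Local Notation adm := (admissible m Om' P K).

Let mprod (A B : set T) : measurable A -> measurable B -> measurable (A `*` B).
Proof. exact: measurableX. Qed.

Lemma measurable_Qset : measurable [set z : T * T | Qset Om (pt z.1, pt z.2)].
Proof.
rewrite (_ : [set z | _] = ~` ((~` Om') `*` (~` Om'))); last first.
  by apply/seteqP; split => z.
by apply: measurableC; apply: mprod; exact: measurableC.
Qed.

Lemma Qset_supp (v : T -> R) (z : T * T) : (forall x, ~ Om' x -> v x = 0) ->
  ~ Qset Om (pt z.1, pt z.2) -> v z.1 - v z.2 = 0.
Proof. by move=> v0 /contrapT[/= h1 h2]; rewrite !v0// subrr. Qed.

(** The density used in X_0, without the factor 1 / p; it is comparable to the energy density since
    1 < p <= pp. *)
Let gagliardo_density (w : T -> R) (z : T * T) := `|w z.1 - w z.2| `^ P z * K z.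

Lemma measurable_gagliardo_density (w : T -> R) : measurable_fun setT w -> measurable_fun setT (gagliardo_density w).
Proof.
move=> mw; apply: measurable_funM; last exact: measurable_fkernel.
apply: measurable_powR2; last exact: measurable_pexp.
apply: measurableT_comp => //; exact: measurable_pairdiff.
Qed.

Lemma gagliardo_density_ge0 (w : T -> R) z : 0 <= gagliardo_density w z.
Proof. by rewrite mulr_ge0 ?powR_ge0 ?fkernel_ge0. Qed.

Lemma finite_energy_admissible (w : T -> R) : measurable_fun setT w -> (forall x, ~ Om' x -> w x = 0) ->
  (\int[m2]_z (gagliardo_density w z)%:E < +oo)%E -> adm w.
Proof.
move=> mw w0 wi; split => //.
apply: integrable_dominated (integrable_lt_pinfty (measurable_gagliardo_density mw)
  (fun z _ => gagliardo_density_ge0 w z) wi) => // [|z _].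
  exact: (measurable_energy_density measurable_pexp measurable_fkernel pm1 pexp_bd).
rewrite ger0_norm ?(energy_density_ge0 fkernel_ge0 pm1 pexp_bd)//.
rewrite /energy_density /gagliardo_density; apply: ler_wpM2r; first exact: fkernel_ge0.
rewrite /pexp ler_pdivrMr// ler_peMr ?powR_ge0//.
by have /andP[+ _] := p_bd (pt z.1, pt z.2); apply: le_trans; exact: ltW.
Qed.

Lemma admissible_X0 (u : T -> R) (U : V -> R) : adm u -> (forall x, `|u x| <= 1) ->
  (forall x, U (pt x) = u x) -> X0 Om s p U.
Proof.
move=> [mu_ u0 ui] u1 UE.
have e1 : (fun x : T => U (pt x)) = u by apply/funext.
split; first by rewrite /measN preimage_setT e1.
split.
  exists 1; split => //; apply: le_lt_trans lebN_bounded.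
  apply: (@le_trans _ _ (\int[m]_(x in Om') (cst 1%:E) x)%E); last first.
    by rewrite integral_cst// mul1e.
  apply: ge0_le_integral.
  - exact: mOm.
  - by move=> x _; rewrite lee_fin powR_ge0.
  - apply/measurable_EFinP/measurable_funTS.
    rewrite (_ : (fun x : T => _) = (fun x => `|u x| `^ p (pt x, pt x))); last first.
      by apply/funext => x; rewrite UE divr1.
    apply: measurable_powR2; first exact: measurableT_comp.
    by apply: (@continuous2_measurable R n _ T p pt pt); [exact: measurable_pt_coord|exact: measurable_pt_coord|exact: p_cont].
  - exact: measurable_cst.
  - move=> x _; rewrite lee_fin UE divr1.
    apply: (@le_trans _ _ (1 `^ p (pt x, pt x))); last by rewrite powR1.
    by apply: ge0_ler_powR; rewrite ?nnegrE// ltW.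
split; last first.
  by apply: aeW => x /u0; rewrite UE.
exists 1; split => //.
pose A : set (T * T) := [set z | Qset Om (pt z.1, pt z.2)].
have mg : measurable_fun setT (EFin \o gagliardo_density u) by apply/measurable_EFinP; exact: measurable_gagliardo_density.
have g0 z : (0 <= (EFin \o gagliardo_density u) z)%E by rewrite lee_fin gagliardo_density_ge0.
have -> : int2N (Qset Om) (fun x y => `|U x - U y| `^ p (x, y) /
    (1 `^ p (x, y) * enorm (x - y) `^ (N + s (x, y) * p (x, y)))) =
    (\int[lebN2 R n]_(z in A) (EFin \o gagliardo_density u) z)%E.
  by apply: eq_integral => z _; rewrite /= powR1 mul1r !UE.
have -> : (\int[lebN2 R n]_(z in A) (EFin \o gagliardo_density u) z = \int[m2]_(z in A) (EFin \o gagliardo_density u) z)%E.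
  exact: (@integral_cmpl_set _ _ _ (prodm m m) A (EFin \o gagliardo_density u) measurable_Qset mg g0).
have pen : m2.-integrable setT (EFin \o (fun z => pp * energy_density P K u z)).
  exact: (integrable_scale _ measurableT ui).
have di : m2.-integrable setT (EFin \o gagliardo_density u).
  apply: integrable_dominated pen => // [|z _]; first exact: measurable_gagliardo_density.
  rewrite ger0_norm ?gagliardo_density_ge0// /gagliardo_density /energy_density mulrA.
  apply: ler_wpM2r; first exact: fkernel_ge0.
  rewrite mulrA mulrAC ler_peMl ?powR_ge0// /pexp ler_pdivlMr// mul1r.
  by have /andP[_] := p_bd (pt z.1, pt z.2).
have /integrableP[_] := integrableS measurableT measurable_Qset (@subsetT _ _) di.
by under eq_integral do rewrite gee0_abs ?lee_fin ?gagliardo_density_ge0//.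
Qed.

Variables (f : V -> R -> R) (alpha : V -> R).

Section signed_test.
Variable sg : R.
Hypothesis sg1 : sg = 1 \/ sg = -1.

(** Elements of X_0 vanish off [Om] almost everywhere, while [admissible] asks it at every point.
    The factor [sg] moves the reflection to the test side: the equation of u tested with sg W is
    that of sg u tested with W. *)
Definition test_function (W : V -> R) (x : T) : R := if x \in Om' then sg * W (pt x) else 0.

Lemma test_function_in (W : V -> R) x : Om' x -> test_function W x = sg * W (pt x).
Proof. by move=> xO; rewrite /test_function mem_set. Qed.

Lemma test_function_out (W : V -> R) x : ~ Om' x -> test_function W x = 0.
Proof. by move=> xO; rewrite /test_function memNset. Qed.

Lemma test_function_ae (W : V -> R) : X0 Om s p W ->
  {ae m, forall x, test_function W x = sg * W (pt x)}.
Proof.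
move=> [_ [_ [_ W0]]]; have FF := ae_filter_ringOfSetsType m.
have W0' : {ae m, forall x, ~ Om' x -> W (pt x) = 0} := W0.
apply: filterS W0' => x {}W0; have [xO|xO] := pselect (Om' x).
  exact: test_function_in.
by rewrite test_function_out// W0// mulr0.
Qed.

Lemma measurable_test_function (W : V -> R) : X0 Om s p W ->
  measurable_fun setT (test_function W).
Proof.
move=> [mW _]; rewrite (_ : test_function W = (fun x : T => sg * W (pt x)) \_ Om'); last first.
  by apply/funext => x; rewrite patchE.
apply/(measurable_restrictT _ mOm); apply: measurable_funM; first exact: measurable_cst.
exact: (measurable_funS (measurableT : measurable (pt @^-1` setT)) (@subsetT _ _) mW).
Qed.

(** By t <= t^a + 1 for a > 1, as [Om] has finite measure and W / l has a finite modular there for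
    some l > 0. *)
Lemma test_function_integrable (W : V -> R) : X0 Om s p W ->
  m.-integrable setT (EFin \o test_function W).
Proof.
move=> WX; have mw := measurable_test_function WX.
have [_ [[l [l0 Wl]] _]] := WX.
pose g (x : T) := l * ((`|test_function W x| / l) `^ p (pt x, pt x) + 1).
have mg : measurable_fun setT (fun x : T => (`|test_function W x| / l) `^ p (pt x, pt x)).
  apply: measurable_powR2.
    apply: measurable_funM; last exact: measurable_cst.
    exact: measurableT_comp.
  by apply: (@continuous2_measurable R n _ T p pt pt); [exact: measurable_pt_coord|exact: measurable_pt_coord|exact: p_cont].
have ns : `|sg| = 1 by exact: norm_sg.
have le_pow (t : R) (a : R) : 1 < a -> 0 <= t -> t <= t `^ a + 1.
  move=> a1 t0; have [t1|t1] := leP t 1; first by rewrite (le_trans t1)// lerDr powR_ge0.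
  rewrite (@le_trans _ _ (t `^ a))// ?lerDl// -[leLHS]powRr1//.
  by apply: ler_powR; exact: ltW.
have gI : m.-integrable Om' (EFin \o g).
  apply: integrable_scale => //; apply: integrable_add => //.
    apply: integrable_lt_pinfty => [|x _|]; [exact: measurable_funTS|exact: powR_ge0|].
    apply: le_lt_trans Wl; rewrite le_eqVlt; apply/predU1P; left.
    by apply: eq_integral => x /set_mem xO; rewrite test_function_in// normrM ns mul1r.
  have := integrable_indic_Om mOm lebN_bounded => /(integrableS measurableT mOm (@subsetT _ _)).
  by apply: eq_integrable => // x xO; rewrite /= indicE xO.
have wI : m.-integrable Om' (EFin \o test_function W).
  apply: integrable_dominated gI => //; first exact: measurable_funTS.
  move=> x _; rewrite /g mulrC -ler_pdivrMr//; apply: le_pow; last by rewrite divr_ge0// ltW.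
  by have /andP[+ _] := p_bd (pt x, pt x); exact: lt_le_trans.
have := (integrable_mkcond (EFin \o test_function W) mOm).1 wI.
rewrite (_ : (EFin \o test_function W) \_ Om' = EFin \o test_function W)//.
apply/funext => x; rewrite patchE; case: ifPn => // /negP xO.
by rewrite /= test_function_out// => /mem_set.
Qed.

Lemma test_function_admissible (W : V -> R) : X0 Om s p W -> adm (test_function W).
Proof.
move=> WX; have mw := measurable_test_function WX.
apply: finite_energy_admissible => //; first exact: test_function_out.
have [mW [_ [[l [l0 Wl]] _]]] := WX.
set w := test_function W.
have ns : `|sg| = 1 by exact: norm_sg.
have mW' : measurable_fun setT (fun x : T => W (pt x)).
  by move: mW; rewrite /measN preimage_setT.
(* The finite integral in X_0 carries the factor l^-p with variable p. It is removed by the constant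
   max(1, l)^pp, which is at least l^p everywhere. *)
pose lb := Num.max 1 l.
have lb1 : 1 <= lb by rewrite le_max lexx.
have pp0 : 0 < pp by have /andP[h1 h2] := p_bd (0, 0); rewrite (lt_le_trans _ h2)// p_pos.
pose A : set (T * T) := [set z | Qset Om (pt z.1, pt z.2)].
pose g (z : T * T) := gagliardo_density (fun x : T => W (pt x)) z / l `^ P z.
have lP0 z : 0 < l `^ P z by exact: powR_gt0.
have mlP : measurable_fun setT (fun z : T * T => l `^ P z).
  by apply: measurable_powR2; [exact: measurable_cst|exact: measurable_pexp].
have mg : measurable_fun setT (EFin \o g).
  apply/measurable_EFinP; apply: measurable_funM; first exact: measurable_gagliardo_density.
  exact: measurable_invr_gt0.
have g0 z : (0 <= (EFin \o g) z)%E by rewrite lee_fin divr_ge0 ?gagliardo_density_ge0// ltW.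
have gA : (\int[m2]_(z in A) (EFin \o g) z < +oo)%E.
  apply: le_lt_trans Wl; rewrite -(@integral_cmpl_set _ _ _ (prodm m m) A (EFin \o g) measurable_Qset mg g0).
  rewrite le_eqVlt; apply/predU1P; left; apply: eq_integral => z _.
  by rewrite /= /g /gagliardo_density /fkernel /pexp invfM; congr (_%:E); ring.
have mdw : measurable_fun setT (EFin \o gagliardo_density w) by apply/measurable_EFinP; exact: measurable_gagliardo_density.
have dw0 z : (0 <= (EFin \o gagliardo_density w) z)%E by rewrite lee_fin gagliardo_density_ge0.
have dwA : (\int[m2]_z (gagliardo_density w z)%:E = \int[m2]_(z in A) (gagliardo_density w z)%:E)%E.
  rewrite [RHS]integral_mkcond; apply: eq_integral => z _; rewrite patchE.
  case: ifPn => // /negP zA; rewrite /gagliardo_density Qset_supp; [|exact: test_function_out|by move=> h; apply: zA; rewrite inE].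
  by rewrite normr0 powR0 ?mul0r// gt_eqF// /pexp.
rewrite dwA.
have lb0 : 0 < lb by exact: lt_le_trans lb1.
have lb_pp0 : 0 < lb `^ pp by exact: powR_gt0.
apply: (@le_lt_trans _ _ (\int[m2]_(z in A) ((lb `^ pp)%:E * (EFin \o g) z))%E).
  apply: ae_ge0_le_integral.
  - exact: measurable_Qset.
  - by move=> z _; exact: dw0.
  - exact: measurable_funTS.
  - by move=> z _; rewrite mule_ge0// lee_fin ltW.
  - by apply: measurable_funTS; exact: measurable_funeM.
  - have FF := ae_filter_ringOfSetsType m2.
    apply: filterS (ae_prod (test_function_ae WX)) => z [E1 E2] _.
    rewrite /= -EFinM lee_fin /g /gagliardo_density /w E1 E2 -mulrBr normrM ns mul1r.
    rewrite mulrCA ler_peMr ?mulr_ge0 ?powR_ge0 ?fkernel_ge0//.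
    rewrite ler_pdivlMr// mul1r.
    have /andP[p1 p2] := p_bd (pt z.1, pt z.2).
    apply: (@le_trans _ _ (lb `^ P z)); last exact: ler_powR.
    apply: ge0_ler_powR; rewrite ?nnegrE ?(ltW l0) ?(ltW lb0)//.
      by rewrite ltW// p_pos.
    by rewrite /lb le_max lexx orbT.
rewrite ge0_integralZl_EFin.
- by rewrite lte_mul_pinfty// lee_fin ltW.
- exact: measurable_Qset.
- by move=> z _; exact: g0.
- exact: measurable_funTS.
- exact: ltW.
Qed.

Variables (alpha' : T -> R) (D : set T) (lam : R).
Hypothesis D_ae : {ae m, forall x, Om' x -> D x}.
Hypothesis f_cont : forall x, D x -> continuous (f (pt x)).
Hypothesis alphaE : forall x, Om' x -> alpha' x = alpha (pt x).
Hypothesis alpha1 : forall x, 1 < alpha' x.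
Local Notation h := (half_nonlinearity f D sg).
Local Notation H := rkernel.

(** Each integrand of the weak formulation agrees, almost everywhere on its domain, with the
    abstract one for the test function sg W; the abstract integrands of the lower order terms vanish
    off that domain. *)
Lemma weak_solution_of (u : T -> R) : adm u -> (forall x, 0 <= u x <= 1) ->
  weakly_stationary m Om' P K H (primitive h) h alpha' lam u ->
  weak_solution Om s p mu alpha f lam (fun v => sg * u (@unvec R n v)).
Proof.
move=> au u01 EL.
have ns : `|sg| = 1 by exact: norm_sg.
have ss : sg * sg = 1 by case: sg1 => ->; rewrite ?mulrNN mulr1.
have UE x : sg * u (@unvec R n (pt x)) = sg * u x by rewrite /Defs.pt vecK.
have u0 x : 0 <= u x by have /andP[] := u01 x.
split.
  apply: (@admissible_X0 (fun x => sg * u x)); last exact: UE.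
    have [mu_ uO ui] := au; split.
    - by apply: measurable_funM => //; exact: measurable_cst.
    - by move=> x xO; rewrite uO// mulr0.
    - rewrite (_ : energy_density P K (fun x => sg * u x) = energy_density P K u)//.
      by apply/funext => z; rewrite /energy_density -mulrBr normrM ns mul1r.
  by move=> x; rewrite normrM ns mul1r ger0_norm//; have /andP[] := u01 x.
move=> W WX /=.
have [iA iB iC E] := EL _ (test_function_admissible WX) (test_function_integrable WX).
set w := test_function W in iA iB iC E.
set A := fun x y : V => _; set B := fun x : V => _; set C := fun x y : V => _.
have wae : {ae m2, forall z, w z.1 = sg * W (pt z.1) /\ w z.2 = sg * W (pt z.2)}.
  exact: (ae_prod (test_function_ae WX)).
have [iA' EA] : integrable2N setT A /\ int2N setT A = (\int[m2]_z (weak_energy P K u w z)%:E)%E.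
  rewrite /integrable2N /int2N preimage_setT.
  apply: (@integrable_ae_cmpl _ _ _ (prodm m m) _ (fun z => A (pt z.1) (pt z.2)) iA).
  have FF := ae_filter_ringOfSetsType (prodm m m).
  apply: filterS wae => z [E1 E2].
  rewrite /A /weak_energy E1 E2 !UE -!mulrBr normrM ns mul1r /fkernel /pexp.
  by ring.
have [iB' EB] : Defs.integrableN Om B /\ intN Om B = (\int[m]_x (weak_concave alpha' u w x)%:E)%E.
  have EO : {in Om', EFin \o weak_concave alpha' u w =1 (fun x : T => (B (pt x))%:E)}.
    move=> x /set_mem xO; congr (_%:E); rewrite /weak_concave /B -alphaE// UE.
    rewrite normrM ns mul1r (ger0_norm (u0 x)) pospow_pos// /w test_function_in//.
    (* For u >= 0 the one-sided power u^(alpha - 1) is u^(alpha - 2) u, also where u = 0. *)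
    rewrite -(@mulr_powRB1 _ (u x) (alpha' x - 1)) ?subr_gt0//.
    by rewrite (_ : alpha' x - 1 - 1 = alpha' x - 2); ring.
  have iO : m.-integrable Om' (EFin \o weak_concave alpha' u w).
    exact: (integrableS measurableT mOm (@subsetT _ _) iB).
  split; first exact: (eq_integrable mOm _ _ EO iO).
  have <- : (\int[m]_(x in Om') (EFin \o weak_concave alpha' u w) x)%E = intN Om B.
    by apply: eq_integral => x; exact: EO.
  rewrite integral_mkcond; apply: eq_integral => x _.
  rewrite patchE; case: ifPn => // /negP xO; rewrite /weak_concave /w test_function_out ?mulr0//.
  by move=> h0; apply: xO; rewrite inE.
have OO_measurable : measurable (Om' `*` Om') by exact: mprod.
pose G := fun z : T * T => C (pt z.1) (pt z.2).
have [iC' EC] : integrable2N (Om `*` Om) C /\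
    int2N (Om `*` Om) C = (\int[m2]_z (weak_choquard H (primitive h) h u w z)%:E)%E.
  (* The primitive and f are the original ones over D only, which fills [Om] up to a null set. *)
  have ae_eqC : {ae prodm m m, forall z, weak_choquard H (primitive h) h u w z = (G \_ (Om' `*` Om')) z}.
    have FF := ae_filter_ringOfSetsType (prodm m m).
    have Dae : {ae prodm m m, forall z, (Om' z.1 -> D z.1) /\ (Om' z.2 -> D z.2)} := ae_prod D_ae.
    apply: filterS Dae => z [D1 D2]; rewrite patchE.
    case: ifPn => [/set_mem[z1 z2]|/negP zO]; last first.
      rewrite /weak_choquard /rkernel; have [z1|z1] := pselect (Om' z.1); last first.
        by rewrite indicE memNset// !mul0r mulr0.
      have z2 : ~ Om' z.2 by move=> z2; apply: zO; rewrite inE.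
      by rewrite [\1_(pt @^-1` Om) z.2]indicE memNset// mulr0 mul0r mulr0.
    rewrite /weak_choquard (primitive_half_nonlinearity f_cont sg1 (D1 z1) (u0 z.1)).
    rewrite (half_nonlinearityE f sg (D2 z2) (u0 z.2)) /w test_function_in//.
    rewrite /rkernel !indicE !mem_set// !mul1r /G /C !UE.
    (* One sign comes from the reflected f and one from the test function. *)
    transitivity ((sg * sg) * (primF f (pt z.1) (sg * u z.1) * f (pt z.2) (sg * u z.2) * W (pt z.2) *
      (enorm (pt z.1 - pt z.2) `^ mu (pt z.1, pt z.2))^-1)); first ring.
    by rewrite ss mul1r.
  have [i1 i2] := @integrable_ae_cmpl _ _ _ (prodm m m) _ (G \_ (Om' `*` Om')) iC ae_eqC.
  have mOO : measurable (Om' `*` Om' : set (LN2 R n)) by exact: cmpl_measurable.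
  have RE : EFin \o (G \_ (Om' `*` Om')) = (EFin \o G) \_ (Om' `*` Om').
    by apply/funext => z; rewrite restrict_EFin.
  split.
    have [_ mk] := @integrable_mkcond _ _ R (lebN2 R n) _ (EFin \o G) mOO.
    by apply: mk; rewrite -RE.
  rewrite -i2 /int2N integral_mkcond; apply: eq_integral => z _.
  by rewrite -[RHS]/((EFin \o (G \_ (Om' `*` Om'))) z) RE.
split => //; rewrite EA EB EC.
rewrite -(fineK (integrable_fin_num measurableT iA)) -(fineK (integrable_fin_num measurableT iB)).
rewrite -(fineK (integrable_fin_num measurableT iC)) -EFinM -EFinD.
exact: (congr1 EFin E).
Qed.

End signed_test.

Hypothesis Om_open : open Om.
Hypothesis Om_nonempty : Om !=set0.
Variables (M : R) (r : V -> R).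
Hypothesis hf : caratheodory Om f.
Hypothesis growth : forall x t, Om x -> `|f x t| <= M * `|t| `^ (r x - 1).
Hypothesis M0 : 0 <= M.
Hypothesis pp_r : forall x, pp <= r x.
Variable alp : R.
Hypothesis alpha_cont : {in Om, continuous alpha}.
Hypothesis alpha_bd : forall x, Om x -> 1 < alpha x <= alp.
Hypothesis alp_pm : alp < pm.

Lemma signed_solution (sg : R) : sg = 1 \/ sg = -1 -> exists Lam : R, 0 < Lam /\
  forall lam, 0 < lam < Lam -> exists u : T -> R,
  [/\ weak_solution Om s p mu alpha f lam (fun v => sg * u (@unvec R n v)),
      (forall x, 0 <= u x) & ~ {ae m, forall x, u x = 0}].
Proof.
move=> sg1.
have [xo xoOm] := Om_nonempty.
have /nbhs_ballP[e /= e0 eOm] : nbhs xo Om by exact: open_nbhs_nbhs.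
pose x0 : T := @unvec R n xo; pose rho := Num.min e 1.
have rho01 : 0 < rho <= 1 by rewrite lt_min e0 ltr01/= ge_min lexx orbT.
have rho_Om x : `|pt x0 - pt x| < rho -> Om (pt x).
  move=> h; apply: eOm; rewrite -ball_normE /= -[xo](@unvecK R n).
  by apply: (lt_le_trans h); rewrite ge_min lexx.
have pp1 : 1 < pp.
  by have /andP[h1 h2] := p_bd (0, 0); exact: lt_le_trans pm1 (le_trans h1 h2).
have [D [mD DOm D_ae f_cont]] := continuity_set mOm hf.
pose h := half_nonlinearity f D sg.
have ch (x : T) : continuous (h x) := @continuous_half_nonlinearity R n f D sg f_cont x.
have mh (t : R) : measurable_fun setT (h ^~ t) by exact: (measurable_half_nonlinearity mOm hf sg mD DOm).
have h_neg (x : T) (t : R) : t <= 0 -> h x t = 0 by exact: (half_nonlinearity_neg growth pp1 pp_r sg DOm).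
have h_le (x : T) (t : R) : `|t| <= 1 -> `|h x t| <= M * `|t| `^ (pp - 1).
  exact: (half_nonlinearity_le growth M0 pp1 pp_r DOm sg1).
(* The exponent is extended by its upper bound so that its bounds hold on the whole space; the
   functions concerned vanish off [Om], so the values there do not matter. *)
pose alpha' (x : T) := if x \in Om' then alpha (pt x) else alp.
have alp1 : 1 < alp by have /andP[] := alpha_bd xoOm; exact: lt_le_trans.
have alpha'1 x : 1 < alpha' x.
  by rewrite /alpha'; case: ifPn => // /set_mem xO; have /andP[] := alpha_bd xO.
have alpha'_le x : alpha' x <= alp.
  by rewrite /alpha'; case: ifPn => // /set_mem xO; have /andP[] := alpha_bd xO.
have malpha : measurable_fun setT alpha'.
  rewrite (_ : alpha' = (fun x => ((fun x : T => alpha (pt x) - alp) \_ Om') x + alp)).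
    apply: measurable_funD; last exact: measurable_cst.
    apply/(measurable_restrictT _ mOm); apply: measurable_funB; last exact: measurable_cst.
    apply: (@continuous_at_measurable R n _ T _ alpha pt mOm) => [i|x xO].
      exact: measurable_pt_coord.
    by apply: alpha_cont; rewrite inE.
  by apply/funext => x; rewrite /alpha' patchE; case: ifP => _; rewrite ?subrK ?add0r.
have [CH [CH0 H_le]] := rkernel_integral.
have [kap [kap0 kap_le]] := fkernel_killing.
have [v0 [v00 cells]] := fkernel_cells.
have cpt := sequential_compactness mOm measurable_pexp measurable_fkernel fkernel_ge0 pm1 pexp_bd v00 cells.
have adm_b := bump_admissible rho01 rho_Om.
have [Lam [Lam0 HL]] := variational_solution mOm lebN_bounded measurable_pexp measurable_fkernel
  fkernel_ge0 pm1 pexp_bd measurable_rkernel rkernel_ge0 rkernel_sym rkernel_supp H_le CH0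
  malpha alpha'1 pp1 (fun v mv => measurable_primitive mh ch h_neg mv)
  (fun v mv => caratheodory_measurable measurableT mh (fun x _ => ch x) mv)
  (is_derive_primitive ch h_neg) (primitive_neg h_neg) h_le M0 kap_le kap0
  alpha'_le alp_pm cpt adm_b (bump_itv x0 rho01) (bump_neq0 rho01).
exists Lam; split => // lam /HL[u [u_adm u01 uN0 EL]].
exists u; split; [|by move=> x; have /andP[] := u01 x|exact: uN0].
apply: (weak_solution_of sg1 D_ae f_cont _ alpha'1 u_adm u01 EL).
by move=> x xO; rewrite /alpha' mem_set.
Qed.

End problem.

Lemma smooth_bounded_measurable (R : realType) (n : nat) (Om : set 'rV[R]_n.+1) :
  smooth_bounded_domain Om -> measurable (@pt R n @^-1` Om : set (LN R n)).
Proof.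
move=> [_ [_ [_ [_ [phi [sphi [-> _]]]]]]].
have [_ cphi] := sphi [::].
have mphi : measurable_fun setT (fun x : LN R n => phi (pt x)).
  apply: (@continuous_at_measurable R n _ (LN R n) _ phi (@pt R n) measurableT) => [i|x _].
    exact: measurable_pt_coord.
  exact: cphi.
rewrite -[X in measurable X]setTI (_ : _ @^-1` _ = (fun x : LN R n => phi (pt x)) @^-1` `]-oo, 0[%classic).
  by apply: mphi => //; exact: measurable_itv.
by apply/seteqP; split => x /=; rewrite in_itv.
Qed.

Lemma bounded_set_norm_lt (R : realType) (n : nat) (Om : set 'rV[R]_n.+1) :
  bounded_set Om -> exists L : R, 1 <= L /\ forall x, Om x -> `|x| < L.
Proof.
move=> [M0 [_ hM]]; exists (Num.max 1 (M0 + 2)); split; first by rewrite le_max lexx.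
move=> x /(hM (M0 + 1)) h; rewrite lt_max; apply/orP; right.
by rewrite (le_lt_trans (h _))// ?ltrD2l ?ltrDl// ltr1n.
Qed.

Lemma setT_continuous (X : topologicalType) (Y : topologicalType) (g : X -> Y) :
  {within setT, continuous g} -> continuous g.
Proof.
by rewrite (continuous_open_subspace _ openT) => cg x; apply: cg; rewrite inE.
Qed.

Lemma inff_le (R : realType) (X : Type) (D : set X) (g : X -> R) x :
  has_lbound (g @` D) -> D x -> inff D g <= g x.
Proof. by move=> gb Dx; apply: ge_inf => //; exists x. Qed.

Lemma le_supf (R : realType) (X : Type) (D : set X) (g : X -> R) x :
  has_ubound (g @` D) -> D x -> g x <= supf D g.
Proof. by move=> gb Dx; apply: ub_le_sup => //; exists x. Qed.

Theorem theorem2p3 (R : realType) (n : nat) (hN : (1 <= n)%N)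
  (Om : set 'rV[R]_(n.+1)) (hOm : smooth_bounded_domain Om)
  (* s *)
  (s : 'rV[R]_(n.+1) * 'rV[R]_(n.+1) -> R) (hs_cont : continuous s)
  (hs_sym : forall x y, s (x, y) = s (y, x))
  (hs_bd : has_lbound (range s) /\ has_ubound (range s))
  (hs : 0 < inff setT s /\ inff setT s <= supf setT s /\ supf setT s < 1)
  (* p *)
  (p : 'rV[R]_(n.+1) * 'rV[R]_(n.+1) -> R) (hp : Cplus setT p)
  (hp_sym : forall x y, p (x, y) = p (y, x))
  (hsp : supf setT s * supf setT p < n.+1%:R)
  (* mu *)
  (mu : 'rV[R]_(n.+1) * 'rV[R]_(n.+1) -> R)
  (hmu_sym : forall x y, mu (x, y) = mu (y, x))
  (hmu_bd : has_lbound (range mu) /\ has_ubound (range mu))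
  (hmu : 0 < inff setT mu /\ inff setT mu <= supf setT mu /\ supf setT mu < n.+1%:R)
  (* q *)
  (q : 'rV[R]_(n.+1) * 'rV[R]_(n.+1) -> R) (hq : Cplus setT q)
  (hqmu : forall x y, 2 / q (x, y) + mu (x, y) / n.+1%:R = 2)
  (* f *)
  (f : 'rV[R]_(n.+1) -> R -> R) (hf : caratheodory Om f)
  (* (F1) *)
  (M : R) (hM : 0 < M) (r : 'rV[R]_(n.+1) -> R) (hr : Cplus setT r)
  (hr_bounds : forall x : 'rV[R]_(n.+1),
     p (x, x) <= r x * inff setT q /\ r x * inff setT q <= r x * supf setT q /\
     r x * supf setT q < n.+1%:R * p (x, x) / (n.+1%:R - s (x, x) * p (x, x)))
  (hr_p : supf setT p < inff setT r)
  (hf_growth : forall x t, Om x -> `|f x t| <= M * `|t| `^ (r x - 1))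
  (* (F2) *)
  (Theta : R) (hTheta : supf setT p < Theta)
  (hAR : forall t : R, t != 0 ->
     aeN (fun x => Om x ->
       0 < Theta * primF f x t /\ Theta * primF f x t <= 2 * t * f x t))
  (* alpha *)
  (alpha : 'rV[R]_(n.+1) -> R) (halpha : Cplus (closure Om) alpha)
  (halpha_p : supf (closure Om) alpha < inff setT p) :
  exists Lam : R, 0 < Lam /\
    forall lam : R, 0 < lam < Lam ->
      exists u1 u2 : 'rV[R]_(n.+1) -> R,
        [/\ weak_solution Om s p mu alpha f lam u1,
            weak_solution Om s p mu alpha f lam u2,
            nontrivial u1, nontrivial u2 & distinct u1 u2].
Proof.
have mOm := smooth_bounded_measurable hOm.
have [Om_open [Om0 [_ [/bounded_set_norm_lt[L [L1 OmL]] _]]]] := hOm.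
have [s_lb s_ub] := hs_bd; have [sm0 [_ sp1]] := hs.
have s_bd v : inff setT s <= s v <= supf setT s by rewrite inff_le// le_supf.
have [/setT_continuous p_cont [p_lb [p_ub pm1]]] := hp.
have p_bd v : inff setT p <= p v <= supf setT p by rewrite inff_le// le_supf.
have [mu_lb mu_ub] := hmu_bd; have [mu0 [_ mupN]] := hmu.
have mu_bd v : 0 < mu v <= supf setT mu by rewrite (lt_le_trans mu0) ?inff_le// le_supf.
have [/setT_continuous q_cont [q_lb [q_ub q1]]] := hq.
have q0 v : 0 < q v by rewrite (lt_trans ltr01)// (lt_le_trans q1)// inff_le.
have N0 : n.+1%:R != 0 :> R by rewrite pnatr_eq0.
(* The relation with q reads mu = N (2 - 2 / q), and q is continuous and positive. *)
have mu_cont : continuous mu.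
  rewrite (_ : mu = (fun v => n.+1%:R * (2 - 2 / q v))); last first.
    apply/funext => -[x y]; have := hqmu x y; move: (2 / q (x, y)) => t h.
    by rewrite -h addrAC subrr add0r mulrC divfK.
  move=> v; apply: cvgM; first exact: cvg_cst.
  apply: cvgB; first exact: cvg_cst.
  apply: cvgM; first exact: cvg_cst.
  by apply: cvgV; [rewrite gt_eqF|exact: q_cont].
have [_ [r_lb _]] := hr.
have pp_r x : supf setT p <= r x by apply: (le_trans (ltW hr_p)); exact: inff_le.
have [a_within [a_lb [a_ub a1]]] := halpha.
have a_cont : {in Om, continuous alpha}.
  by rewrite -(continuous_open_subspace _ Om_open); apply: continuous_subspaceW a_within; exact: subset_closure.
have a_bd x : Om x -> 1 < alpha x <= supf (closure Om) alpha.
  move=> /subset_closure xO; rewrite le_supf// andbT.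
  by rewrite (lt_le_trans a1)// inff_le.
have sol := signed_solution mOm hs_cont p_cont mu_cont sm0 sp1 s_bd pm1 p_bd mu_bd mupN
  hmu_sym L1 OmL Om_open Om0 hf hf_growth (ltW hM) pp_r a_cont a_bd halpha_p.
have [L2 [L20 sol1]] := sol 1 (or_introl erefl).
have [L3 [L30 sol2]] := sol (-1) (or_intror erefl).
exists (Num.min L2 L3); split; first by rewrite lt_min L20.
move=> lam /andP[lam0]; rewrite lt_min => /andP[lam2 lam3].
have [|u [uw u0 uN]] := sol1 lam; first by rewrite lam0.
have [|v [vw v0 vN]] := sol2 lam; first by rewrite lam0.
have FF := ae_filter_ringOfSetsType (lebN R n).
exists (fun x => 1 * u (@unvec R n x)), (fun x => -1 * v (@unvec R n x)); split => //.
- move=> h; apply: uN.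
  have : {ae lebN R n, forall x, 1 * u (@unvec R n (pt x)) = 0} := h.
  by apply: filterS => x; rewrite /pt vecK mul1r.
- move=> h; apply: vN.
  have : {ae lebN R n, forall x, -1 * v (@unvec R n (pt x)) = 0} := h.
  by apply: filterS => x; rewrite /pt vecK mulN1r => /eqP; rewrite oppr_eq0 => /eqP.
(* If a nonnegative and a nonpositive function agree almost everywhere, both vanish there, against
   the nontriviality of u. *)
- move=> h; apply: uN.
  have : {ae lebN R n, forall x, 1 * u (@unvec R n (pt x)) = -1 * v (@unvec R n (pt x))} := h.
  apply: filterS => x; rewrite /pt vecK mul1r mulN1r => E.
  by apply/eqP; rewrite eq_le u0 andbT E oppr_le0.
Qed.
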